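(* Let $(R,\mathfrak m)$ be a regular local ring of characteristic $p>0$ and dimension $d$. If $I$ is an ideal of $R$ such that $R/I$ is $F$-full (for example, $F$-pure), then for every $i$ such that $\operatorname{H}^i_{\mathfrak m}(R/I)\neq 0$ we have $$\liminf_{n\to\infty}\frac{\lambda(\operatorname{H}^i_{\mathfrak m}(R/I^n))}{n^d}>0.$$
   Context: $\lambda(-)$ denotes length and $\operatorname{H}^i_{\mathfrak m}(-)$ local cohomology. For a Noetherian local ring $(R,\mathfrak m)$ of characteristic $p>0$ and an ideal $I$, $R/I$ is called $F$-full if the natural map $\operatorname{H}^i_{\mathfrak m}(R/J)\to\operatorname{H}^i_{\mathfrak m}(R/I)$ is surjective for every $i$ and every ideal $J$ with $J\subseteq I\subseteq\sqrt J$. A ring $S$ of characteristic $p>0$ with Frobenius endomorphism $\mathcal F:S\to S$, $\mathcal F(x)=x^p$, is $F$-pure if $\mathcal F\otimes M: S\otimes_S M\to S\otimes_S M$ (where the target copy of $S$ is an $S$-module via $\mathcal F$) is injective for every $S$-module $M$. *)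

(* Defs.v *)
From HB Require Import structures.
From mathcomp Require Import all_boot all_order all_algebra.
From mathcomp Require Import ring.
From mathcomp Require Import all_classical all_reals all_analysis.
Set Implicit Arguments.
Unset Strict Implicit.
Unset Printing Implicit Defensive.
Import Order.TTheory GRing.Theory Num.Theory.
Local Open Scope classical_set_scope.
Local Open Scope quotient_scope.
Local Open Scope ring_scope.

Record submodule (R : pzRingType) (M : lmodType R) := Submodule {
  submodule_set :> set M;
  submodule0 : submodule_set 0;
  submoduleP : forall a u v,
    submodule_set u -> submodule_set v -> submodule_set (a *: u + v) }.

(* [submodule_set] only makes [N] usable as a set; this allows writing [N u]. *)
Definition submodule_mem (R : pzRingType) (M : lmodType R) (N : submodule M) :
  M -> Prop := submodule_set N.
Coercion submodule_mem : submodule >-> Funclass.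

Section SubmoduleTheory.
Context (R : pzRingType) (M : lmodType R) (N : submodule M).

Lemma submoduleD u v : N u -> N v -> N (u + v).
Proof. by move=> Nu Nv; rewrite -[u]scale1r; exact: submoduleP. Qed.

Lemma submoduleZ a u : N u -> N (a *: u).
Proof.
by move=> Nu; rewrite -[_ *: _]addr0; apply: submoduleP => //; exact: submodule0.
Qed.

Lemma submoduleN u : N u -> N (- u).
Proof. by move=> Nu; rewrite -scaleN1r; exact: submoduleZ. Qed.

Lemma submoduleB u v : N u -> N v -> N (u - v).
Proof. by move=> Nu Nv; apply: submoduleD => //; exact: submoduleN. Qed.

End SubmoduleTheory.

Section Generated.
Context (R : pzRingType) (M : lmodType R) (A : set M).

Let generated_set : set M := [set u | forall N : submodule M, A `<=` N -> N u].

Let generated0 : generated_set 0. Proof. by move=> N _; exact: submodule0. Qed.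

Let generatedP a u v : generated_set u -> generated_set v -> generated_set (a *: u + v).
Proof. by move=> uA vA N AN; apply: submoduleP; [exact: uA|exact: vA]. Qed.

Definition generated : submodule M := Submodule generated0 generatedP.

End Generated.

Definition ideal (R : comPzRingType) := submodule R^o.

Section Ideals.
Context (R : comPzRingType).
Implicit Types I J P : ideal R.

Definition generated_ideal (A : set R) : ideal R := generated (M := R^o) A.

Definition ideal_mul I J : ideal R :=
  generated_ideal [set c | exists a b : R, [/\ I a, J b & c = a * b]].

Fixpoint ideal_pow I (n : nat) : ideal R :=
  if n is n'.+1 then ideal_mul I (ideal_pow I n') else generated_ideal setT.

Definition radical I : set R := [set a | exists n : nat, I (a ^+ n)].

Definition finitely_generated I : Prop :=
  exists s : seq R, (I : set R) = generated_ideal [set` s].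

Definition noetherian : Prop := forall I, finitely_generated I.

Definition prime_ideal P : Prop :=
  ~ P 1 /\ forall a b : R, P (a * b) -> P a \/ P b.

Definition maximal_ideal P : Prop :=
  ~ P 1 /\ forall J, P `<=` J -> ~ J 1 -> J `<=` P.

Definition local_ring (m : ideal R) : Prop :=
  maximal_ideal m /\ forall P, maximal_ideal P -> (P : set R) = m.

Definition has_prime_chain (k : nat) : Prop :=
  exists P : nat -> ideal R, (forall j, (j <= k)%N -> prime_ideal (P j)) /\
    (forall j, (j < k)%N -> P j `<` P j.+1).

Definition krull_dim (d : nat) : Prop :=
  has_prime_chain d /\ forall k, has_prime_chain k -> (k <= d)%N.

Definition regular_local_ring (m : ideal R) (d : nat) : Prop :=
  [/\ noetherian, local_ring m, krull_dim d &
      exists y : 'I_d -> R, (m : set R) = generated_ideal (range y)].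

End Ideals.

Section QuotientModule.
Context (R : pzRingType) (M : lmodType R) (N : submodule M).

Let qrel (u v : M) : bool := `[< N (u - v) >].

Let qrel_equiv : equiv_class_of qrel.
Proof.
split=> [u|u v|v u w].
- by apply/asboolP; rewrite subrr; exact: submodule0.
- by apply/asboolP/asboolP => /submoduleN; rewrite opprB.
- move=> /asboolP uv /asboolP vw; apply/asboolP.
  by have := submoduleD uv vw; rewrite addrA subrK.
Qed.

Canonical qrel_equiv_rel := EquivRelPack qrel_equiv.

Definition quotient_module := {eq_quot qrel_equiv_rel}.
HB.instance Definition _ := EqQuotient.on quotient_module.
HB.instance Definition _ := Choice.on quotient_module.

Definition quotient_class (u : M) : quotient_module := \pi_quotient_module u.

Lemma quotient_classE u v : (quotient_class u = quotient_class v) <-> N (u - v).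
Proof.
split=> [/eqP|uv]; first by rewrite /quotient_class eqmodE => /asboolP.
by apply/eqP; rewrite /quotient_class eqmodE; apply/asboolP.
Qed.

Lemma quotient_class_surj (q : quotient_module) : exists u, q = quotient_class u.
Proof. by exists (repr q); rewrite /quotient_class reprK. Qed.

Lemma quotient_repr u : N (repr (quotient_class u) - u).
Proof. by apply/quotient_classE; rewrite /quotient_class reprK. Qed.

Let qadd (q r : quotient_module) := quotient_class (repr q + repr r).
Let qopp (q : quotient_module) := quotient_class (- repr q).
Let qscale a (q : quotient_module) := quotient_class (a *: repr q).

Let qaddE u v : qadd (quotient_class u) (quotient_class v) = quotient_class (u + v).
Proof.
by apply/quotient_classE; rewrite opprD addrACA; apply: submoduleD;
  exact: quotient_repr.
Qed.

Let qoppE u : qopp (quotient_class u) = quotient_class (- u).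
Proof.
by apply/quotient_classE; rewrite -opprD; apply: submoduleN; exact: quotient_repr.
Qed.

Let qscaleE a u : qscale a (quotient_class u) = quotient_class (a *: u).
Proof.
by apply/quotient_classE; rewrite -scalerBr; apply: submoduleZ; exact: quotient_repr.
Qed.

Let qaddA : associative qadd.
Proof.
move=> q r s; case: (quotient_class_surj q) (quotient_class_surj r) => u -> [v ->].
by case: (quotient_class_surj s) => w ->; rewrite !qaddE addrA.
Qed.

Let qaddC : commutative qadd.
Proof. by move=> q r; rewrite /qadd addrC. Qed.

Let qadd0 : left_id (quotient_class 0) qadd.
Proof. by move=> q; case: (quotient_class_surj q) => u ->; rewrite qaddE add0r. Qed.

Let qaddN : left_inverse (quotient_class 0) qopp qadd.
Proof.
by move=> q; case: (quotient_class_surj q) => u ->; rewrite qoppE qaddE addNr.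
Qed.

HB.instance Definition _ :=
  GRing.isZmodule.Build quotient_module qaddA qaddC qadd0 qaddN.

Let qscaleA a b q : qscale a (qscale b q) = qscale (a * b) q.
Proof. by case: (quotient_class_surj q) => u ->; rewrite !qscaleE scalerA. Qed.

Let qscale1 : left_id 1 qscale.
Proof. by move=> q; case: (quotient_class_surj q) => u ->; rewrite qscaleE scale1r. Qed.

Let qscaleDr : right_distributive qscale +%R.
Proof.
move=> a q r; case: (quotient_class_surj q) (quotient_class_surj r) => u -> [v ->].
by rewrite /GRing.add/= qaddE !qscaleE qaddE scalerDr.
Qed.

Let qscaleDl q : {morph qscale^~ q : a b / a + b}.
Proof.
move=> a b; case: (quotient_class_surj q) => u ->.
by rewrite !qscaleE {2}/GRing.add/= qaddE scalerDl.
Qed.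

HB.instance Definition _ := GRing.Zmodule_isLmodule.Build R quotient_module
  qscaleA qscale1 qscaleDr qscaleDl.

Lemma quotient_class_is_linear : linear quotient_class.
Proof.
move=> a u v.
rewrite -[RHS]/(qadd (qscale a (quotient_class u)) (quotient_class v)).
by rewrite qscaleE qaddE.
Qed.

HB.instance Definition _ := GRing.isLinear.Build R M quotient_module _
  quotient_class quotient_class_is_linear.

End QuotientModule.

Section QuotientRing.
Context (R : comPzRingType) (I : ideal R).

Definition quotient_ring := quotient_module I.
HB.instance Definition _ := GRing.Lmodule.on quotient_ring.

Let cls (a : R) : quotient_ring := quotient_class I a.
Let qmul (q r : quotient_ring) := cls ((repr q : R) * repr r).

Let qmulE a b : qmul (cls a) (cls b) = cls (a * b).
Proof.
apply/quotient_classE.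
set a' := (X in X * _ - _); set b' := (X in _ * X - _).
have -> : a' * b' - a * b = b' * (a' - a) + a * (b' - b).
  by rewrite !mulrBr addrA mulrC (mulrC b' a) subrK.
by apply: submoduleD; apply: (submoduleZ (M := R^o)); exact: quotient_repr.
Qed.

Let surj (q : quotient_ring) : exists a, q = cls a.
Proof. exact: (@quotient_class_surj _ _ I q). Qed.

Let qmulA : associative qmul.
Proof.
move=> q r s; case: (surj q) (surj r) (surj s) => a -> [b ->] [c ->].
by rewrite !qmulE mulrA.
Qed.

Let qmulC : commutative qmul.
Proof. by move=> q r; rewrite /qmul mulrC. Qed.

Let qmul1 : left_id (cls 1) qmul.
Proof. by move=> q; case: (surj q) => a ->; rewrite qmulE mul1r. Qed.

Let qmulD : left_distributive qmul +%R.
Proof.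
move=> q r s; case: (surj q) (surj r) (surj s) => a -> [b ->] [c ->].
by rewrite -raddfD !qmulE mulrDl /cls raddfD.
Qed.

HB.instance Definition _ := GRing.Zmodule_isComPzRing.Build quotient_ring
  qmulA qmulC qmul1 qmulD.

End QuotientRing.

Section QuotientModuleMap.
Context (R : pzRingType) (M M' : lmodType R) (N : submodule M) (N' : submodule M').
Context (g : {linear M -> M'}).

Definition quotient_map (q : quotient_module N) : quotient_module N' :=
  quotient_class N' (g (repr q)).

Lemma quotient_mapE (gN : forall u, N u -> N' (g u)) u :
  quotient_map (quotient_class N u) = quotient_class N' (g u).
Proof.
by apply/quotient_classE; rewrite -raddfB; apply: gN; exact: quotient_repr.
Qed.

Lemma quotient_map_linear (gN : forall u, N u -> N' (g u)) : linear quotient_map.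
Proof.
move=> a q r; case: (quotient_class_surj q) (quotient_class_surj r) => u -> [v ->].
by rewrite -linearP !quotient_mapE// !linearP.
Qed.

End QuotientModuleMap.

Section QuotientProjection.
Context (R : comPzRingType) (J I : ideal R).

Definition quotient_proj of J `<=` I : quotient_module J -> quotient_module I :=
  @quotient_map _ _ _ J I idfun.

Context (JI : J `<=` I).

Lemma quotient_projE a :
  quotient_proj JI (quotient_class J a) = quotient_class I a.
Proof. exact: (@quotient_mapE _ _ _ J I idfun JI). Qed.

Lemma quotient_proj_is_linear : linear (quotient_proj JI).
Proof. exact: (@quotient_map_linear _ _ _ J I idfun JI). Qed.

HB.instance Definition _ := GRing.isLinear.Build R (quotient_module J)
  (quotient_module I) _ (quotient_proj JI) quotient_proj_is_linear.

End QuotientProjection.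

Section SubmoduleModule.
Context (R : pzRingType) (M : lmodType R) (N : submodule M).

Definition submodule_bpred : {pred M} := fun u => `[< N u >].

Let submodule_bpred_closed : GRing.submod_closed submodule_bpred.
Proof.
split=> [|a u v /asboolP Nu /asboolP Nv]; apply/asboolP; first exact: submodule0.
exact: submoduleP.
Qed.

HB.instance Definition _ :=
  GRing.isSubmodClosed.Build R M submodule_bpred submodule_bpred_closed.

Record submodule_module := SubmoduleModule {
  submodule_val : M; _ : submodule_val \in submodule_bpred }.

HB.instance Definition _ := [isSub for submodule_val].
HB.instance Definition _ := [Choice of submodule_module by <:].
HB.instance Definition _ := [SubChoice_isSubLmodule of submodule_module by <:].

Lemma submodule_valP (u : submodule_module) : N (submodule_val u).
Proof. by case: u => u /= /asboolP. Qed.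

Definition submodule_of (u : M) (Nu : N u) : submodule_module :=
  SubmoduleModule (asboolT Nu).

End SubmoduleModule.

Section SubmoduleMap.
Context (R : pzRingType) (M M' : lmodType R) (N : submodule M) (N' : submodule M').
Context (g : {linear M -> M'}) (gN : forall u, N u -> N' (g u)).

Definition submodule_map (u : submodule_module N) : submodule_module N' :=
  submodule_of (gN (submodule_valP u)).

Lemma submodule_map_is_linear : linear submodule_map.
Proof. by move=> a u v; apply: val_inj; rewrite /= linearP. Qed.

HB.instance Definition _ := GRing.isLinear.Build R (submodule_module N)
  (submodule_module N') _ submodule_map submodule_map_is_linear.

End SubmoduleMap.

Definition product_module (R : pzRingType) (T : Type) (V : T -> lmodType R) : Type :=
  forall t, V t.

Section ProductModule.
Context (R : pzRingType) (T : Type) (V : T -> lmodType R).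
Local Notation P := (product_module V).

HB.instance Definition _ := gen_eqMixin P.
HB.instance Definition _ := gen_choiceMixin P.

Let padd (c e : P) : P := fun t => c t + e t.
Let popp (c : P) : P := fun t => - c t.
Let pzero : P := fun=> 0.
Let pscale a (c : P) : P := fun t => a *: c t.

Let paddA : associative padd.
Proof. by move=> b c e; apply: functional_extensionality_dep => t; exact: addrA. Qed.
Let paddC : commutative padd.
Proof. by move=> c e; apply: functional_extensionality_dep => t; exact: addrC. Qed.
Let padd0 : left_id pzero padd.
Proof. by move=> c; apply: functional_extensionality_dep => t; exact: add0r. Qed.
Let paddN : left_inverse pzero popp padd.
Proof. by move=> c; apply: functional_extensionality_dep => t; exact: addNr. Qed.

HB.instance Definition _ := GRing.isZmodule.Build P paddA paddC padd0 paddN.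

Let pscaleA a b c : pscale a (pscale b c) = pscale (a * b) c.
Proof. by apply: functional_extensionality_dep => t; exact: scalerA. Qed.
Let pscale1 : left_id 1 pscale.
Proof. by move=> c; apply: functional_extensionality_dep => t; exact: scale1r. Qed.
Let pscaleDr : right_distributive pscale +%R.
Proof.
by move=> a c e; apply: functional_extensionality_dep => t; exact: scalerDr.
Qed.
Let pscaleDl c : {morph pscale^~ c : a b / a + b}.
Proof.
by move=> a b; apply: functional_extensionality_dep => t; exact: scalerDl.
Qed.

HB.instance Definition _ := GRing.Zmodule_isLmodule.Build R P
  pscaleA pscale1 pscaleDr pscaleDl.

End ProductModule.

Section Localization.
Context (R : comPzRingType) (M : lmodType R) (f : R).

(* (u, k) represents the fraction u / f^k. *)
Let lrel (z w : M * nat) : bool :=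
  `[< exists n, f ^+ n *: (f ^+ w.2 *: z.1 - f ^+ z.2 *: w.1) = 0 >].

Let lrel_equiv : equiv_class_of lrel.
Proof.
split=> [z|z w|y z w].
- by apply/asboolP; exists 0%N; rewrite subrr scaler0.
- by apply/asboolP/asboolP => -[n nE]; exists n;
    rewrite -opprB scalerN nE oppr0.
- case: y z w => [u k] [v l] [w j] /asboolP[n /= nE] /asboolP[n' /= n'E].
  apply/asboolP; exists (n + n' + k)%N => /=.
  have -> : f ^+ (n + n' + k) *: (f ^+ j *: v - f ^+ l *: w) =
      (f ^+ n' * f ^+ j) *: (f ^+ n *: (f ^+ k *: v - f ^+ l *: u)) +
      (f ^+ n * f ^+ l) *: (f ^+ n' *: (f ^+ j *: u - f ^+ k *: w)).
    rewrite !scalerBr !scalerA !exprD.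
    set b := (X in _ - X *: u); set c := (X in _ + (X *: u - _)).
    have -> : b = c by rewrite /b /c; ring.
    by rewrite addrA subrK; congr (_ *: _ - _ *: _); ring.
  by rewrite nE n'E !scaler0 addr0.
Qed.

Canonical lrel_equiv_rel := EquivRelPack lrel_equiv.

Definition localization := {eq_quot lrel_equiv_rel}.
HB.instance Definition _ := EqQuotient.on localization.
HB.instance Definition _ := Choice.on localization.

Definition fraction (u : M) (k : nat) : localization := \pi_localization (u, k).

Lemma fractionE u k v l : fraction u k = fraction v l <->
  exists n, f ^+ n *: (f ^+ l *: u - f ^+ k *: v) = 0.
Proof.
split=> [/eqP|uv]; first by rewrite /fraction eqmodE => /asboolP.
by apply/eqP; rewrite /fraction eqmodE; apply/asboolP.
Qed.

Lemma fraction_surj (z : localization) : exists u k, z = fraction u k.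
Proof.
by exists (repr z).1, (repr z).2; rewrite /fraction -surjective_pairing reprK.
Qed.

Lemma fraction_lift (S : Type) (h : M -> nat -> S) :
  (forall u k v l n, f ^+ n *: (f ^+ l *: u - f ^+ k *: v) = 0 -> h u k = h v l) ->
  forall u k, h (repr (fraction u k)).1 (repr (fraction u k)).2 = h u k.
Proof.
move=> hE u k; have [|n] := (fractionE (repr (fraction u k)).1 (repr (fraction u k)).2 u k).1.
  by rewrite {1}/fraction -surjective_pairing reprK.
exact: hE.
Qed.

Let ladd (z w : localization) :=
  fraction (f ^+ (repr w).2 *: (repr z).1 + f ^+ (repr z).2 *: (repr w).1)
    ((repr z).2 + (repr w).2).
Let lopp (z : localization) := fraction (- (repr z).1) (repr z).2.
Let lscale a (z : localization) := fraction (a *: (repr z).1) (repr z).2.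

Let loppE u k : lopp (fraction u k) = fraction (- u) k.
Proof.
rewrite /lopp (@fraction_lift _ (fun u k => fraction (- u) k))// => v l w j n nE.
by apply/fractionE; exists n; rewrite !scalerN -opprD scalerN nE oppr0.
Qed.

Let lscaleE a u k : lscale a (fraction u k) = fraction (a *: u) k.
Proof.
rewrite /lscale (@fraction_lift _ (fun u k => fraction (a *: u) k))// => v l w j n nE.
apply/fractionE; exists n; transitivity (a *: (0 : M)); last exact: scaler0.
rewrite -nE !scalerBr !scalerA.
by congr (_ *: _ - _ *: _); ring.
Qed.

Let laddC : commutative ladd.
Proof. by move=> z w; rewrite /ladd addrC addnC. Qed.

Let laddE u k v l :
  ladd (fraction u k) (fraction v l) = fraction (f ^+ l *: u + f ^+ k *: v) (k + l).
Proof.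
have E x j y i w n : fraction x j = fraction y i ->
    fraction (f ^+ j *: w + f ^+ n *: x) (n + j) =
    fraction (f ^+ i *: w + f ^+ n *: y) (n + i).
  move=> /fractionE[t tE]; apply/fractionE; exists t.
  transitivity ((f ^+ n * f ^+ n) *: (0 : M)); last exact: scaler0.
  rewrite -tE !scalerDr !scalerN !scalerDr !scalerA !exprD opprD addrACA.
  set b := (X in X *: w - _ + _); set c := (X in _ - X *: w + _).
  have -> : b = c by rewrite /b /c; ring.
  by rewrite subrr add0r; congr (_ *: _ - _ *: _); ring.
have reprE z : fraction (repr z).1 (repr z).2 = z.
  by rewrite /fraction -surjective_pairing reprK.
rewrite /ladd (E _ _ _ _ _ _ (reprE (fraction v l))) addrC addnC.
by rewrite (E _ _ _ _ _ _ (reprE (fraction u k))) addrC addnC.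
Qed.

Let laddA : associative ladd.
Proof.
move=> y z w.
case: (fraction_surj y) (fraction_surj z) (fraction_surj w)
  => u [k ->] [v [l ->]] [x [j ->]].
rewrite !laddE addnA; congr (fraction _ _).
by rewrite !scalerDr !scalerA -!exprD addrA addnC (addnC j k).
Qed.

Let ladd0 : left_id (fraction 0 0) ladd.
Proof.
move=> z; case: (fraction_surj z) => u [k ->].
by rewrite laddE expr0 scale1r scaler0 add0r.
Qed.

Let fraction0 k : fraction 0 k = fraction 0 0.
Proof. by apply/fractionE; exists 0%N; rewrite !scaler0 subrr scaler0. Qed.

Let laddN : left_inverse (fraction 0 0) lopp ladd.
Proof.
move=> z; case: (fraction_surj z) => u [k ->].
by rewrite loppE laddE scalerN addNr fraction0.
Qed.

HB.instance Definition _ := GRing.isZmodule.Build localization laddA laddC ladd0 laddN.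

Let lscaleA a b z : lscale a (lscale b z) = lscale (a * b) z.
Proof. by case: (fraction_surj z) => u [k ->]; rewrite !lscaleE scalerA. Qed.

Let lscale1 : left_id 1 lscale.
Proof. by move=> z; case: (fraction_surj z) => u [k ->]; rewrite lscaleE scale1r. Qed.

Let lscaleDr : right_distributive lscale +%R.
Proof.
move=> a z w; case: (fraction_surj z) (fraction_surj w) => u [k ->] [v [l ->]].
rewrite -[_ + _]/(ladd _ _) -[RHS]/(ladd _ _) laddE !lscaleE laddE.
by congr (fraction _ _); rewrite scalerDr !scalerA !(mulrC a).
Qed.

Let lscaleDl z : {morph lscale^~ z : a b / a + b}.
Proof.
move=> a b; case: (fraction_surj z) => u [k ->].
rewrite -[RHS]/(ladd _ _) !lscaleE laddE; apply/fractionE; exists 0%N.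
by rewrite -scalerDr -scalerDl [f ^+ k *: (_ *: _)]scalerA -exprD subrr scaler0.
Qed.

HB.instance Definition _ := GRing.Zmodule_isLmodule.Build R localization
  lscaleA lscale1 lscaleDr lscaleDl.

Lemma fractionD u k v l :
  fraction u k + fraction v l = fraction (f ^+ l *: u + f ^+ k *: v) (k + l).
Proof. exact: laddE. Qed.

Lemma fractionZ a u k : a *: fraction u k = fraction (a *: u) k.
Proof. exact: lscaleE. Qed.

End Localization.

(* Functoriality in the module: u / f^k is sent to g(u) / f^k. *)
Section LocalizationMap.
Context (R : comPzRingType) (M M' : lmodType R) (g : {linear M -> M'}) (f : R).

Let gZ a u : g (a *: u) = a *: g u. Proof. exact: linearZ. Qed.
Let gBZ a b c u v : g (a *: (b *: u - c *: v)) = a *: (b *: g u - c *: g v).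
Proof. by rewrite gZ raddfB/= !gZ. Qed.
Let gDZ a b c u v : g (b *: (a *: u) + c *: v) = b *: (a *: g u) + c *: g v.
Proof. by rewrite raddfD/= !gZ. Qed.

Definition localization_map (z : localization M f) : localization M' f :=
  fraction f (g (repr z).1) (repr z).2.

Lemma localization_mapE u k :
  localization_map (fraction f u k) = fraction f (g u) k.
Proof.
rewrite /localization_map (@fraction_lift _ _ _ _ (fun u k => fraction f (g u) k))//.
move=> {}u {}k v l n nE; apply/fractionE; exists n.
by apply: etrans (esym (gBZ _ _ _ _ _)) _; rewrite nE raddf0.
Qed.

Lemma localization_map_is_linear : linear localization_map.
Proof.
move=> a z w; case: (fraction_surj z) (fraction_surj w) => u [k ->] [v [l ->]].
rewrite fractionZ fractionD !localization_mapE fractionZ fractionD.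
by congr fraction; exact: gDZ.
Qed.

HB.instance Definition _ := GRing.isLinear.Build R (localization M f)
  (localization M' f) _ localization_map localization_map_is_linear.

End LocalizationMap.

(* For f' = f * h, the canonical map M_f -> M_f' sends u / f^k to
   (h^k u) / f'^k. *)
Section LocalizationExtension.
Context (R : comPzRingType) (M : lmodType R) (f h f' : R).

Definition localization_ext (z : localization M f) : localization M f' :=
  fraction f' (h ^+ (repr z).2 *: (repr z).1) (repr z).2.

Hypothesis f'E : f' = f * h.

Lemma localization_extE u k :
  localization_ext (fraction f u k) = fraction f' (h ^+ k *: u) k.
Proof.
rewrite /localization_ext
  (@fraction_lift _ _ _ _ (fun u k => fraction f' (h ^+ k *: u) k))//.
move=> {}u {}k v l n nE; apply/fractionE; exists n.
transitivity ((h ^+ n * h ^+ k * h ^+ l) *: (0 : M)); last exact: scaler0.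
rewrite -nE f'E !scalerBr !scalerA !exprMn.
by congr (_ *: _ - _ *: _); ring.
Qed.

Lemma localization_ext_linear : linear localization_ext.
Proof.
move=> a z w; case: (fraction_surj z) (fraction_surj w) => u [k ->] [v [l ->]].
rewrite fractionZ fractionD !localization_extE fractionZ fractionD; congr fraction.
rewrite f'E !scalerDr !scalerA !exprD !exprMn.
by congr (_ *: _ + _ *: _); ring.
Qed.

End LocalizationExtension.

(* Local cohomology with support in the ideal (x_0, ..., x_(r-1)) is computed
   by the Cech complex
     C^i(x; M) = \prod_(S a subset of {0, ..., r-1} with i elements) M_(x_S),
   where x_S = \prod_(j in S) x_j, with differential
     (d c)_S = \sum_(j in S) (-1)^(number of k in S with k < j) c_(S \ j).
   All degrees live in the single module [cech_module] of families indexed by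
   all the sets S; C^i is the submodule of the families supported on the S with
   i elements. *)
Section Cech.
Context (R : comPzRingType) (r : nat) (x : 'I_r -> R).

Definition cech_elt (S : {set 'I_r}) : R := \prod_(j in S) x j.

Lemma cech_eltD1 (S : {set 'I_r}) j : j \in S -> cech_elt S = cech_elt (S :\ j) * x j.
Proof. by move=> jS; rewrite /cech_elt (big_setD1 j)//= mulrC. Qed.

Section CechModule.
Context (M : lmodType R).

Definition cech_module : lmodType R :=
  product_module (fun S : {set 'I_r} => localization M (cech_elt S) : lmodType R).

Definition cech_diff (c : cech_module) : cech_module := fun S =>
  \sum_(j in S) (-1) ^+ #|[set k in S | (k < j)%N]| *:
    localization_ext (x j) (cech_elt S) (c (S :\ j)).

Lemma cech_diff_is_linear : linear cech_diff.
Proof.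
move=> a c e; apply: functional_extensionality_dep => S.
rewrite -[RHS]/(a *: cech_diff c S + cech_diff e S) /cech_diff.
rewrite scaler_sumr -big_split/=; apply: eq_bigr => j jS.
rewrite -[(a *: c + e) _]/(a *: c (S :\ j) + e (S :\ j)).
rewrite (localization_ext_linear (cech_eltD1 jS)) scalerDr !scalerA.
by congr (_ *: _ + _); rewrite mulrC.
Qed.

HB.instance Definition _ := GRing.isLinear.Build R cech_module cech_module _
  cech_diff cech_diff_is_linear.

Definition cech_supported (D : pred nat) (c : cech_module) : Prop :=
  forall S : {set 'I_r}, ~~ D #|S| -> c S = 0.

Lemma cech_supported0 D : cech_supported D 0. Proof. by []. Qed.

Lemma cech_supportedP D a c e :
  cech_supported D c -> cech_supported D e -> cech_supported D (a *: c + e).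
Proof.
move=> cD eD S SD; rewrite -[LHS]/(a *: c S + e S) cD// eD//.
by rewrite scaler0 addr0.
Qed.

Section Cohomology.
Context (i : nat).

Let cocycle : set cech_module :=
  [set c | cech_supported (fun k => k == i) c /\ cech_diff c = 0].

Let cocycle0 : cocycle 0.
Proof. by split; [exact: cech_supported0|exact: raddf0]. Qed.

Let cocycleP a c e : cocycle c -> cocycle e -> cocycle (a *: c + e).
Proof.
move=> [ci cE] [ei eE]; split; first exact: cech_supportedP.
by rewrite linearP/= cE eE scaler0 addr0.
Qed.

Definition cech_cocycles : submodule cech_module := Submodule cocycle0 cocycleP.

(* For i = 0 the support condition forces c = 0, so that B^0 = 0. *)
Let coboundary : set (submodule_module cech_cocycles) :=
  [set z | exists2 c, cech_supported (fun k => k.+1 == i) c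
                    & submodule_val z = cech_diff c].

Let coboundary0 : coboundary 0.
Proof. by exists 0; [exact: cech_supported0|rewrite raddf0]. Qed.

Let coboundaryP a y z : coboundary y -> coboundary z -> coboundary (a *: y + z).
Proof.
move=> [c ci yc] [e ei ze]; exists (a *: c + e); first exact: cech_supportedP.
by rewrite linearP/= -yc -ze.
Qed.

Definition cech_coboundaries : submodule (submodule_module cech_cocycles) :=
  Submodule coboundary0 coboundaryP.

Definition local_cohomology : lmodType R := quotient_module cech_coboundaries.

End Cohomology.
End CechModule.

Section CechMap.
Context (M M' : lmodType R) (g : {linear M -> M'}).

Definition cech_map (c : cech_module M) : cech_module M' :=
  fun S => localization_map g (c S).

Lemma cech_map_is_linear : linear cech_map.
Proof.
move=> a c e; apply: functional_extensionality_dep => S.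
exact: localization_map_is_linear.
Qed.

HB.instance Definition _ := GRing.isLinear.Build R (cech_module M) (cech_module M') _
  cech_map cech_map_is_linear.

Lemma cech_map_supported D c : cech_supported D c -> cech_supported D (cech_map c).
Proof. by move=> cD S SD; rewrite /cech_map cD// raddf0. Qed.

Lemma cech_map_diff c : cech_diff (cech_map c) = cech_map (cech_diff c).
Proof.
apply: functional_extensionality_dep => S.
rewrite /cech_map /cech_diff raddf_sum; apply: eq_bigr => j jS.
rewrite [RHS]linearZ; congr (_ *: _).
case: (fraction_surj (c (S :\ j))) => u [k ->].
rewrite localization_mapE !(localization_extE (cech_eltD1 jS))/= localization_mapE.
by rewrite linearZ.
Qed.

Context (i : nat).

Let cech_map_cocycles c : cech_cocycles M i c -> cech_cocycles M' i (cech_map c).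
Proof.
move=> [ci cE]; split; first exact: cech_map_supported.
by rewrite cech_map_diff cE raddf0.
Qed.

(* The map H^i(M) -> H^i(M') induced by g, sending the class of a cocycle c to
   the class of [cech_map c]. *)
Definition local_cohomology_map :
    local_cohomology M i -> local_cohomology M' i :=
  quotient_map (cech_coboundaries M' i) (submodule_map cech_map_cocycles).

Let cech_map_coboundaries z : cech_coboundaries M i z ->
  cech_coboundaries M' i (submodule_map cech_map_cocycles z).
Proof.
move=> [c ci zc]; exists (cech_map c); first exact: cech_map_supported.
by rewrite cech_map_diff -zc.
Qed.

Lemma local_cohomology_mapE z :
  local_cohomology_map (quotient_class (cech_coboundaries M i) z) =
  quotient_class (cech_coboundaries M' i) (submodule_map cech_map_cocycles z).
Proof. exact: (quotient_mapE cech_map_coboundaries). Qed.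

Lemma local_cohomology_map_is_linear : linear local_cohomology_map.
Proof. exact: (quotient_map_linear cech_map_coboundaries). Qed.

HB.instance Definition _ := GRing.isLinear.Build R (local_cohomology M i)
  (local_cohomology M' i) _ local_cohomology_map local_cohomology_map_is_linear.

End CechMap.
End Cech.

Arguments local_cohomology_map {R r} x {M M'} g i _.

(* The supremum of the lengths k of the chains of submodules
   N_0 < N_1 < ... < N_k, in [0, +oo]. *)
Definition module_length (K : realType) (R : pzRingType) (V : lmodType R) : \bar K :=
  ereal_sup [set (k%:R)%:E | k in [set k : nat |
    exists N : nat -> submodule V, forall j, (j < k)%N -> N j `<` N j.+1]].

Definition F_full (R : comPzRingType) (r : nat) (x : 'I_r -> R) (I : ideal R) : Prop :=
  forall (i : nat) (J : ideal R) (JI : J `<=` I), I `<=` radical J ->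
    forall h : local_cohomology x (quotient_module I) i,
      exists h' : local_cohomology x (quotient_module J) i,
        local_cohomology_map x (quotient_proj JI) i h' = h.

(* Formal sums of elements s (x) u of T (x)_S M, where T is an S-module via f,
   up to equality in T (x)_S M. *)
Section Tensor.
Context (S T : comPzRingType) (f : S -> T) (M : lmodType S).

Inductive tensor_eq : seq (T * M) -> seq (T * M) -> Prop :=
| tensor_refl v : tensor_eq v v
| tensor_sym v w : tensor_eq v w -> tensor_eq w v
| tensor_trans v w y : tensor_eq v w -> tensor_eq w y -> tensor_eq v y
| tensor_cat v v' w w' :
    tensor_eq v v' -> tensor_eq w w' -> tensor_eq (v ++ w) (v' ++ w')
| tensor_comm v w : tensor_eq (v ++ w) (w ++ v)
| tensor_0l u : tensor_eq [:: (0, u)] [::]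
| tensor_Dl s t u : tensor_eq [:: (s + t, u)] [:: (s, u); (t, u)]
| tensor_Dr s u v : tensor_eq [:: (s, u + v)] [:: (s, u); (s, v)]
| tensor_balanced s a u : tensor_eq [:: (s * f a, u)] [:: (s, a *: u)].

End Tensor.

(* The Frobenius map S -> S tensored with M sends \sum s_i (x) u_i to
   \sum s_i^p (x) u_i. *)
Definition frobenius_tensor (S : comPzRingType) (p : nat) (M : lmodType S)
    (v : seq (S * M)) : seq (S * M) :=
  [seq (z.1 ^+ p, z.2) | z <- v].

Definition F_pure (S : comPzRingType) (p : nat) : Prop :=
  forall (M : lmodType S) (v w : seq (S * M)),
    tensor_eq (fun a => a ^+ p) (frobenius_tensor p v) (frobenius_tensor p w) ->
    tensor_eq idfun v w.

(* Main.v *)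
Require Import Defs.
From HB Require Import structures.
From mathcomp Require Import all_boot all_order all_algebra.
From mathcomp Require Import ring zify.
From mathcomp Require Import all_classical all_reals all_analysis.
Set Implicit Arguments.
Unset Strict Implicit.
Unset Printing Implicit Defensive.
Import Order.TTheory GRing.Theory Num.Theory.
Local Open Scope classical_set_scope.
Local Open Scope ring_scope.

(** Fix [q = p^e], let [F] be the [e]-th iterate of the Frobenius of [R], and write
    [I^[q]] for the ideal generated by the [q]-th powers of elements of [I].

    The lower bound rests on three facts. First, [F] is flat, so that
    [H^i(R/I^[q])] is the base change of [H^i(R/I)] along [F]. It is therefore
    generated by Frobenius images ([represents_phi_generate]), a surjection
    [H^i(R/J) -> H^i(R/I)] stays onto after twisting by [F]
    ([local_cohomology_phi_surj]), and a nonzero class of [H^i(R/I)], having its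
    annihilator in [m], goes to a class whose annihilator lies in [m^[q]]
    ([represents_phi_annihilator]). Second, [R/m^[q]] has length at least [q^d],
    because [m] is generated by a regular sequence of [d] elements. Third, if
    [mu] exceeds the number of generators of [I] and [mu q <= n <= mu p q], then
    [(I^(mu p))^[q] <= I^n <= I^[q]]. As [R/I] is F-full, [H^i(R/I^(mu p))] maps
    onto [H^i(R/I)]; after twisting, [H^i(R/I^n)] maps onto [H^i(R/I^[q])], and
    a lift of the class above generates a submodule of length at least [q^d].
    Choosing [q] maximal with [mu q <= n] gives [q >= n / (mu p)], hence a liminf
    of at least [(mu p)^(-d)].

    Flatness of [F] is stated through syzygies: every linear relation between
    the [F a_j] is a combination of images of relations between the [a_j]. It is
    proved for all ideals by noetherian induction ([syzygy_flat_ideal]), from the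
    maximal ideal, where it holds because the Koszul relations are the only
    relations on a regular sequence. That generators of [m] form a regular
    sequence comes from Krull's principal ideal theorem: a chain of [d + 1]
    primes can be bent through one generator after the other
    ([regular_seq_of_chain]).

    If [R/I] is F-pure, let [J <= I] be an ideal with [I^[q] <= J]. The image of
    [H^i(R/J)] in [H^i(R/I)] contains the submodule generated by [F (H^i(R/I))],
    so it is enough to see that this submodule is everything. The submodules
    generated by [F^n (H^i(R/I))] decrease with [n], hence are stationary since
    [H^i(R/I)] is artinian ([local_cohomology_artinian]). So [F^n h] is, for
    large [n], a combination of elements [F^(n+1) h'] modulo coboundaries, and
    purity of [F^n] cancels [F^n] from this linear system
    ([frobenius_span_full]).

    Throughout, classes in [H^i(R/J)] are handled through Koszul cochains [u]
    standing for the Cech cochains [u_S / x_S^k], so that being a cocycle or a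
    coboundary becomes a finite system of linear congruences modulo [J]. *)

(** * Ideals and noetherian induction *)

Section Ideals.
Context (R : comPzRingType).
Implicit Types I J P C : ideal R.

Lemma ideal0 I : I 0. Proof. exact: submodule0. Qed.

Lemma idealD I a b : I a -> I b -> I (a + b). Proof. exact: submoduleD. Qed.

Lemma idealB I a b : I a -> I b -> I (a - b). Proof. exact: submoduleB. Qed.

Lemma idealMl I a b : I b -> I (a * b).
Proof. exact: (submoduleZ (M := R^o)). Qed.

Lemma idealMr I a b : I a -> I (a * b).
Proof. by rewrite mulrC; exact: idealMl. Qed.

Lemma idealX I a n : (0 < n)%N -> I a -> I (a ^+ n).
Proof. by case: n => // n _ Ia; rewrite exprS; exact: idealMr. Qed.

Lemma ideal_eq1 I : I 1 -> forall a, I a.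
Proof. by move=> I1 a; rewrite -[a]mulr1; exact: idealMl. Qed.

Lemma ideal_sum I (T : Type) (s : seq T) (P : pred T) (F : T -> R) :
  (forall t, P t -> I (F t)) -> I (\sum_(t <- s | P t) F t).
Proof.
move=> IF; elim/big_ind : _ => //; [exact: ideal0 | exact: idealD].
Qed.

Lemma submodule_sum (M : lmodType R) (N : submodule M) (T : Type) (s : seq T)
    (P : pred T) (F : T -> M) :
  (forall t, P t -> N (F t)) -> N (\sum_(t <- s | P t) F t).
Proof.
move=> NF; elim/big_ind : _ => //; [exact: submodule0 | exact: submoduleD].
Qed.

Lemma generated_sub (M : lmodType R) (A : set M) u : A u -> generated A u.
Proof. exact: (fun Au N AN => AN _ Au). Qed.

Lemma generated_min (M : lmodType R) (A : set M) (N : submodule M) :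
  A `<=` N -> forall u, generated A u -> N u.
Proof. exact: (fun AN u uA => uA N AN). Qed.

Lemma generated_seqP (M : lmodType R) (s : seq M) u :
  generated [set` s] u <->
  exists b : 'I_(size s) -> R, u = \sum_i b i *: s`_i.
Proof.
split; last first.
  case=> b ->; apply: submodule_sum => i _; apply: submoduleZ.
  by apply: generated_sub => /=; exact: mem_nth.
pose N0 : set M := [set u | exists b : 'I_(size s) -> R, u = \sum_i b i *: s`_i].
have N00 : N0 0.
  by exists (fun=> 0); rewrite big1// => i _; rewrite scale0r.
have N0P a v w : N0 v -> N0 w -> N0 (a *: v + w).
  case=> b -> [c ->]; exists (fun i => a * b i + c i).
  by rewrite scaler_sumr -big_split; apply: eq_bigr => i _; rewrite scalerDl scalerA.
apply: (generated_min (N := Submodule N00 N0P)) => v /= vs.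
have vi : (index v s < size s)%N by rewrite index_mem.
exists (fun i => if i == Ordinal vi then 1 else 0).
rewrite (bigD1 (Ordinal vi))//= eqxx scale1r nth_index// big1 ?addr0// => i iN.
by rewrite (negbTE iN) scale0r.
Qed.

Section Adjoin.
Context (J : ideal R) (z : R).

Definition adjoin_set : set R := [set a | exists2 b, J b & exists c, a = b + c * z].

Lemma adjoin_set0 : adjoin_set 0.
Proof. by exists 0; [exact: ideal0 | exists 0; rewrite mul0r addr0]. Qed.

Lemma adjoin_setP (a : R) (u v : R^o) :
  adjoin_set u -> adjoin_set v -> adjoin_set (a *: u + v).
Proof.
case=> b Jb [c ->] [b' Jb' [c' ->]]; exists (a * b + b').
  by apply: idealD => //; exact: idealMl.
by exists (a * c + c'); rewrite /GRing.scale/=; ring.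
Qed.

Definition adjoin : ideal R := Submodule (M := R^o) adjoin_set0 adjoin_setP.

Lemma adjoin_sub : J `<=` adjoin.
Proof. by move=> b Jb; exists b => //; exists 0; rewrite mul0r addr0. Qed.

Lemma adjoin_mem : adjoin z.
Proof. by exists 0; [exact: ideal0 | exists 1; rewrite mul1r add0r]. Qed.

Lemma adjoin_min P : J `<=` P -> P z -> adjoin `<=` P.
Proof. by move=> JP Pz _ [b Jb [c ->]]; apply: idealD; [exact: JP|exact: idealMl]. Qed.

Definition colon_set : set R := [set a | J (a * z)].

Lemma colon_set0 : colon_set 0.
Proof. by rewrite /colon_set/= mul0r; exact: ideal0. Qed.

Lemma colon_setP (a : R) (u v : R^o) :
  colon_set u -> colon_set v -> colon_set (a *: u + v).
Proof.
move=> Ju Jv; rewrite /colon_set/= /GRing.scale/= mulrDl -mulrA.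
by apply: idealD => //; exact: idealMl.
Qed.

Definition colon : ideal R := Submodule (M := R^o) colon_set0 colon_setP.

Lemma colon_sub : J `<=` colon.
Proof. by move=> a Ja; exact: idealMr. Qed.

End Adjoin.

Section Annihilator.
Context (M : lmodType R) (h : M).

Definition annihilator_set : set R := [set a | a *: h = 0].

Lemma annihilator_set0 : annihilator_set 0. Proof. exact: scale0r. Qed.

Lemma annihilator_setP (a : R) (u v : R^o) :
  annihilator_set u -> annihilator_set v -> annihilator_set (a *: u + v).
Proof.
by rewrite /annihilator_set/= scalerDl -scalerA => -> ->; rewrite scaler0 addr0.
Qed.

Definition annihilator : ideal R :=
  Submodule (M := R^o) annihilator_set0 annihilator_setP.

End Annihilator.

Lemma quotient_class_eq0 (M : lmodType R) (N : submodule M) u :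
  quotient_class N u = 0 <-> N u.
Proof. by rewrite -(raddf0 (quotient_class N)) quotient_classE subr0. Qed.

Lemma quotient_classZ (I : ideal R) a b :
  a *: quotient_class I b = quotient_class I (a * b).
Proof. by rewrite -linearZ. Qed.

Section Noetherian.
Context (hN : noetherian R).

Lemma noetherian_ind (P : ideal R -> Prop) :
  (forall I, (forall I', I `<=` I' -> ~ (I' `<=` I) -> P I') -> P I) ->
  forall I, P I.
Proof.
move=> IH I0; apply: contrapT => nP0.
have next (I : {I | ~ P I}) : {I' : {I | ~ P I} |
    sval I `<=` sval I' /\ ~ (sval I' `<=` sval I)}.
  case: I => I nP /=; apply: cid; apply: contrapT => nex; apply: nP; apply: IH.
  by move=> I' II' nI'; apply: contrapT => nP; apply: nex; exists (exist _ I' nP).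
pose f := fix f n := if n is n'.+1 then sval (next (f n')) else exist _ I0 nP0.
have fS n : sval (f n) `<=` sval (f n.+1) /\ ~ (sval (f n.+1) `<=` sval (f n)).
  exact: (svalP (next (f n))).
have fmono n k : sval (f n) `<=` sval (f (n + k)%N).
  elim: k => [|k IHk]; first by rewrite addn0.
  by rewrite addnS; apply: (subset_trans IHk); case: (fS (n + k)%N).
pose U : set R := [set a | exists n, sval (f n) a].
have U0 : U 0 by exists 0%N; exact: ideal0.
have UP (a : R) (u v : R^o) : U u -> U v -> U (a *: u + v).
  move=> [n un] [k vk]; exists (n + k)%N; apply: idealD.
    by apply: idealMl; exact: fmono un.
  by rewrite addnC; exact: fmono vk.
have [s sE] := hN (Submodule (M := R^o) U0 UP).
have [n sn] : exists n, forall a, a \in s -> sval (f n) a.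
  have : forall a, a \in s -> U a.
    move=> a sa; suff : (Submodule (M := R^o) U0 UP : set R) a by [].
    by rewrite sE; exact: generated_sub.
  elim: {sE} s => [|b s IHs] sU; first by exists 0%N.
  have [|n nE] := IHs; first by move=> a sa; apply: sU; rewrite inE sa orbT.
  have [|k bk] := sU b; first by rewrite inE eqxx.
  exists (n + k)%N => a; rewrite inE => /predU1P[->|/nE na]; last exact: fmono na.
  by rewrite addnC; exact: fmono bk.
have [_ []] := fS n; move=> a an.
have : (Submodule (M := R^o) U0 UP : set R) a by exists n.+1.
by rewrite sE; apply: generated_min => b /= /sn.
Qed.

Lemma noetherian_max (P : ideal R -> Prop) I0 : P I0 ->
  exists I, [/\ P I, I0 `<=` I & forall I', P I' -> I `<=` I' -> I' `<=` I].
Proof.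
elim/noetherian_ind : I0 => I0 IH PI0.
have [[I' [PI' II' nI']]|nex] :=
    pselect (exists I', [/\ P I', I0 `<=` I' & ~ (I' `<=` I0)]).
  have [I [PI I'I Imax]] := IH I' II' nI' PI'.
  by exists I; split=> //; exact: subset_trans I'I.
exists I0; split=> // I' PI' II'; apply: contrapT => nI'.
by apply: nex; exists I'.
Qed.

(** Among the multiples of [h] which are nonzero, one with a largest annihilator
    is killed by every element of [X]: if [c] did not kill it, the last nonzero
    multiple by a power of [c] would have a larger annihilator. *)
Lemma exists_socle (M : lmodType R) (h : M) (X : set R) :
  h <> 0 -> (forall c, X c -> exists n, c ^+ n *: h = 0) ->
  exists a, a *: h <> 0 /\ forall c, X c -> c *: (a *: h) = 0.
Proof.
move=> h0 hX.
pose P I := exists2 a, a *: h <> 0 & forall b, I b -> b *: (a *: h) = 0.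
have P1 : P (annihilator h).
  by exists 1; [rewrite scale1r | move=> b; rewrite scale1r].
have [I [[a ah0 aI] _ Imax]] := noetherian_max P1.
exists a; split=> // c Xc; apply: contrapT => cah0.
have [n cnE] : exists n, c ^+ n.+1 *: (a *: h) = 0 /\ c ^+ n *: (a *: h) <> 0.
  have [n nE] : exists n, c ^+ n *: (a *: h) = 0.
    have [n nE] := hX c Xc; exists n.
    by rewrite scalerA mulrC -scalerA nE scaler0.
  elim: n nE => [|n IHn nE]; first by rewrite scale1r.
  by have [/IHn//|n0] := pselect (c ^+ n *: (a *: h) = 0); exists n.
case: cnE => cE cN.
have PI' : P (annihilator (c ^+ n *: (a *: h))).
  exists (c ^+ n * a); first by rewrite -scalerA.
  by move=> b; rewrite -scalerA; exact.
have II' : I `<=` annihilator (c ^+ n *: (a *: h)).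
  by move=> b Ib; rewrite /= /annihilator_set/= !scalerA (mulrC b) -!scalerA aI// !scaler0.
apply: cah0; apply: aI; apply: (Imax _ PI' II').
by rewrite /= /annihilator_set/= scalerA -exprS.
Qed.

End Noetherian.

End Ideals.

(** * Nakayama's lemma and Krull's principal ideal theorem *)

Section Nakayama.
Context (R : comPzRingType) (C : ideal R) (hC : prime_ideal C).

Lemma prime_ideal1 : ~ C 1. Proof. by case: hC. Qed.

Lemma prime_idealM s t : ~ C s -> ~ C t -> ~ C (s * t).
Proof. by move=> nCs nCt; case: hC => _ /[apply] -[]. Qed.

Lemma prime_idealX c n : C (c ^+ n) -> C c.
Proof.
elim: n => [/prime_ideal1//|n IHn]; rewrite exprS => Cc.
by case: hC => _ /(_ _ _ Cc) [].
Qed.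

(** Being [C]-saturated means being the contraction of a submodule of the
    localization at [C]; it allows working locally at [C] without localizing. *)
Definition saturated (M : lmodType R) (N : set M) : Prop :=
  forall s u, ~ C s -> N (s *: u) -> N u.

Definition ideal_scale (M : lmodType R) (J : ideal R) (N : submodule M) : submodule M :=
  generated [set v | exists c u, [/\ J c, N u & v = c *: u]].

Section NakayamaModule.
Context (M : lmodType R) (K : submodule M).
Hypothesis Ksat : saturated K.

(** The set [K + C l], built so that the generators in [l] can be removed one
    by one. *)
Fixpoint nak_comb (l : seq M) : set M :=
  if l is a :: l' then [set v | exists2 c, C c & nak_comb l' (v - c *: a)] else K.

Let nak_comb0 l : nak_comb l 0.
Proof.
elim: l => [|a l IHl]; first exact: submodule0.
by exists 0; [exact: ideal0|rewrite scale0r subr0].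
Qed.

Let nak_combP l (a : R) u v :
  nak_comb l u -> nak_comb l v -> nak_comb l (a *: u + v).
Proof.
elim: l u v => [|b l IHl] u v; first exact: submoduleP.
move=> [c Cc cu] [e Ce ev]; exists (a * c + e).
  by apply: idealD => //; exact: idealMl.
suff -> : a *: u + v - (a * c + e) *: b = a *: (u - c *: b) + (v - e *: b).
  exact: IHl.
by rewrite scalerBr scalerDl scalerA opprD addrACA.
Qed.

Let comb_submodule l := Submodule (nak_comb0 l) (@nak_combP l).

Let nak_comb_mem l c a : a \in l -> C c -> nak_comb l (c *: a).
Proof.
move=> + Cc; elim: l => // b l IHl; rewrite inE => /predU1P[->|al].
  by exists c => //; rewrite subrr; exact: nak_comb0.
by exists 0; [exact: ideal0|rewrite scale0r subr0; exact: IHl].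
Qed.

Let nakayama_seq l : (forall a, a \in l -> exists2 s, ~ C s & nak_comb l (s *: a)) ->
  forall a, a \in l -> K a.
Proof.
elim: l => // a l IHl hl.
have [s nCs [c Cc ca]] := hl a (mem_head _ _).
have nCsc : ~ C (s - c).
  by move=> Csc; apply: nCs; rewrite -[s](subrK c); exact: idealD.
have sca : nak_comb l ((s - c) *: a) by rewrite scalerBl.
have lK b : b \in l -> K b.
  apply: IHl => {}b bl.
  have [|t nCt [e Ce eb]] := hl b; first by rewrite inE bl orbT.
  exists ((s - c) * t); first exact: prime_idealM.
  suff -> : ((s - c) * t) *: b =
      (s - c) *: (t *: b - e *: a) + e *: ((s - c) *: a).
    apply: nak_combP => //; rewrite -[e *: _]addr0.
    by apply: nak_combP => //; exact: nak_comb0.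
  by rewrite scalerBr !scalerA (mulrC e) subrK.
move=> b; rewrite inE => /predU1P[->|/lK//].
apply: (Ksat nCsc); move: sca; move: lK => {IHl hl ca}.
elim: l ((s - c) *: a) => // b' l IHl v lK [e Ce /IHl ev].
rewrite -[v](subrK (e *: b')); apply: submoduleD.
  by apply: ev => b'' b''l; apply: lK; rewrite inE b''l orbT.
by apply: submoduleZ; apply: lK; exact: mem_head.
Qed.

(** Nakayama's lemma at the prime [C]: the generators of [N] are eliminated one
    at a time, using that [s - c] avoids [C] when [s] does and [c] is in [C]. *)
Lemma nakayama (N : submodule M) (l : seq M) : (N : set M) = generated [set` l] ->
  (forall u, N u -> exists s v, [/\ ~ C s, K v & ideal_scale C N (s *: u - v)]) ->
  N `<=` K.
Proof.
move=> NE hN.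
suff lK : forall a, a \in l -> K a by rewrite NE; exact: generated_min.
apply: nakayama_seq => a al.
have [|s [v [nCs Kv suv]]] := hN a.
  rewrite -[N a]/((N : set M) a) NE; exact: generated_sub.
exists s => //; rewrite -[_ *: _](subrK v) -[_ - _]scale1r; apply: nak_combP; last first.
  elim: l {NE hN al suv} => //= b l IHl.
  by exists 0; [exact: ideal0|rewrite scale0r subr0].
apply: (generated_min (N := comb_submodule l)) suv => _ [c [u [Cc Nu ->]]].
move: Nu; rewrite -[N u]/((N : set M) u) NE => /generated_seqP[b ->].
rewrite scaler_sumr; apply: (submodule_sum (N := comb_submodule l)) => i _.
rewrite scalerA.
by apply: nak_comb_mem; [exact: mem_nth|exact: idealMr].
Qed.

End NakayamaModule.

Section Saturation.
Context (J : ideal R).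

Definition saturation_set : set R := [set a | exists2 s, ~ C s & J (s * a)].

Lemma saturation_set0 : saturation_set 0.
Proof. by exists 1; [exact: prime_ideal1|rewrite mulr0; exact: ideal0]. Qed.

Lemma saturation_setP (a : R) (u v : R^o) :
  saturation_set u -> saturation_set v -> saturation_set (a *: u + v).
Proof.
move=> [s nCs Jsu] [t nCt Jtv]; exists (s * t); first exact: prime_idealM.
suff -> : s * t * (a *: u + v) = (t * a) * (s * u) + s * (t * v).
  by apply: idealD; exact: idealMl.
by rewrite /GRing.scale/=; ring.
Qed.

Definition saturation : ideal R := Submodule (M := R^o) saturation_set0 saturation_setP.

Lemma saturation_sub : J `<=` saturation.
Proof. by move=> a Ja; exists 1; [exact: prime_ideal1|rewrite mul1r]. Qed.

Lemma saturation_saturated : saturated (M := R^o) saturation.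
Proof.
move=> s u nCs [t nCt Jtsu]; exists (t * s); first exact: prime_idealM.
by rewrite -mulrA.
Qed.

End Saturation.

Lemma saturated_proper J : saturated (M := R^o) J -> ~ J 1 -> J `<=` C.
Proof.
move=> Jsat nJ1 a Ja; apply: contrapT => nCa; apply: nJ1.
by apply: (Jsat a) => //; rewrite /GRing.scale/= mulr1.
Qed.

Lemma prime_saturated (P : ideal R) : prime_ideal P -> P `<=` C ->
  saturated (M := R^o) P.
Proof.
move=> [_ hP] PC s u nCs Psu.
by have [/PC|] := hP s u Psu.
Qed.

(** The ring [R_C / J_C] is artinian when [C] is the only prime over [J] inside
    [C]. Noetherian induction on [J]: enlarging [J] by a socle element [u]
    changes an ideal of a descending chain by at most one step. *)
Lemma dcc_over_primary (hN : noetherian R) (J : ideal R) (I : nat -> ideal R) :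
  saturated (M := R^o) J -> (forall c, C c -> exists n, J (c ^+ n)) ->
  (forall n, saturated (M := R^o) (I n)) -> (forall n, J `<=` I n) ->
  (forall n, I n.+1 `<=` I n) ->
  exists n0, forall n, (n0 <= n)%N -> I n `<=` I n.+1.
Proof.
elim/(noetherian_ind hN) : J I => J IH I Jsat Jprim Isat JI Idec.
have [J1|nJ1] := pselect (J 1).
  by exists 0%N => n _ a _; apply: ideal_eq1; exact: JI.
have JC := saturated_proper Jsat nJ1.
have [u [nJu Cu]] : exists u, ~ J u /\ forall c, C c -> J (c * u).
  have q1 : quotient_class J 1 <> 0 by rewrite quotient_class_eq0.
  have [|a [ah aC]] := exists_socle hN (X := C) q1.
    move=> c /Jprim[n Jcn]; exists n.
    by rewrite quotient_classZ quotient_class_eq0 mulr1.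
  rewrite quotient_classZ quotient_class_eq0 mulr1 in ah.
  exists a; split=> // c /aC.
  by rewrite (quotient_classZ J a 1) quotient_classZ mulr1 quotient_class_eq0.
pose I' n := saturation (adjoin (I n) u).
have JJ' : J `<=` saturation (adjoin J u).
  by apply: subset_trans (@saturation_sub _); exact: adjoin_sub.
have [|c Cc||n|n|n0 n0P] := IH _ JJ' _ I' (saturation_saturated (J := adjoin J u)).
- by move=> sub; apply: nJu; apply: sub; apply: saturation_sub; exact: adjoin_mem.
- by have [n Jcn] := Jprim c Cc; exists n; exact: JJ'.
- by move=> n; exact: saturation_saturated.
- move=> a [s nCs [b Jb [e sE]]]; exists s => //; exists b; first exact: JI.
  by exists e.
- move=> a [s nCs [b Jb [e sE]]]; exists s => //; exists b; first exact: Idec.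
  by exists e.
have [uI|/existsNP[n1 nIu]] := pselect (forall n, I n u).
  exists n0 => n n0n a Ia.
  have [s nCs [b Ib [e sE]]] : I' n.+1 a.
    by apply: n0P => //; apply: saturation_sub; exact: adjoin_sub.
  apply: (Isat _ s) => //; rewrite /GRing.scale/= sE.
  by apply: idealD => //; apply: idealMl.
have Imono n k : I (n + k)%N `<=` I n.
  elim: k => [|k IHk]; first by rewrite addn0.
  by rewrite addnS; apply: subset_trans IHk; exact: Idec.
exists (n0 + n1)%N => n n01n a Ia.
have nIun : ~ I n u.
  move=> Iu; apply: nIu; apply: (Imono n1 (n - n1)%N); rewrite subnKC//; lia.
have [s nCs [b Ib [e sE]]] : I' n.+1 a.
  by apply: n0P; [lia|apply: saturation_sub; exact: adjoin_sub].
have Ce : C e.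
  apply: contrapT => nCe; apply: nIun; apply: (Isat _ e) => //.
  rewrite /GRing.scale/=; have -> : e * u = s * a - b by rewrite sE addrAC subrr add0r.
  by apply: idealB; [exact: idealMl|exact: Idec].
apply: (Isat _ s) => //; rewrite /GRing.scale/= sE.
by apply: idealD => //; apply: JI; exact: Cu.
Qed.

End Nakayama.

Section IdealSum.
Context (R : comPzRingType) (I J : ideal R).

Definition ideal_add_set : set R := [set a | exists2 b, I b & (exists2 c, J c & a = b + c)].

Lemma ideal_add_set0 : ideal_add_set 0.
Proof.
by exists 0; [exact: ideal0|exists 0; [exact: ideal0|rewrite addr0]].
Qed.

Lemma ideal_add_setP (a : R) (u v : R^o) :
  ideal_add_set u -> ideal_add_set v -> ideal_add_set (a *: u + v).
Proof.
move=> [b Ib [c Jc ->]] [b' Ib' [c' Jc' ->]]; exists (a * b + b').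
  by apply: idealD => //; exact: idealMl.
exists (a * c + c'); first by apply: idealD => //; exact: idealMl.
by rewrite /GRing.scale/=; ring.
Qed.

Definition ideal_add : ideal R := Submodule (M := R^o) ideal_add_set0 ideal_add_setP.

Lemma ideal_addl : I `<=` ideal_add.
Proof. by move=> b Ib; exists b => //; exists 0; [exact: ideal0|rewrite addr0]. Qed.

Lemma ideal_addr : J `<=` ideal_add.
Proof.
by move=> b Jb; exists 0; [exact: ideal0|exists b; [exact: Jb|rewrite add0r]].
Qed.

End IdealSum.

Section PrincipalIdealTheorem.
Context (R : comPzRingType) (hN : noetherian R).
Context (A B C : ideal R).
Hypotheses (hA : prime_ideal A) (hB : prime_ideal B) (hC : prime_ideal C).
Hypotheses (AB : A `<=` B) (nBA : ~ (B `<=` A)) (BC : B `<=` C) (nCB : ~ (C `<=` B)).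
Context (z : R) (Cz : C z).

Let symbolic n := saturation hB (ideal_add (ideal_pow B n) A).

Let symbolicS n : symbolic n.+1 `<=` symbolic n.
Proof.
move=> a [s nBs [b Bb [c Ac sE]]]; exists s => //; exists b; last by exists c.
apply: (generated_min (N := ideal_pow B n)) Bb => _ [e [f [_ Bf ->]]].
exact: idealMl.
Qed.

Let notinBC s : ~ C s -> ~ B s. Proof. by move=> nCs /BC. Qed.

(** Krull's principal ideal theorem, in the form that lets a chain of primes be
    bent so as to pass through [z] one step earlier. If [C] were minimal over
    [A + (z)], the symbolic powers of [B] would become stationary modulo [z],
    hence stationary by Nakayama at [C], hence [B = A] by Nakayama at [B]. *)
Lemma principal_ideal_theorem : exists Q : ideal R,
  [/\ prime_ideal Q, A `<=` Q, ~ (Q `<=` A), Q `<=` C & ~ (C `<=` Q) /\ Q z].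
Proof.
have [Bz|nBz] := pselect (B z); first by exists B.
have nAz : ~ A z by move=> /AB.
apply: contrapT => noQ.
pose J := saturation hC (adjoin A z).
have AJ : A `<=` J by apply: subset_trans (@saturation_sub _ _ _ _); exact: adjoin_sub.
have Jz : J z by apply: saturation_sub; exact: adjoin_mem.
have Jprim c : C c -> exists n, J (c ^+ n).
  move=> Cc; apply: contrapT => /forallNP nJc.
  pose P (X : ideal R) := adjoin A z `<=` X /\ forall n s, ~ C s -> ~ X (s * c ^+ n).
  have P0 : P (adjoin A z).
    by split=> // n s nCs Xsc; apply: (nJc n); exists s.
  have [Q [[AzQ QP] _ Qmax]] := noetherian_max hN P0.
  apply: noQ; exists Q; split.
  - split=> [Q1|a b Qab].
      by apply: (QP 0%N 1); [exact: prime_ideal1|rewrite mulr1].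
    apply: contrapT => /not_orP[nQa nQb].
    have big e : ~ Q e -> exists n s, ~ C s /\ adjoin Q e (s * c ^+ n).
      move=> nQe; apply: contrapT => nex; apply: nQe.
      apply: (Qmax (adjoin Q e)); last exact: adjoin_mem.
        split=> [|n s nCs Qs]; last by apply: nex; exists n, s.
        by apply: subset_trans AzQ _; exact: adjoin_sub.
      exact: adjoin_sub.
    have [n [s [nCs [q Qq [f sE]]]]] := big a nQa.
    have [n' [s' [nCs' [q' Qq' [f' s'E]]]]] := big b nQb.
    apply: (QP (n + n')%N (s * s')); first exact: prime_idealM.
    have -> : s * s' * c ^+ (n + n') = (s * c ^+ n) * (s' * c ^+ n').
      by rewrite exprD; ring.
    rewrite sE s'E; have -> : (q + f * a) * (q' + f' * b) =
       q * (q' + f' * b) + f * a * q' + f * f' * (a * b) by ring.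
    apply: idealD; last exact: idealMl.
    by apply: idealD; [exact: idealMr|exact: idealMl].
  - by apply: subset_trans AzQ; exact: adjoin_sub.
  - by move=> QA; apply: nAz; apply: QA; apply: AzQ; exact: adjoin_mem.
  - move=> a Qa; apply: contrapT => nCa.
    by apply: (QP 0%N a) => //; rewrite mulr1.
  - split=> [CQ|]; last by apply: AzQ; exact: adjoin_mem.
    apply: (QP 1%N 1); first exact: prime_ideal1.
    by rewrite mul1r expr1; exact: CQ.
have Idec n : saturation hC (adjoin (symbolic n.+1) z) `<=`
    saturation hC (adjoin (symbolic n) z).
  move=> a [s nCs [b Jb [e sE]]]; exists s => //; exists b; last by exists e.
  exact: symbolicS.
have JI n : J `<=` saturation hC (adjoin (symbolic n) z).
  move=> a [s nCs [b Ab [e sE]]]; exists s => //; exists b; last by exists e.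
  by apply: saturation_sub; exact: ideal_addr.
have [n0 n0P] := dcc_over_primary hC hN
  (saturation_saturated (hC := hC) (J := adjoin A z)) Jprim
  (fun n => saturation_saturated (hC := hC) (J := adjoin (symbolic n) z)) JI Idec.
have symsat n : saturated C (M := R^o) (symbolic n).
  by move=> s u nCs; apply: saturation_saturated; exact: notinBC.
have stat : symbolic n0 `<=` symbolic n0.+1.
  have [l lE] := hN (symbolic n0).
  apply: (nakayama hC (M := R^o) (symsat n0.+1) lE) => a Ba.
  have [|s nCs [b Bb [e sE]]] := n0P n0 (leqnn _) a.
    by apply: saturation_sub; exact: adjoin_sub.
  exists s, b; split=> //.
  apply: generated_sub; exists z, e; split=> //.
    apply: (saturation_saturated (hC := hB) (s := z)) => //.
    rewrite /GRing.scale/=; have -> : z * e = s * a - b by rewrite sE; ring.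
    apply: (idealB (I := symbolic n0)); last exact: symbolicS.
    exact: (idealMl (I := symbolic n0)).
  by rewrite /GRing.scale/= sE; ring.
have powA : ideal_pow B n0 `<=` A.
  have [l lE] := hN (ideal_pow B n0).
  apply: (nakayama hB (M := R^o) (prime_saturated hA AB) lE) => a Ba.
  have [|s nBs [b Bb [c Ac sE]]] := stat a.
    by apply: saturation_sub; exact: ideal_addl.
  exists s, c; split=> //.
  rewrite [_ *: _]sE addrK.
  apply: (generated_min (N := ideal_scale B (ideal_pow B n0))) Bb.
  move=> _ [e [f [Be Bf ->]]]; apply: generated_sub; by exists e, f.
apply: nBA => b Bb; apply: (prime_idealX hA (n := n0)); apply: powA.
elim: n0 {n0P stat} => [|n IHn]; first by apply: generated_sub.
by rewrite exprS; apply: generated_sub; exists b, (b ^+ n).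
Qed.

End PrincipalIdealTheorem.

(** * Regular sequences *)

Section RegularSequences.
Context (R : comPzRingType).
Implicit Types (I J L A B C P : ideal R) (y z w : R) (s t : seq R).

Lemma ideal_ext I J : I `<=` J -> J `<=` I -> I = J.
Proof.
case: I J => [I I0 IP] [J J0 JP] /= IJ JI.
have E : I = J by apply/seteqP.
by subst J; congr Submodule; exact: Prop_irrelevance.
Qed.

Lemma adjoinAC J y z : adjoin (adjoin J y) z = adjoin (adjoin J z) y.
Proof.
have sub w v : adjoin (adjoin J w) v `<=` adjoin (adjoin J v) w.
  apply: adjoin_min; last by apply: adjoin_sub; exact: adjoin_mem.
  apply: adjoin_min; last exact: adjoin_mem.
  by apply: (subset_trans (@adjoin_sub _ _ v)); exact: adjoin_sub.
by apply: ideal_ext; exact: sub.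
Qed.

Fixpoint adjoins J s : ideal R :=
  if s is y :: s' then adjoins (adjoin J y) s' else J.

Lemma adjoins_adjoin J s y : adjoins (adjoin J y) s = adjoin (adjoins J s) y.
Proof. by elim: s J => //= z s IHs J; rewrite adjoinAC IHs. Qed.

Lemma adjoins_sub J s : J `<=` adjoins J s.
Proof.
elim: s J => [J|y s IHs J] /=; first exact: subset_refl.
by apply: (subset_trans (@adjoin_sub _ _ y)); exact: IHs.
Qed.

Lemma adjoins_min J s P : J `<=` P -> (forall y, y \in s -> P y) -> adjoins J s `<=` P.
Proof.
elim: s J => //= y s IHs J JP sP; apply: IHs; last first.
  by move=> z zs; apply: sP; rewrite inE zs orbT.
by apply: adjoin_min => //; apply: sP; exact: mem_head.
Qed.

Lemma adjoins_mem J s y : y \in s -> adjoins J s y.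
Proof.
elim: s J => //= z s IHs J; rewrite inE => /predU1P[->|/IHs]; last exact.
by apply: adjoins_sub; exact: adjoin_mem.
Qed.

Definition nonzerodivisor J y : Prop := forall a, J (a * y) -> J a.

Fixpoint regular_seq J s : Prop :=
  if s is y :: s' then nonzerodivisor J y /\ regular_seq (adjoin J y) s' else True.

Lemma nonzerodivisorX J y n : nonzerodivisor J y -> nonzerodivisor J (y ^+ n).
Proof.
move=> Jy; elim: n => [|n IHn] a; first by rewrite mulr1.
by rewrite exprSr mulrA => /Jy/IHn.
Qed.

Lemma nonzerodivisor_swap J y w :
  nonzerodivisor J y -> nonzerodivisor (adjoin J y) w -> nonzerodivisor (adjoin J w) y.
Proof.
move=> Jy Jyw a [j Jj [c aE]].
have [|j' Jj' [c' cE]] := Jyw c.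
  exists (- j); first by rewrite -sub0r; apply: idealB => //; exact: ideal0.
  by exists a; rewrite aE; ring.
exists (a - c' * w); last by exists c'; rewrite subrK.
apply: Jy; have -> : (a - c' * w) * y = a * y - c' * y * w by ring.
have -> : c' * y = c - j' by rewrite cE; ring.
rewrite aE; have -> : j + c * w - (c - j') * w = j + j' * w by ring.
by apply: idealD => //; exact: idealMr.
Qed.

(** By induction on [n]: if [b w] is in [J + (y^(n+1))] then [b = c y] modulo [J],
    and cancelling [y] gives [c w] in [J + (y^n)]. *)
Lemma nonzerodivisor_adjoinX J y w n : nonzerodivisor J y ->
  nonzerodivisor (adjoin J y) w -> nonzerodivisor (adjoin J (y ^+ n)) w.
Proof.
move=> Jy Jyw; elim: n => [|n IHn] b.
  by move=> _; apply: ideal_eq1; rewrite expr0; exact: adjoin_mem.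
move=> [j Jj [r bwE]].
have [|j' Jj' [c bE]] := Jyw b.
  by exists j => //; exists (r * y ^+ n); rewrite bwE exprSr mulrA.
have [|j2 Jj2 [e cE]] := IHn c.
  exists (c * w - r * y ^+ n); last by exists r; rewrite subrK.
  apply: Jy; have -> : (c * w - r * y ^+ n) * y = c * y * w - r * y ^+ n.+1.
    by rewrite exprSr; ring.
  have -> : c * y = b - j' by rewrite bE; ring.
  rewrite mulrBl bwE; have -> : j + r * y ^+ n.+1 - j' * w - r * y ^+ n.+1 = j - j' * w.
    by ring.
  by apply: idealB => //; exact: idealMr.
exists (j' + j2 * y); first by apply: idealD => //; exact: idealMr.
by exists e; rewrite bE cE exprSr; ring.
Qed.

(** The head [y] stays regular modulo each later element, which is what allows
    replacing it by a power without assuming that regular sequences permute. *)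
Lemma regular_seq_headX J y s n : nonzerodivisor J y ->
  regular_seq (adjoin J y) s -> regular_seq (adjoin J (y ^+ n)) s.
Proof.
elim: s J => //= w s IHs J Jy [Jyw ws]; split.
  exact: nonzerodivisor_adjoinX.
rewrite adjoinAC; apply: IHs; last by rewrite adjoinAC.
exact: nonzerodivisor_swap.
Qed.

Lemma regular_seqX J s n : regular_seq J s -> regular_seq J [seq y ^+ n | y <- s].
Proof.
elim: s J => //= y s IHs J [Jy ys]; split; first exact: nonzerodivisorX.
by apply: IHs; exact: regular_seq_headX.
Qed.

Lemma nonzerodivisor_adjoins J y s : nonzerodivisor J y ->
  regular_seq (adjoin J y) s -> nonzerodivisor (adjoins J s) y.
Proof.
elim: s J => //= w s IHs J Jy [Jyw ws]; apply: IHs.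
  exact: nonzerodivisor_swap.
by rewrite adjoinAC.
Qed.

Lemma regular_seq_rcons J s y :
  regular_seq J (rcons s y) <-> regular_seq J s /\ nonzerodivisor (adjoins J s) y.
Proof.
elim: s J => [|z s IHs] J /=; first by split=> [[]|[]].
by rewrite IHs; split=> [[? []]|[[]]].
Qed.

(** ** Chains of ideals above the powers of a regular sequence *)

Definition ideal_chain J n : Prop := exists L : nat -> ideal R,
  (forall j, J `<=` L j) /\
  forall j, (j < n)%N -> L j `<=` L j.+1 /\ ~ (L j.+1 `<=` L j).

Section Dilation.
Context (J L : ideal R) (z : R).

Definition dilation_set : set R := [set a | exists2 b, J b & exists2 c, L c & a = b + c * z].

Lemma dilation_set0 : dilation_set 0.
Proof.
by exists 0; [exact: ideal0 | exists 0; [exact: ideal0 | rewrite mul0r addr0]].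
Qed.

Lemma dilation_setP (a : R) (u v : R^o) :
  dilation_set u -> dilation_set v -> dilation_set (a *: u + v).
Proof.
case=> b Jb [c Lc ->] [b' Jb' [c' Lc' ->]]; exists (a * b + b').
  by apply: idealD => //; exact: idealMl.
exists (a * c + c'); first by apply: idealD => //; exact: idealMl.
by rewrite /GRing.scale/=; ring.
Qed.

Definition dilation : ideal R := Submodule (M := R^o) dilation_set0 dilation_setP.

End Dilation.

(** The ideals [J' + w L], for [L] in a chain above [J = (J' : w)], come below
    a chain above [J' + (w)]: this is additivity of length along
    [0 -> R/J -> R/J' -> R/(J' + (w)) -> 0]. *)
Lemma ideal_chain_cat J J' w n n' :
  (forall a, J' (a * w) -> J a) -> ideal_chain J n -> ideal_chain (adjoin J' w) n' ->
  ideal_chain J' (n + n').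
Proof.
move=> colJ [L [JL Lchain]] [L' [JL' L'chain]].
exists (fun j => if (j < n)%N then dilation J' (L j) w else L' (j - n)%N).
have dilE j c : dilation J' (L j) w (c * w) -> L j c.
  move=> [b Jb [e Le cE]]; rewrite -[c](subrK e); apply: idealD => //.
  by apply: JL; apply: colJ; rewrite mulrBl cE addrK.
split=> j.
  case: ifP => _ a Ja.
    exists a => //; exists 0; first exact: ideal0.
    by rewrite mul0r addr0.
  by apply: JL'; exact: adjoin_sub.
move=> jnn'; case: (ltnP j.+1 n) => [jn|].
  rewrite (ltnW jn); have [sub nsub] := Lchain j (ltnW jn).
  split=> [a [b Jb [c Lc ->]]|sub'].
    by exists b => //; exists c => //; exact: sub.
  apply: nsub => c Lc; apply: dilE; apply: sub'.
  by exists 0; [exact: ideal0|exists c => //; rewrite add0r].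
rewrite leq_eqVlt => /predU1P[nE|nj].
  rewrite nE ltnSn subnn; have [sub nsub] : L j `<=` L j.+1 /\ ~ (L j.+1 `<=` L j).
    by apply: Lchain; rewrite nE.
  split=> [a [b Jb [c Lc ->]]|sub'].
    by apply: JL'; exists b => //; exists c.
  apply: nsub => c _; apply: ideal_eq1; apply: dilE; rewrite mul1r; apply: sub'.
  by apply: JL'; exact: adjoin_mem.
rewrite ltnNge -ltnS nj/= subSn; last by lia.
by apply: L'chain; lia.
Qed.

Lemma ideal_chain_sub J J' n : J' `<=` J -> ideal_chain J n -> ideal_chain J' n.
Proof.
move=> JJ' [L [JL Lchain]]; exists L; split=> // j.
exact: subset_trans (JL j).
Qed.

Lemma ideal_chainX J y n k : nonzerodivisor J y ->
  ideal_chain (adjoin J y) n -> ideal_chain (adjoin J (y ^+ k)) (k * n).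
Proof.
move=> Jy yn; elim: k => [|k IHk].
  exists (fun=> adjoin J (y ^+ 0)); split=> j; first exact: subset_refl.
  by rewrite mul0n ltn0.
rewrite mulSn; apply: (ideal_chain_cat (J := adjoin J y) (w := y ^+ k)) => //.
  move=> a [j Jj [r aE]]; exists (a - r * y); last by exists r; rewrite subrK.
  apply: (nonzerodivisorX (n := k) Jy); rewrite mulrBl aE exprS.
  by rewrite [X in J X](_ : _ = j)//; ring.
apply: ideal_chain_sub IHk; apply: adjoin_min; last exact: adjoin_mem.
apply: adjoin_min; first exact: adjoin_sub.
by rewrite exprS; apply: idealMl; exact: adjoin_mem.
Qed.

(** The head is regular modulo the powers of the tail, so the length is
    multiplied by [q] for each element of the sequence. *)
Lemma regular_seq_chain J s q : regular_seq J s -> ~ adjoins J s 1 ->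
  ideal_chain (adjoins J [seq y ^+ q | y <- s]) (q ^ size s).
Proof.
elim: s J => [|y s IHs] J /=.
  move=> _ nJ1; exists (fun j => if j is 0 then J else generated_ideal setT); split.
    by case=> // j a _; exact: generated_sub.
  case=> // _; split=> [a _|sub]; first exact: generated_sub.
  by apply: nJ1; apply: sub; exact: generated_sub.
move=> [Jy ys] nJ1; have chs := IHs _ ys nJ1.
rewrite expnS adjoins_adjoin; apply: ideal_chainX; last by rewrite -adjoins_adjoin.
by apply: nonzerodivisor_adjoins => //; exact: regular_seqX.
Qed.

End RegularSequences.

(** * Regular local rings *)

Section PrimeChains.
Context (R : comPzRingType).
Implicit Types A B C J : ideal R.

Fixpoint prime_chain (k : nat) A C : Prop :=
  if k is k'.+1 then
    exists B, [/\ prime_chain k' A B, B `<=` C, ~ (C `<=` B) & prime_ideal C]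
  else A = C /\ prime_ideal C.

Lemma prime_chain_prime k A C : prime_chain k A C -> prime_ideal C.
Proof. by case: k => [[]|k [B []]]. Qed.

(** The principal ideal theorem is applied at the top of the chain, producing a
    prime below [C] through [z], and then further and further down. *)
Lemma prime_chain_bend (hN : noetherian R) k A C z : prime_chain k.+1 A C -> C z ->
  exists B, [/\ prime_ideal B, A `<=` B, ~ (B `<=` A), B z & prime_chain k B C].
Proof.
elim: k C => [|k IHk] C.
  by case=> _ [[<- hA] AC nCA hC] Cz; exists C.
case=> B [[A' [AA' A'B nBA' hB]] BC nCB hC] Cz.
have [Q [hQ A'Q nQA' QC [nCQ Qz]]] := principal_ideal_theorem hN
  (prime_chain_prime AA') hB hC A'B nBA' BC nCB Cz.
have [|D [hD AD nDA Dz DQ]] := IHk Q _ Qz; first by exists A'.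
by exists D; split=> //; exists Q.
Qed.

End PrimeChains.

Section LocalRing.
Context (R : comPzRingType) (hN : noetherian R) (m : ideal R) (hm : local_ring m).

Lemma local_proper (J : ideal R) : ~ J 1 -> J `<=` m.
Proof.
move=> nJ1.
have [Q [nQ1 JQ Qmax]] := noetherian_max hN (P := fun X : ideal R => ~ X 1) nJ1.
case: hm => _ /(_ Q) <-//; split=> // X QX nX1; exact: Qmax.
Qed.

Lemma local_unit (s : R) : ~ m s -> exists t, t * s = 1.
Proof.
move=> nms; apply: contrapT => /forallNP nt.
apply: nms; apply: (@local_proper (generated_ideal [set` [:: s]])).
  by move=> /generated_seqP[b /=]; rewrite big_ord1 => /esym; exact: nt.
by apply: generated_sub; exact: mem_head.
Qed.

Lemma local_prime : prime_ideal m.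
Proof.
case: hm => -[nm1 _] _; split=> // a b mab; apply: contrapT => /not_orP[nma nmb].
have [[c cE] [e eE]] := (local_unit nma, local_unit nmb).
apply: nm1; rewrite (_ : 1 = c * e * (a * b)); first exact: idealMl.
by transitivity ((c * a) * (e * b)); [rewrite cE eE mulr1|ring].
Qed.

Lemma local_saturated (M : lmodType R) (N : submodule M) : saturated m N.
Proof.
move=> s u /local_unit[t tE] Nsu; rewrite -[u]scale1r -tE -scalerA.
exact: submoduleZ.
Qed.

(** Adjoining [y] to [J] lowers both the number of generators of [m] and the
    length of a chain, by bending the chain through [y]; so [J + (y)] is the
    prime [B] following [A], whence [A] is contained in [J + y A] and equals [J].
    In particular [R/J] is a domain and [y] is regular on it. *)
Lemma regular_seq_of_chain (J A : ideal R) (s : seq R) :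
  J `<=` A -> prime_ideal A -> prime_chain (size s) A m ->
  m `<=` adjoins J s -> (forall y, y \in s -> m y) ->
  A = J /\ regular_seq J s.
Proof.
elim: s J A => [|y s IHs] J A JA hA /=.
  by move=> [AE _] mJ _; split=> //; rewrite AE in JA *; exact: ideal_ext.
move=> Am mJs sm; have my : m y by apply: sm; exact: mem_head.
have [B [hB AB nBA By Bm]] := prime_chain_bend hN Am my.
have [||BE ys] := IHs _ _ _ hB Bm mJs.
- by apply: adjoin_min => //; exact: subset_trans AB.
- by move=> z zs; apply: sm; rewrite inE zs orbT.
have nAy : ~ A y by move=> Ay; apply: nBA; rewrite BE; exact: adjoin_min.
have AJ : A = J.
  apply: ideal_ext => //; have [l lE] := hN A.
  apply: (nakayama local_prime (M := R^o) (@local_saturated _ J) lE) => a Aa.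
  have := AB _ Aa; rewrite BE => -[b Jb [c aE]].
  exists 1, b; split=> //; first exact: (prime_ideal1 local_prime).
  apply: generated_sub; exists y, c; split=> //; last first.
    by rewrite scale1r [LHS]/= aE addrC addKr /GRing.scale/= mulrC.
  case: hA => _ /(_ c y) []// .
  have -> : c * y = a - b by rewrite aE addrC addKr.
  by apply: idealB => //; exact: JA.
split=> //; split=> // a; rewrite -AJ.
by case: hA => _ /[apply] -[].
Qed.

End LocalRing.

Section ZeroIdeal.
Context (R : comPzRingType).

Lemma zero_ideal_subproof (a : R) (u v : R^o) :
  [set 0 : R^o] u -> [set 0 : R^o] v -> [set 0 : R^o] (a *: u + v).
Proof. by move=> /= -> ->; rewrite scaler0 addr0. Qed.

Definition zero_ideal : ideal R :=
  Submodule (M := R^o) (submodule_set := [set 0]) erefl zero_ideal_subproof.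

End ZeroIdeal.

Lemma regular_local_seq (R : comNzRingType) (m : ideal R) (d : nat) :
  regular_local_ring m d -> exists s : seq R,
  [/\ size s = d, adjoins (zero_ideal R) s = m & regular_seq (zero_ideal R) s].
Proof.
case=> hN hm [[P [hP chP]] dimP] [y mE].
pose s := [seq y i | i <- enum 'I_d].
have size_s : size s = d by rewrite size_map size_enum_ord.
have sm z : z \in s -> m z.
  move=> /mapP[i _ ->]; rewrite -[m _]/((m : set R) _) mE.
  by apply: generated_sub; exists i.
have ms : m `<=` adjoins (zero_ideal R) s.
  rewrite mE; apply: generated_min => _ [i _ <-].
  by apply: adjoins_mem; apply: map_f; rewrite mem_enum.
have Pm k : (k <= d)%N -> P k `<=` m by move=> /hP[nP1 _]; exact: local_proper.
(* Otherwise [m] would extend the chain beyond the Krull dimension. *)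
have Pdm : P d = m.
  apply: ideal_ext; first exact: Pm.
  apply: contrapT => nmP.
  suff : has_prime_chain R d.+1 by move=> /dimP; rewrite ltnn.
  exists (fun j => if (j <= d)%N then P j else m); split=> j.
    by case: ifP => [/hP//|_ _]; exact: local_prime.
  rewrite ltnS leq_eqVlt => /predU1P[->|jd].
    by rewrite /= eqxx ltnn; split=> //; exact: Pm.
  by rewrite /= jd orbT; exact: chP.
have ch k : (k <= d)%N -> prime_chain k (P 0%N) (P k).
  elim: k => [|k IHk kd]; first by split=> //; exact: hP.
  have [sub nsub] := chP k kd.
  by exists (P k); split=> //; [exact: IHk (ltnW kd)|exact: hP].
have P0m : prime_chain (size s) (P 0%N) m by rewrite size_s -Pdm; exact: ch.
have [|_ reg] := regular_seq_of_chain hN hm (J := zero_ideal R) _ (hP 0%N isT) P0m ms sm.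
  by move=> a /= ->; exact: ideal0.
exists s; split=> //; apply: ideal_ext => //.
by apply: adjoins_min => // a /= ->; exact: ideal0.
Qed.

(** * Flatness of an endomorphism of a regular local ring *)

Section Generates.
Context (R : comPzRingType).
Implicit Types I J : ideal R.

Definition generates n (a : 'cV[R]_n) I : Prop :=
  forall u, I u <-> exists b : 'rV_n, u = (b *m a) 0 0.

Lemma generates_entry n (a : 'cV[R]_n) I i : generates a I -> I (a i 0).
Proof. by move=> aI; apply/aI; exists (delta_mx 0 i); rewrite -rowE mxE. Qed.

Lemma generates_mul n (a : 'cV[R]_n) I k (B : 'M[R]_(k, n)) i :
  generates a I -> I ((B *m a) i 0).
Proof. by move=> aI; apply/aI; exists (row i B); rewrite -row_mul [RHS]mxE. Qed.

Lemma generates_lift n (a : 'cV[R]_n) I k (e : 'cV[R]_k) :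
  generates a I -> (forall i, I (e i 0)) -> exists G : 'M[R]_(k, n), e = G *m a.
Proof.
move=> aI eI; have /choice[b bE] : forall i, exists b : 'rV_n, e i 0 = (b *m a) 0 0.
  by move=> i; apply/aI.
exists (\matrix_i b i); apply/matrixP => i j; rewrite ord1 bE.
by rewrite -[b i](rowK b) -row_mul [LHS]mxE.
Qed.

Lemma generates_col_mx n (a : 'cV[R]_n) I (z : R) :
  generates a I -> generates (col_mx a z%:M) (adjoin I z).
Proof.
move=> aI u; split.
  move=> [b /aI[b' ->] [c ->]]; exists (row_mx b' c%:M).
  by rewrite mul_row_col -scalar_mxM !mxE mulr1n.
move=> [b ->]; rewrite -[b]hsubmxK mul_row_col mul_mx_scalar mxE.
exists ((lsubmx b *m a) 0 0); first by apply/aI; exists (lsubmx b).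
by exists (rsubmx b 0 0); rewrite [X in _ + X]mxE mulrC.
Qed.

Lemma generates0 : generates (0 : 'cV[R]_0) (zero_ideal R).
Proof.
move=> u; split=> [/= ->|[b ->]]; first by exists 0; rewrite mul0mx mxE.
by rewrite mulmx0 mxE; exact: ideal0.
Qed.

Lemma generates1 I : I 1 -> generates (1%:M : 'cV[R]_1) I.
Proof.
move=> I1 u; split=> _; last exact: ideal_eq1.
by exists u%:M; rewrite mulmx1 mxE mulr1n.
Qed.

Lemma noetherian_generates I : noetherian R -> exists n (a : 'cV[R]_n), generates a I.
Proof.
move=> hN; have [s sE] := hN I; exists (size s), (\col_i s`_i) => u.
rewrite -[I u]/((I : set R) u) sE; split.
  move=> /generated_seqP[b ->]; exists (\row_i b i).
  by rewrite mxE; apply: eq_bigr => i _; rewrite !mxE.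
move=> [b ->]; apply/generated_seqP; exists (b 0).
by rewrite mxE; apply: eq_bigr => i _; rewrite !mxE.
Qed.

(** Finite generation is checked on the first coordinate, then on the vectors
    whose first coordinate vanishes. *)
Lemma noetherian_rV n (N : submodule 'rV[R]_n) : noetherian R ->
  exists l : seq 'rV[R]_n, (N : set _) = generated [set` l].
Proof.
move=> hN; elim: n N => [|n IHn] N.
  exists [::]; apply/seteqP; split=> u _; rewrite thinmx0; exact: submodule0.
pose I0 : set R := [set c | exists v : 'rV_n, N (row_mx (c%:M : 'M[R]_1) v)].
have I00 : I0 0 by exists 0; rewrite raddf0 row_mx0; exact: submodule0.
have I0P (c : R) (u v : R^o) : I0 u -> I0 v -> I0 (c *: u + v).
  move=> [u' Nu] [v' Nv]; exists (c *: u' + v').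
  have -> : (c *: u + v)%:M = c *: u%:M + v%:M :> 'M[R]_1.
    by rewrite raddfD/= scale_scalar_mx.
  by rewrite -add_row_mx -scale_row_mx; exact: submoduleP.
have [s sE] := hN (Submodule (M := R^o) I00 I0P).
pose K0 : set 'rV[R]_n := [set v | N (row_mx (0 : 'M[R]_1) v)].
have K00 : K0 0 by rewrite /K0/= row_mx0; exact: submodule0.
have K0P (c : R) u v : K0 u -> K0 v -> K0 (c *: u + v).
  rewrite /K0/= => Nu Nv; rewrite -[0](addr0 0) -{1}(scaler0 _ c).
  by rewrite -add_row_mx -scale_row_mx; exact: submoduleP.
have [t tE] := IHn (Submodule K00 K0P).
have /choice[w wE] : forall i : 'I_(size s), exists v : 'rV_n,
    N (row_mx ((s`_i)%:M : 'M[R]_1) v).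
  move=> i.
  suff : (Submodule (M := R^o) I00 I0P : set R) s`_i by [].
  by rewrite sE; apply: generated_sub; exact: mem_nth.
pose lift (i : 'I_(size s)) : 'rV[R]_(1 + n) := row_mx (s`_i)%:M (w i).
exists ([seq lift i | i <- enum 'I_(size s)] ++
        [seq row_mx (0 : 'M[R]_1) v | v <- t]).
apply/seteqP; split; last first.
  apply: generated_min => u /=; rewrite mem_cat => /orP[/mapP[i _ ->]|/mapP[v vt ->]].
    exact: wE.
  suff : (Submodule K00 K0P : set _) v by [].
  by rewrite tE; exact: generated_sub.
move=> u Nu; set L := [set` _].
have uE : u = row_mx (lsubmx (u : 'rV_(1 + n))) (rsubmx (u : 'rV_(1 + n))).
  by rewrite hsubmxK.
have : (Submodule (M := R^o) I00 I0P : set R) (u 0 0).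
  exists (rsubmx (u : 'rV_(1 + n))).
  suff -> : (u 0 0)%:M = lsubmx (u : 'rV_(1 + n)) :> 'M[R]_1 by rewrite -uE.
  rewrite [RHS]mx11_scalar !mxE; congr (u _ _)%:M; exact: val_inj.
rewrite sE => /generated_seqP[b bE].
pose v := u - \sum_i b i *: lift i.
have -> : u = v + \sum_i b i *: lift i by rewrite subrK.
apply: (submoduleD (N := generated L)); last first.
  apply: (submodule_sum (N := generated L)) => i _; apply: submoduleZ.
  apply: generated_sub.
  by rewrite /L/= mem_cat map_f ?mem_enum.
have lv : lsubmx (v : 'rV_(1 + n)) = 0.
  apply/matrixP => i j; rewrite !ord1 !mxE.
  rewrite (_ : lshift n 0 = 0); last exact: val_inj.
  rewrite bE summxE; apply/eqP; rewrite subr_eq0; apply/eqP; apply: eq_bigr => k _.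
  rewrite [RHS]mxE; congr (_ * _).
  have <- : lift k 0 (lshift n 0) = s`_k by rewrite row_mxEl mxE mulr1n.
  by congr (lift k _ _); exact: val_inj.
have vE : v = row_mx (0 : 'M[R]_1) (rsubmx (v : 'rV_(1 + n))) by rewrite -lv hsubmxK.
have : (Submodule K00 K0P : set _) (rsubmx (v : 'rV_(1 + n))).
  rewrite /= /K0/= -vE; apply: (submoduleB (N := N)) => //.
  by apply: (submodule_sum (N := N)) => i _; apply: submoduleZ; exact: wE.
rewrite tE => /generated_seqP[c cE]; rewrite vE cE.
have -> : row_mx (0 : 'M[R]_1) (\sum_i c i *: t`_i) =
    \sum_i c i *: row_mx (0 : 'M[R]_1) t`_i :> 'rV[R]_(1 + n).
  elim/big_rec2 : _ => [|i x y _ <-]; first by rewrite row_mx0.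
  by rewrite scale_row_mx scaler0 add_row_mx addr0.
apply: (submodule_sum (N := generated L)) => i _; apply: submoduleZ.
apply: generated_sub; rewrite /L/= mem_cat; apply/orP; right; apply: map_f; exact: mem_nth.
Qed.

End Generates.

Section Flatness.
Context (R : comPzRingType) (phi : {rmorphism R -> R}).
Implicit Types I J : ideal R.

(** The syzygies of [phi a] come from those of [a]: this is the vanishing of
    [Tor_1(R/I, R)], with [R] a module via [phi] and [I] generated by [a]. *)
Definition syzygy_flat n (a : 'cV[R]_n) : Prop :=
  forall b : 'rV_n, b *m map_mx phi a = 0 ->
  exists k (C : 'M[R]_(k, n)) (s : 'rV_k), C *m a = 0 /\ b = s *m map_mx phi C.

Lemma syzygy_flat_generates n (a : 'cV[R]_n) n' (a' : 'cV[R]_n') I :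
  generates a I -> generates a' I -> syzygy_flat a -> syzygy_flat a'.
Proof.
move=> aI a'I flat b bE.
have [P PE] := generates_lift aI (fun i => generates_entry i a'I).
have [Q QE] := generates_lift a'I (fun i => generates_entry i aI).
have [|k [C [s [Ca bP]]]] := flat (b *m map_mx phi P).
  by rewrite -mulmxA -map_mxM -PE.
exists (n' + k)%N, (col_mx (1%:M - P *m Q) (C *m Q)), (row_mx b s); split.
  by rewrite mul_col_mx mulmxBl mul1mx -!mulmxA -QE -PE subrr Ca col_mx0.
rewrite map_col_mx mul_row_col map_mxB map_mx1 mulmxBr mulmx1 !map_mxM.
by rewrite !mulmxA -bP subrK.
Qed.

Lemma syzygy_flat1 : syzygy_flat (1%:M : 'cV[R]_1).
Proof.
move=> b; rewrite map_mx1 mulmx1 => ->.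
by exists 0%N, 0, 0; split; rewrite ?mul0mx.
Qed.

Lemma syzygy_flat0 (a : 'cV[R]_0) : syzygy_flat a.
Proof.
move=> b _; exists 0%N, 0, 0; split; first exact: mul0mx.
by rewrite mul0mx thinmx0.
Qed.

(** [Tor_1] vanishes on [R/I] when it does on the outer terms of
    [0 -> R/(I : z) -> R/I -> R/(I + (z)) -> 0]. *)
Lemma syzygy_flat_colon n (a : 'cV[R]_n) k (c : 'cV[R]_k) I z :
  generates a I -> generates c (colon I z) -> syzygy_flat c ->
  syzygy_flat (col_mx a z%:M) -> syzygy_flat a.
Proof.
move=> aI cI flatc flataz b bE.
have [|l [Ce [s [CeE]]]] := flataz (row_mx b 0).
  by rewrite map_col_mx mul_row_col bE mul0mx addr0.
rewrite -[Ce]hsubmxK in CeE *; set C := lsubmx Ce in CeE *; set e := rsubmx Ce in CeE *.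
rewrite map_row_mx mul_mx_row => /eq_row_mx[bC /esym se].
rewrite mul_row_col mul_mx_scalar in CeE.
have CaE : C *m a = - (z *: e) by apply/eqP; rewrite -addr_eq0 CeE.
have [G GE] : exists G, e = G *m c.
  apply: (generates_lift cI) => i; change (I (e i 0 * z)); rewrite mulrC.
  have -> : z * e i 0 = (- C *m a) i 0 by rewrite mulNmx CaE opprK [RHS]mxE.
  exact: generates_mul aI.
have [T TE] : exists T, z *: c = T *m a.
  apply: (generates_lift aI) => i; rewrite mxE mulrC.
  exact: (generates_entry i cI).
have [|l' [H [s' [Hc sG]]]] := flatc (s *m map_mx phi G).
  by rewrite -mulmxA -map_mxM -GE.
exists (l + l')%N, (col_mx (C + G *m T) (- H *m T)), (row_mx s s'); split.
  rewrite mul_col_mx mulmxDl CaE -!mulmxA -TE -!scalemxAr -GE addNr.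
  by rewrite mulNmx Hc oppr0 scaler0 col_mx0.
rewrite map_col_mx mul_row_col map_mxD mulmxDr -bC mulNmx map_mxN mulmxN !map_mxM.
by rewrite !mulmxA -sG addrK.
Qed.

(** When [z] is regular on [R/I], the sequence reads
    [0 -> R/I -> R/I -> R/(I + (z)) -> 0]: vanishing at the right end makes the
    multiplication by [phi z] onto on [Tor_1(R/I, R)], and Nakayama applies. *)
Lemma syzygy_flat_nonzerodivisor (m : ideal R) n (a : 'cV[R]_n) I z :
  noetherian R -> local_ring m -> m (phi z) -> generates a I ->
  nonzerodivisor I z -> syzygy_flat (col_mx a z%:M) -> syzygy_flat a.
Proof.
move=> hN hm mz aI Iz flataz.
pose E0 : set 'rV[R]_n := [set b | b *m map_mx phi a = 0].
have E00 : E0 0 by exact: mul0mx.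
have E0P c u v : E0 u -> E0 v -> E0 (c *: u + v).
  by rewrite /E0/= => uE vE; rewrite mulmxDl -scalemxAl uE vE scaler0 addr0.
pose K0 : set 'rV[R]_n := [set b | exists k (C : 'M[R]_(k, n)) (s : 'rV_k),
  C *m a = 0 /\ b = s *m map_mx phi C].
have K00 : K0 0 by exists 0%N, 0, 0; split; rewrite mul0mx.
have K0P c u v : K0 u -> K0 v -> K0 (c *: u + v).
  move=> [k [C [s [Ca ->]]]] [l [D [t [Da ->]]]].
  exists (k + l)%N, (col_mx C D), (row_mx (c *: s) t); split.
    by rewrite mul_col_mx Ca Da col_mx0.
  by rewrite map_col_mx mul_row_col scalemxAl.
have [l lE] := noetherian_rV (Submodule E00 E0P) hN.
suff sub : Submodule E00 E0P `<=` Submodule K00 K0P by move=> b /sub.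
apply: (nakayama (local_prime hN hm) (@local_saturated _ hN _ hm _ _) lE) => b bE.
have [|k [Ce [s [CeE]]]] := flataz (row_mx b 0).
  by rewrite map_col_mx mul_row_col bE mul0mx addr0.
rewrite -[Ce]hsubmxK in CeE *; set C := lsubmx Ce in CeE *; set e := rsubmx Ce in CeE *.
rewrite map_row_mx mul_mx_row => /eq_row_mx[bC /esym se].
rewrite mul_row_col mul_mx_scalar in CeE.
have CaE : C *m a = - (z *: e) by apply/eqP; rewrite -addr_eq0 CeE.
have [G GE] : exists G, e = G *m a.
  apply: (generates_lift aI) => i; apply: Iz; rewrite mulrC.
  have -> : z * e i 0 = (- C *m a) i 0 by rewrite mulNmx CaE opprK [RHS]mxE.
  exact: generates_mul aI.
exists 1, (s *m map_mx phi (C + z *: G)); split.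
- exact: prime_ideal1 (local_prime hN hm).
- exists k, (C + z *: G), s; split=> //.
  by rewrite mulmxDl CaE -scalemxAl -GE addNr.
- apply: generated_sub; exists (phi z), (- (s *m map_mx phi G)); split=> //.
    by rewrite /= /E0/= mulNmx -mulmxA -map_mxM -GE se oppr0.
  rewrite scale1r map_mxD mulmxDr -bC map_mxZ -scalemxAr scalerN.
  by rewrite opprD addNKr.
Qed.

(** The Koszul relations between [phi w] and [phi a] are images of those
    between [w] and [a]. *)
Lemma syzygy_flat_koszul n (a : 'cV[R]_n) J w :
  generates (map_mx phi a) J -> nonzerodivisor J (phi w) ->
  syzygy_flat a -> syzygy_flat (col_mx a w%:M).
Proof.
move=> aJ Jw flat b; rewrite -[b]hsubmxK.
set b1 := lsubmx b; set r := rsubmx b.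
rewrite map_col_mx mul_row_col map_scalar_mx mul_mx_scalar => bE.
have [b' rE] : exists b', r = b' *m map_mx phi a.
  apply: (generates_lift aJ) => i; apply: Jw; rewrite ord1.
  have -> : r 0 0 * phi w = ((- b1) *m map_mx phi a) 0 0.
    rewrite mulNmx; have -> : - (b1 *m map_mx phi a) = phi w *: r.
      by move/eqP: bE; rewrite addrC addr_eq0 => /eqP ->.
    by rewrite [RHS]mxE mulrC.
  exact: generates_mul aJ.
have [|k [C [s [Ca sE]]]] := flat (b1 + phi w *: b').
  by rewrite mulmxDl -scalemxAl -rE.
exists (k + n)%N, (col_mx (row_mx C 0) (row_mx (- w%:M) a)), (row_mx s b'); split.
  rewrite mul_col_mx !mul_row_col mul0mx addr0 Ca mulNmx.
  by rewrite mul_scalar_mx mul_mx_scalar addNr col_mx0.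
rewrite map_col_mx !map_row_mx mul_row_col !mul_mx_row add_row_mx.
rewrite map_mx0 mulmx0 add0r -rE -sE map_mxN map_scalar_mx mulmxN mul_mx_scalar.
by rewrite addrK.
Qed.

Lemma syzygy_flat_regular_seq (s : seq R) :
  regular_seq (zero_ideal R) [seq phi y | y <- s] ->
  exists n (a : 'cV[R]_n), [/\ generates a (adjoins (zero_ideal R) s),
    generates (map_mx phi a) (adjoins (zero_ideal R) [seq phi y | y <- s]) &
    syzygy_flat a].
Proof.
have rconsE J t y : adjoins J (rcons t y) = adjoin (adjoins J t) y :> ideal R.
  by elim: t J => //= z t IHt J.
elim/last_ind: s => [_|s y IHs].
  exists 0%N, 0; split; first exact: generates0.
    by rewrite map_mx0; exact: generates0.
  exact: syzygy_flat0.
rewrite map_rcons regular_seq_rcons => -[/IHs[n [a [aI aphiI flat]]] sy].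
exists (n + 1)%N, (col_mx a y%:M); rewrite !rconsE; split.
- exact: generates_col_mx.
- by rewrite map_col_mx map_scalar_mx; exact: generates_col_mx.
- exact: syzygy_flat_koszul aphiI sy flat.
Qed.

(** Noetherian induction on [I]: if [z] is in the maximal ideal but not in [I]
    then [I + (z)] is larger, and [(I : z)] is either larger or equal to [I].
    The induction starts from the maximal ideal. *)
Lemma syzygy_flat_ideal (m : ideal R) n0 (y : 'cV[R]_n0) :
  noetherian R -> local_ring m -> (forall a, m a -> m (phi a)) ->
  generates y m -> syzygy_flat y ->
  forall n (a : 'cV[R]_n) I, generates a I -> syzygy_flat a.
Proof.
move=> hN hm mphi ym flaty n a I; elim/(noetherian_ind hN) : I n a => I IH n a aI.
have [I1|nI1] := pselect (I 1).
  exact: syzygy_flat_generates (generates1 I1) aI syzygy_flat1.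
have Im : I `<=` m := local_proper hN hm nI1.
have [mI|/existsNP[z /not_implyP[mz nIz]]] := pselect (m `<=` I).
  by rewrite (ideal_ext Im mI) in aI; exact: syzygy_flat_generates ym aI flaty.
have flataz : syzygy_flat (col_mx a z%:M).
  apply: (IH (adjoin I z)); last exact: generates_col_mx.
    exact: adjoin_sub.
  by move=> sub; apply: nIz; apply: sub; exact: adjoin_mem.
have [colI|ncolI] := pselect (colon I z `<=` I).
  by apply: (syzygy_flat_nonzerodivisor hN hm (mphi _ mz) aI _ flataz) => u /colI.
have [k [c cI]] := noetherian_generates (colon I z) hN.
apply: (syzygy_flat_colon aI cI _ flataz).
by apply: IH cI => //; exact: colon_sub.
Qed.

Section LinearSystems.
Context (hN : noetherian R).
Hypothesis flat : forall n (a : 'cV[R]_n), syzygy_flat a.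

Definition ideal_map J : ideal R := generated_ideal (phi @` J).

Lemma ideal_map_mem J a : J a -> ideal_map J (phi a).
Proof. by move=> Ja; apply: generated_sub; exists a. Qed.

Lemma generates_map n (g : 'cV[R]_n) J :
  generates g J -> generates (map_mx phi g) (ideal_map J).
Proof.
move=> gJ u; split; last first.
  move=> [b ->]; rewrite mxE; apply: ideal_sum => i _.
  by rewrite mxE; apply: idealMl; apply: ideal_map_mem; exact: generates_entry.
pose S0 : set R := [set u | exists b : 'rV_n, u = (b *m map_mx phi g) 0 0].
have S00 : S0 0 by exists 0; rewrite mul0mx mxE.
have S0P (c : R) (v w : R^o) : S0 v -> S0 w -> S0 (c *: v + w).
  by move=> [b ->] [b' ->]; exists (c *: b + b'); rewrite mulmxDl -scalemxAl !mxE.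
apply: (generated_min (N := Submodule (M := R^o) S00 S0P)) => _ [v /gJ[b ->] <-].
by exists (map_mx phi b); rewrite -map_mxM [RHS]mxE.
Qed.

Let flat_mod1 J n (a : 'cV[R]_n) (b : 'rV_n) :
  ideal_map J ((b *m map_mx phi a) 0 0) ->
  exists k (C : 'M[R]_(k, n)) (s : 'rV_k),
    (forall i, J ((C *m a) i 0)) /\ b = s *m map_mx phi C.
Proof.
have [t [g gJ]] := noetherian_generates J hN.
move=> /(generates_map gJ)[v bE].
have [|k [CD [s [CDE]]]] := @flat _ (col_mx a (- g)) (row_mx b v).
  rewrite map_col_mx mul_row_col map_mxN mulmxN.
  apply/matrixP => i j; rewrite !ord1 mxE bE [X in _ + X]mxE subrr.
  by rewrite mxE.
rewrite -[CD]hsubmxK in CDE *; rewrite map_row_mx mul_mx_row => /eq_row_mx[-> _].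
exists k, (lsubmx CD), s; split=> // i.
have -> : lsubmx CD *m a = rsubmx CD *m g.
  by apply/eqP; rewrite -subr_eq0 -mulmxN -mul_row_col CDE.
exact: generates_mul.
Qed.

Let flat_mod J n l (A : 'M[R]_(n, l)) (b : 'rV_n) :
  (forall j, ideal_map J ((b *m map_mx phi A) 0 j)) ->
  exists k (C : 'M[R]_(k, n)) (s : 'rV_k),
    (forall i j, J ((C *m A) i j)) /\ b = s *m map_mx phi C.
Proof.
elim: l n A b => [|l IHl] n A b bA.
  exists n, 1%:M, b; split=> [i []//|].
  by rewrite map_mx1 mulmx1.
pose A' : 'M[R]_(n, 1 + l) := A.
have bA' (j : 'I_(1 + l)) : ideal_map J ((b *m map_mx phi A') 0 j) by exact: bA.
have [|k [C [s [Ca bE]]]] := flat_mod1 (J := J) (a := lsubmx A') (b := b).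
  have := bA' (lshift l 0); rewrite -{1}[A']hsubmxK.
  by rewrite map_row_mx mul_mx_row row_mxEl.
have [j|k' [C' [s' [CA sE]]]] := IHl k (C *m rsubmx A') s.
  rewrite map_mxM mulmxA -bE; have := bA' (rshift 1 j); rewrite -{1}[A']hsubmxK.
  by rewrite map_row_mx mul_mx_row row_mxEr.
exists k', (C' *m C), s'; split; last by rewrite map_mxM mulmxA -sE.
move=> i; change (forall j : 'I_(1 + l), J ((C' *m C *m A') i j)) => j.
rewrite -[A']hsubmxK mul_mx_row; case: (split_ordP j) => j' ->.
  rewrite row_mxEl ord1 -mulmxA mxE; apply: ideal_sum => h _.
  exact: idealMl.
by rewrite row_mxEr -mulmxA; exact: CA.
Qed.

(** Over [R/J], base changed along [phi]: a solution of the homogeneous linear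
    system [phi A] is a combination of images of solutions of [A]. *)
Lemma flat_linear_system J (X Y : finType) (A : X -> Y -> R) (b : X -> R) :
  (forall y, ideal_map J (\sum_x b x * phi (A x y))) ->
  exists k (C : 'I_k -> X -> R) (s : 'I_k -> R),
    (forall i y, J (\sum_x C i x * A x y)) /\
    forall x, b x = \sum_i s i * phi (C i x).
Proof.
move=> bA.
pose Am := \matrix_(i < #|X|, j < #|Y|) A (enum_val i) (enum_val j).
pose bm := \row_(i < #|X|) b (enum_val i).
have sumE (F : X -> R) : \sum_x F x = \sum_(i < #|X|) F (enum_val i).
  by rewrite (reindex _ (onW_bij _ (@enum_val_bij X))).
have [j|k [C [s [CA bE]]]] := flat_mod (J := J) (A := Am) (b := bm).
  rewrite mxE; have := bA (enum_val j); rewrite sumE.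
  by under [X in _ -> _ X]eq_bigr do rewrite !mxE.
exists k, (fun i x => C i (enum_rank x)), (s 0); split=> [i y|x].
  have := CA i (enum_rank y); rewrite mxE sumE.
  by under eq_bigr do rewrite mxE enum_rankK; under [X in _ -> _ X]eq_bigr do rewrite enum_valK.
have := congr1 (fun M : 'rV__ => M 0 (enum_rank x)) bE.
rewrite !mxE enum_rankK => ->; apply: eq_bigr => i _; by rewrite mxE.
Qed.

End LinearSystems.
End Flatness.

(** * Koszul cochains and local cohomology *)

Section Fractions.
Context (R : comPzRingType) (M : lmodType R) (f : R).
Implicit Types (u v : M).

Lemma fraction_eq0 u k : fraction f u k = 0 <-> exists n, f ^+ n *: u = 0.
Proof.
rewrite -[0]/(fraction f (0 : M) 0); split.
  by move=> /fractionE[n]; rewrite scaler0 subr0 expr0 scale1r; exists n.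
by move=> [n nE]; apply/fractionE; exists n; rewrite scaler0 subr0 expr0 scale1r.
Qed.

Lemma fraction0 k : fraction f (0 : M) k = 0.
Proof. by apply/fraction_eq0; exists 0%N; rewrite scaler0. Qed.

Lemma fractionDl u v k : fraction f u k + fraction f v k = fraction f (u + v) k.
Proof.
rewrite fractionD; apply/fractionE; exists 0%N.
by rewrite !scalerDr -!scalerDr !scalerA -exprD subrr scaler0.
Qed.

Lemma fraction_sum (T : Type) (s : seq T) (P : pred T) (F : T -> M) k :
  \sum_(t <- s | P t) fraction f (F t) k = fraction f (\sum_(t <- s | P t) F t) k.
Proof.
by rewrite (big_morph _ (fun u v => esym (fractionDl u v k)) (fraction0 k)).
Qed.

Lemma fraction_rescale u k n : fraction f u k = fraction f (f ^+ n *: u) (k + n).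
Proof.
by apply/fractionE; exists 0%N; rewrite !scalerA -exprD subrr scaler0.
Qed.

End Fractions.

Section Koszul.
Context (R : comPzRingType) (r : nat) (x : 'I_r -> R).
Implicit Types (J : ideal R) (u v : {set 'I_r} -> R) (S T : {set 'I_r}).

Definition koszul_sign (j : 'I_r) S : R := (-1) ^+ #|[set k in S | (k < j)%N]|.

Definition koszul_diff (k : nat) u S : R :=
  \sum_(j in S) koszul_sign j S * (x j ^+ k * u (S :\ j)).

Definition koszul_rescale (n : nat) u S : R := cech_elt x S ^+ n * u S.

Lemma koszul_diff_sum (I : Type) (s : seq I) (a : I -> R) k
    (u : I -> {set 'I_r} -> R) T :
  koszul_diff k (fun S => \sum_(i <- s) a i * u i S) T =
  \sum_(i <- s) a i * koszul_diff k (u i) T.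
Proof.
rewrite /koszul_diff.
under [RHS]eq_bigr do rewrite mulr_sumr.
rewrite exchange_big; apply: eq_bigr => j _; rewrite !mulr_sumr.
by apply: eq_bigr => i _; ring.
Qed.

Lemma koszul_diff_rescale k n u T :
  koszul_diff (k + n) (koszul_rescale n u) T = koszul_rescale n (koszul_diff k u) T.
Proof.
rewrite /koszul_rescale /koszul_diff mulr_sumr; apply: eq_bigr => j jT.
by rewrite (cech_eltD1 x jT) exprMn exprD; ring.
Qed.

Lemma eq_koszul_diff k u v T :
  (forall j, j \in T -> u (T :\ j) = v (T :\ j)) -> koszul_diff k u T = koszul_diff k v T.
Proof. by move=> uv; apply: eq_bigr => j jT; rewrite uv. Qed.

Lemma card_setD1S (S : {set 'I_r}) (j : 'I_r) : j \in S -> #|S| = #|S :\ j|.+1.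
Proof. by move=> jS; rewrite (cardsD1 j S) jS. Qed.

Lemma koszul_sign_sqr j S : koszul_sign j S * koszul_sign j S = 1.
Proof. by rewrite /koszul_sign -expr2 sqrr_sign. Qed.

Lemma koszul_sign_setU1 (a b : 'I_r) S : a \notin S ->
  koszul_sign b (a |: S) = (-1) ^+ (a < b)%N * koszul_sign b S.
Proof.
move=> aS; rewrite /koszul_sign -exprD; congr (_ ^+ _).
have [ab|ab] := boolP (a < b)%N.
  have -> : [set l in a |: S | (l < b)%N]%SET = a |: [set l in S | (l < b)%N]%SET.
    by apply/setP => l; rewrite !inE; case: eqP => [->|].
  by rewrite cardsU1 inE (negbTE aS).
apply: eq_card => l; rewrite !inE.
by case: eqP => [->|]//=; rewrite (negbTE ab) andbF.
Qed.

Section Representation.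
Context (J : ideal R) (i : nat).

Definition koszul_cocycle (k : nat) u : Prop :=
  forall T, #|T| = i.+1 -> J (koszul_diff k u T).

Definition koszul_frac (k : nat) S (a : R) : localization (quotient_module J) (cech_elt x S) :=
  fraction (cech_elt x S) (quotient_class J a) k.

(** [h] is the class of the Cech cocycle [u_S / x_S^k]. As in
    [H^i = colim_k H^i(x^k; R/J)], [u] is a Koszul cochain for the powers [x^k]. *)
Definition represents (k : nat) u (h : local_cohomology x (quotient_module J) i) : Prop :=
  exists z : submodule_module (cech_cocycles x (quotient_module J) i),
    h = quotient_class (cech_coboundaries x (quotient_module J) i) z /\
    forall S, #|S| = i -> submodule_val z S = koszul_frac k S (u S).

Lemma koszul_fracP k S (a b c : R) :
  a *: koszul_frac k S b + koszul_frac k S c = koszul_frac k S (a * b + c).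
Proof. by rewrite /koszul_frac fractionZ fractionDl -linearP. Qed.

Lemma koszul_frac0 k S : koszul_frac k S 0 = 0.
Proof. by rewrite /koszul_frac raddf0 fraction0. Qed.

Lemma koszul_frac_eq0 k S a :
  koszul_frac k S a = 0 <-> exists n, J (cech_elt x S ^+ n * a).
Proof.
rewrite /koszul_frac fraction_eq0; split=> -[n nE]; exists n.
  by apply/quotient_class_eq0; rewrite -quotient_classZ.
by rewrite quotient_classZ; apply/quotient_class_eq0.
Qed.

Lemma koszul_frac_rescale k S a n :
  koszul_frac k S a = koszul_frac (k + n) S (cech_elt x S ^+ n * a).
Proof. by rewrite /koszul_frac (fraction_rescale _ _ k n) quotient_classZ. Qed.

Lemma koszul_frac_surj (c : cech_module x (quotient_module J)) (k0 : nat) :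
  exists n u, forall S, c S = koszul_frac (k0 + n) S (u S).
Proof.
have /choice[ka kaE] : forall S, exists ka : nat * R, c S = koszul_frac ka.1 S ka.2.
  move=> S; have [u [k ->]] := fraction_surj (c S).
  by have [a ->] := quotient_class_surj u; exists (k, a).
pose n := \max_S (ka S).1.
exists n, (fun S => cech_elt x S ^+ (k0 + n - (ka S).1) * (ka S).2) => S.
rewrite kaE (koszul_frac_rescale _ _ _ (k0 + n - (ka S).1)) subnKC//.
by apply: (leq_trans (leq_bigmax (F := fun S => (ka S).1) S)); exact: leq_addl.
Qed.

Lemma cech_diff_frac (c : cech_module x (quotient_module J)) k u S :
  (forall j, j \in S -> c (S :\ j) = koszul_frac k (S :\ j) (u (S :\ j))) ->
  cech_diff c S = koszul_frac k S (koszul_diff k u S).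
Proof.
move=> cE; rewrite /koszul_frac /koszul_diff raddf_sum -fraction_sum.
apply: eq_bigr => j jS; rewrite cE// (localization_extE (cech_eltD1 x jS)) fractionZ.
congr fraction.
by rewrite (quotient_classZ J (x j ^+ k) (u (S :\ j))) quotient_classZ.
Qed.

Lemma represents_exists k u : koszul_cocycle k u -> exists h, represents k u h.
Proof.
move=> hu; pose u' S := if #|S| == i then u S else 0.
pose c : cech_module x (quotient_module J) := fun S => koszul_frac k S (u' S).
have cz : cech_cocycles x (quotient_module J) i c.
  split=> [S /negbTE Si|]; first by rewrite /c /u' Si koszul_frac0.
  apply: functional_extensionality_dep => T; rewrite (cech_diff_frac (k := k) (u := u'))//.
  rewrite -[RHS]/(0 : localization _ _).
  have [Ti|/negbTE Ti] := eqVneq #|T| i.+1.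
    apply/koszul_frac_eq0; exists 0%N; rewrite mul1r.
    rewrite (@eq_koszul_diff _ _ u) => [|j jT]; first exact: hu.
    by rewrite /u' -eqSS -card_setD1S// Ti eqxx.
  rewrite [koszul_diff _ _ _]big1 ?koszul_frac0// => j jT.
  by rewrite /u' -eqSS -card_setD1S// Ti !mulr0.
exists (quotient_class _ (submodule_of cz)), (submodule_of cz); split=> // S Si.
by rewrite /= /c /u' Si eqxx.
Qed.

Lemma represents_rescale k u h n :
  represents k u h -> represents (k + n) (koszul_rescale n u) h.
Proof.
move=> [z [-> zE]]; exists z; split=> // S Si.
by rewrite zE// (koszul_frac_rescale _ _ _ n).
Qed.

Lemma koszul_cocycle_rescale k u n :
  koszul_cocycle k u -> koszul_cocycle (k + n) (koszul_rescale n u).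
Proof. by move=> hu T Ti; rewrite koszul_diff_rescale; apply: idealMl; exact: hu. Qed.

(** Clearing denominators in [d z = 0] once more turns a representative of [z]
    into a Koszul cocycle modulo [J]; [k0] is a prescribed lower bound for the
    exponent. *)
Lemma represents_surj h (k0 : nat) :
  exists n u, koszul_cocycle (k0 + n) u /\ represents (k0 + n) u h.
Proof.
have [z ->] := quotient_class_surj h.
have [n [u uE]] := koszul_frac_surj (submodule_val z) k0.
have [_ dz0] := submodule_valP z.
have /choice[nT nTE] : forall T, exists l, J (cech_elt x T ^+ l * koszul_diff (k0 + n) u T).
  move=> T; apply/(koszul_frac_eq0 (k0 + n)).
  by rewrite -(cech_diff_frac (c := submodule_val z))// dz0.
pose N := \max_T nT T.
exists (n + N)%N, (koszul_rescale N u); rewrite addnA; split.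
  move=> T _; rewrite koszul_diff_rescale /koszul_rescale.
  have -> : N = (N - nT T + nT T)%N by rewrite subnK// (leq_bigmax (F := nT)).
  by rewrite exprD -mulrA; exact: idealMl.
by apply: represents_rescale; exists z; split=> // S _; exact: uE.
Qed.

Lemma representsP k (a : R) u v h h' :
  represents k u h -> represents k v h' ->
  represents k (fun S => a * u S + v S) (a *: h + h').
Proof.
move=> [z [-> zE]] [z' [-> z'E]]; exists (a *: z + z'); split; first by rewrite linearP.
move=> S Si; rewrite -koszul_fracP -zE// -z'E//.
Qed.

Lemma represents0 k : represents k (fun=> 0) 0.
Proof.
exists 0; split; first by rewrite raddf0.
by move=> S _; rewrite koszul_frac0.
Qed.

Lemma represents_sum (I : Type) (s : seq I) (a : I -> R) k
    (u : I -> {set 'I_r} -> R) (h : I -> local_cohomology x (quotient_module J) i) :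
  (forall i, represents k (u i) (h i)) ->
  represents k (fun S => \sum_(i <- s) a i * u i S) (\sum_(i <- s) a i *: h i).
Proof.
move=> uh; elim: s => [|j s IHs].
  rewrite big_nil; under eq_fun do rewrite big_nil; exact: represents0.
rewrite big_cons; under eq_fun do rewrite big_cons.
exact: representsP.
Qed.

Lemma represents_eq0 k u h : represents k u h ->
  h = 0 <-> exists N v, forall S, #|S| = i ->
    J (cech_elt x S ^+ N * u S - koszul_diff (k + N) v S).
Proof.
move=> [z [-> zE]]; rewrite quotient_class_eq0; split; last first.
  move=> [N [v NvE]]; pose v' S := if #|S|.+1 == i then v S else 0.
  pose c : cech_module x (quotient_module J) := fun S => koszul_frac (k + N) S (v' S).
  exists c; first by move=> S /negbTE Si; rewrite /c /v' Si koszul_frac0.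
  apply: functional_extensionality_dep => S.
  rewrite (cech_diff_frac (k := k + N) (u := v'))//.
  have [Si|Si] := eqVneq #|S| i; last first.
    have [/(_ S Si) -> _] := submodule_valP z.
    rewrite [koszul_diff _ _ _]big1 ?koszul_frac0// => j jS.
    by rewrite /v' -card_setD1S// (negbTE Si) !mulr0.
  rewrite zE// (koszul_frac_rescale _ _ _ N).
  apply/eqP; rewrite -subr_eq0 -[X in X - _]add0r addrC -scaleN1r add0r; apply/eqP.
  rewrite koszul_fracP; apply/koszul_frac_eq0; exists 0%N; rewrite mul1r mulN1r addrC.
  rewrite (@eq_koszul_diff _ _ v) => [|j jS]; first exact: NvE.
  by rewrite /v' -card_setD1S// Si eqxx.
move=> [c _ zc]; have [n [v vE]] := koszul_frac_surj c k.
have /choice[nS nSE] : forall S, exists l, #|S| = i ->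
    J (cech_elt x S ^+ l * (cech_elt x S ^+ n * u S - koszul_diff (k + n) v S)).
  move=> S; have [Si|Si] := eqVneq #|S| i; last by exists 0%N => /eqP; rewrite (negbTE Si).
  suff /koszul_frac_eq0[l lE] :
      koszul_frac (k + n) S (cech_elt x S ^+ n * u S - koszul_diff (k + n) v S) = 0.
    by exists l.
  rewrite addrC -mulN1r -koszul_fracP -koszul_frac_rescale -zE// zc.
  by rewrite -(cech_diff_frac (c := c))// scaleN1r addNr.
pose N := \max_S nS S.
exists (n + N)%N, (koszul_rescale N v) => S Si.
rewrite addnA koszul_diff_rescale /koszul_rescale exprD (mulrC (_ ^+ n)) -mulrA -mulrBr.
have -> : N = (N - nS S + nS S)%N by rewrite subnK// (leq_bigmax (F := nS)).
by rewrite exprD -mulrA; apply: idealMl; exact: nSE.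
Qed.

Lemma represents_inj k u h h' : represents k u h -> represents k u h' -> h = h'.
Proof.
move=> uh uh'; apply/eqP; rewrite -subr_eq0 addrC -scaleN1r; apply/eqP.
apply/(represents_eq0 (representsP (-1) uh' uh)).
exists 0%N, (fun=> 0) => S _; rewrite mulN1r addNr mulr0 sub0r.
by rewrite [koszul_diff _ _ _]big1 ?oppr0; [exact: ideal0|move=> j _; rewrite !mulr0].
Qed.

Lemma represents_mod k u v h : represents k u h ->
  (forall S, #|S| = i -> J (u S - v S)) -> represents k v h.
Proof.
move=> [z [-> zE]] uv; exists z; split=> // S Si; rewrite zE//; congr fraction.
by apply/quotient_classE; exact: uv.
Qed.

(** Contraction with [e_j] is a homotopy between multiplication by [x_j^k] and
    zero on the Koszul complex of [x^k]. *)
Lemma represents_torsion k u h j :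
  koszul_cocycle k u -> represents k u h -> x j ^+ k *: h = 0.
Proof.
move=> hu uh.
have : represents k (fun S => x j ^+ k * u S) (x j ^+ k *: h).
  have := representsP (x j ^+ k) uh (represents0 k); rewrite addr0.
  by under eq_fun do rewrite addr0.
move=> /represents_eq0 ->.
exists 0%N, (fun S => if j \in S then 0 else koszul_sign j S * u (j |: S)) => S Si.
rewrite expr0 mul1r addn0.
have [jS|jS] := boolP (j \in S).
  rewrite /koszul_diff (bigD1 j)//= finset.setD11 finset.setD1K// big1 => [|l /andP[lS lj]].
    have -> : koszul_sign j (S :\ j) = koszul_sign j S.
      by rewrite -{2}(finset.setD1K jS) koszul_sign_setU1 ?finset.setD11// ltnn mul1r.
    rewrite addr0 mulrCA (mulrA (koszul_sign _ _)) koszul_sign_sqr mul1r subrr.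
    exact: ideal0.
  by rewrite in_setD1 eq_sym lj jS !mulr0.
have := hu (j |: S); rewrite cardsU1 jS Si => /(_ erefl).
rewrite /koszul_diff (bigD1 j)/= ?finset.setU11// finset.setU1K// => Jd.
have : J (koszul_sign j S * (koszul_sign j (j |: S) * (x j ^+ k * u S) +
  \sum_(l in j |: S | l != j) koszul_sign l (j |: S) * (x l ^+ k * u ((j |: S) :\ l)))).
  exact: idealMl.
rewrite mulrDr mulrA koszul_sign_setU1// ltnn mul1r koszul_sign_sqr mul1r.
congr (J (_ + _)).
rewrite mulr_sumr -sumrN; apply: eq_big => [l|l /andP[+ lj]].
  by rewrite !inE; case: eqP => [->|]; rewrite ?(negbTE jS)//= andbT.
rewrite in_setU1 (negbTE lj) => lS; rewrite in_setD1 (negbTE jS) andbF.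
have -> : j |: S :\ l = (j |: S) :\ l.
  by apply/setP => h'; rewrite !inE; case: eqP => // ->; rewrite eq_sym (negbTE lj).
suff -> : koszul_sign l (j |: S) = - (koszul_sign j S * koszul_sign j (S :\ l) * koszul_sign l S).
  have := koszul_sign_sqr j S; move: (koszul_sign j S) => e ee.
  transitivity (- (e * e) * (koszul_sign j (S :\ l) * koszul_sign l S * x l ^+ k * u ((j |: S) :\ l))).
    by ring.
  by rewrite ee; ring.
have -> : koszul_sign j S = (-1) ^+ (l < j)%N * koszul_sign j (S :\ l).
  by rewrite -{1}(finset.setD1K lS) koszul_sign_setU1 ?finset.setD11.
rewrite koszul_sign_setU1// -[in RHS](mulrA _ (koszul_sign j _) (koszul_sign j _)) koszul_sign_sqr mulr1 -mulNr.
congr (_ * _); case: (ltngtP j l) => [||/val_inj jl]; rewrite ?expr1 ?expr0 ?opprK//.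
by rewrite jl eqxx in lj.
Qed.

End Representation.

Lemma represents_map (I J : ideal R) (JI : J `<=` I) i k u
    (h : local_cohomology x (quotient_module J) i) : represents k u h ->
  represents k u (local_cohomology_map x (quotient_proj JI) i h).
Proof.
move=> [z [-> zE]]; rewrite local_cohomology_mapE; eexists; split; first reflexivity.
move=> S Si /=; rewrite /cech_map zE// localization_mapE; congr fraction.
exact: quotient_projE.
Qed.

End Koszul.

(** * The Frobenius on local cohomology *)

Section FrobeniusPower.
Context (R : comNzRingType) (p : nat) (hp : p \in [pchar R]) (e : nat).

(** The proof that [p] is the characteristic is a phantom argument, from which
    the ring morphism structure is inferred. *)
Definition frobenius_power of p \in [pchar R] := fun a : R => a ^+ (p ^ e).

Let hpe : [pchar R].-nat (p ^ e)%N.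
Proof. by rewrite pnatX pnatE ?hp//; exact: pcharf_prime hp. Qed.

Lemma frobenius_power_is_zmod_morphism : zmod_morphism (frobenius_power hp).
Proof.
move=> a b; rewrite /frobenius_power exprDn_pchar//; congr (_ + _).
have := exprDn_pchar b (- b) hpe; rewrite subrr expr0n expn_eq0.
have /prime_gt0 := pcharf_prime hp; case: p => //= p' _ /esym/eqP.
by rewrite addr_eq0 => /eqP ->; rewrite opprK.
Qed.

Lemma frobenius_power_is_monoid_morphism : monoid_morphism (frobenius_power hp).
Proof. by split=> [|a b]; rewrite /frobenius_power ?expr1n// exprMn. Qed.

HB.instance Definition _ := GRing.isZmodMorphism.Build R R (frobenius_power hp)
  frobenius_power_is_zmod_morphism.
HB.instance Definition _ := GRing.isMonoidMorphism.Build R R (frobenius_power hp)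
  frobenius_power_is_monoid_morphism.

End FrobeniusPower.

Section FrobeniusKoszul.
Context (R : comPzRingType) (r : nat) (x : 'I_r -> R).
Context (phi : {rmorphism R -> R}) (q : nat) (q_gt0 : (0 < q)%N).
Hypothesis phiE : forall a, phi a = a ^+ q.
Implicit Types (I J L : ideal R) (u v : {set 'I_r} -> R) (S T : {set 'I_r}).

Lemma koszul_diff_phi k u T :
  koszul_diff x (k * q) (phi \o u) T = phi (koszul_diff x k u T).
Proof.
rewrite /koszul_diff rmorph_sum; apply: eq_bigr => j jT.
by rewrite !rmorphM/= /koszul_sign rmorph_sign rmorphXn/= [in RHS]phiE -exprM mulnC.
Qed.

Lemma koszul_rescale_phi n u :
  koszul_rescale x (n * q) (phi \o u) = phi \o koszul_rescale x n u.
Proof.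
apply: funext => S; rewrite /koszul_rescale/= rmorphM rmorphXn/=.
by rewrite [in RHS]phiE -exprM mulnC.
Qed.

Lemma koszul_cocycle_phi J i k u : koszul_cocycle x J i k u ->
  koszul_cocycle x (ideal_map phi J) i (k * q) (phi \o u).
Proof. by move=> hu T Ti; rewrite koszul_diff_phi; apply: ideal_map_mem; exact: hu. Qed.

Lemma represents_phi0 J i k u
    (h : local_cohomology x (quotient_module (ideal_map phi J)) i) :
  represents k u (0 : local_cohomology x (quotient_module J) i) ->
  represents (k * q) (phi \o u) h -> h = 0.
Proof.
move=> u0 uh; have [N [v NvE]] := (represents_eq0 u0).1 erefl.
apply/(represents_eq0 uh); exists (N * q)%N, (phi \o v) => S Si.
rewrite -mulnDl koszul_diff_phi.
have -> : cech_elt x S ^+ (N * q) * (phi \o u) S = phi (cech_elt x S ^+ N * u S).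
  by rewrite rmorphM [in RHS]phiE exprM.
by rewrite -rmorphB; apply: ideal_map_mem; exact: NvE.
Qed.

(** The map [u_S / x_S^k |-> phi (u_S) / x_S^(k q)] is well defined on classes. *)
Lemma represents_phi_inj J i k u k' u' (h : local_cohomology x (quotient_module J) i)
    (H H' : local_cohomology x (quotient_module (ideal_map phi J)) i) :
  represents k u h -> represents k' u' h ->
  represents (k * q) (phi \o u) H -> represents (k' * q) (phi \o u') H' -> H = H'.
Proof.
move=> uh u'h uH u'H'.
have ukh := represents_rescale k' uh; rewrite addnC in ukh.
have ukH := represents_rescale (k' * q) uH; rewrite addnC in ukH.
have d0 := representsP (-1) (represents_rescale k u'h) ukh; rewrite scaleN1r addNr in d0.
have dH := representsP (-1) (represents_rescale (k * q) u'H') ukH.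
have dE : (fun S => -1 * koszul_rescale x (k * q) (phi \o u') S +
    koszul_rescale x (k' * q) (phi \o u) S) =
    phi \o (fun S => -1 * koszul_rescale x k u' S + koszul_rescale x k' u S).
  by rewrite !koszul_rescale_phi; apply: funext => S /=; rewrite !mulN1r rmorphD rmorphN.
rewrite dE -mulnDl in dH.
have /eqP := represents_phi0 d0 dH.
by rewrite scaleN1r addrC subr_eq0 => /eqP.
Qed.

Definition koszul_mx k S T : R :=
  \sum_(j in T | T :\ j == S) koszul_sign R j T * x j ^+ k.

Lemma koszul_diffE k u T : koszul_diff x k u T = \sum_S u S * koszul_mx k S T.
Proof.
rewrite /koszul_mx; under eq_bigr do rewrite mulr_sumr.
rewrite (exchange_big_dep (mem T))//=; last by move=> S j _ /andP[].
apply: eq_bigr => j jT; rewrite (big_pred1 (T :\ j)) => [|S]; first by ring.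
by rewrite jT eq_sym.
Qed.

Lemma koszul_mx_phi k S T : koszul_mx (k * q) S T = phi (koszul_mx k S T).
Proof.
rewrite /koszul_mx rmorph_sum; apply: eq_bigr => j jT.
by rewrite rmorphM/= /koszul_sign rmorph_sign rmorphXn/= [in RHS]phiE -exprM mulnC.
Qed.

Hypothesis hN : noetherian R.
Hypothesis flat : forall n (a : 'cV[R]_n), syzygy_flat phi a.

(** By flatness [H^i(R/phi(J))] is the base change of [H^i(R/J)] along [phi],
    hence generated by the image of [H^i(R/J)]: a cocycle modulo [phi(J)] solves
    a linear system with coefficients in the image of [phi]. *)
Lemma represents_phi_generate J i
    (h : local_cohomology x (quotient_module (ideal_map phi J)) i) :
  exists k l (C : 'I_l -> {set 'I_r} -> R) (s : 'I_l -> R),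
    (forall t, koszul_cocycle x J i k (C t)) /\
    represents (k * q) (fun S => \sum_t s t * phi (C t S)) h.
Proof.
have [k [u [hu uh]]] := represents_surj h 0; rewrite add0n in hu uh.
pose A S T := if #|T| == i.+1 then koszul_mx k S T else 0.
have kq : (k + (k * q - k) = k * q)%N.
  by rewrite subnKC// leq_pmulr.
have [T|l [C [s [CA uE]]]] := flat_linear_system hN flat (J := J) (A := A)
    (b := koszul_rescale x (k * q - k) u).
  rewrite /A; case: eqP => [Ti|_]; last first.
    by rewrite big1 => [|S _]; [exact: ideal0|rewrite rmorph0 mulr0].
  under eq_bigr do rewrite -koszul_mx_phi.
  have := koszul_cocycle_rescale (k * q - k) hu; rewrite kq => huq.
  by rewrite -koszul_diffE; exact: huq.
exists k, l, C, s; split.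
  move=> t T Ti; rewrite koszul_diffE; have := CA t T.
  by rewrite /A Ti eqxx.
have := represents_rescale (k * q - k) uh; rewrite kq; congr represents.
by apply: funext => S; exact: uE.
Qed.

(** Flatness again: only the ideal generated by the image of the annihilator of
    a class annihilates the image of that class. *)
Lemma represents_phi_annihilator J i k u (h : local_cohomology x (quotient_module J) i)
    (H : local_cohomology x (quotient_module (ideal_map phi J)) i) a :
  represents k u h -> represents (k * q) (phi \o u) H -> a *: H = 0 ->
  ideal_map phi (annihilator h) a.
Proof.
move=> uh uH aH.
have auH := representsP a uH (represents0 x (ideal_map phi J) i (k * q)).
rewrite addr0 in auH.
have [N [v NvE]] := (represents_eq0 auH).1 aH.
pose N' := (N * q - N)%N.
have NN' : (N + N' = N * q)%N by rewrite subnKC// leq_pmulr.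
pose v' := koszul_rescale x N' v.
pose A (X : option {set 'I_r}) S := if #|S| == i then
  (if X is Some S' then koszul_mx (k + N) S' S else cech_elt x S ^+ N * u S) else 0.
pose b (X : option {set 'I_r}) := if X is Some S' then - v' S' else a.
have big_option (F : option {set 'I_r} -> R) :
    \sum_X F X = F None + \sum_S F (Some S).
  rewrite (bigD1 None)//=; congr (_ + _).
  rewrite (reindex_omap Some id)/= => [|[]//].
  by apply: eq_bigl => S; rewrite eqxx.
have [S|l [C [s [CA bE]]]] := flat_linear_system hN flat (J := J) (A := A) (b := b).
  rewrite /A; case: eqP => [Si|_]; last first.
    by rewrite big1 => [|X _]; [exact: ideal0|rewrite rmorph0 mulr0].
  rewrite big_option/=; under eq_bigr do rewrite -koszul_mx_phi mulNr.
  rewrite sumrN -koszul_diffE mulnDl -NN' addnA koszul_diff_rescale.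
  rewrite rmorphM [phi (_ ^+ N)]phiE -exprM -NN' exprD /koszul_rescale.
  have := NvE S Si; rewrite addr0 => /(idealMl (cech_elt x S ^+ N')).
  by congr (ideal_map _ _ _); rewrite /=; ring.
rewrite -[a]/(b None) bE; apply: ideal_sum => t _; apply: idealMl.
apply: ideal_map_mem; rewrite /= /annihilator_set/=.
have cuh := representsP (C t None) uh (represents0 x J i k).
rewrite addr0 in cuh.
apply/(represents_eq0 cuh); exists N, (fun S' => - C t (Some S')) => S Si.
have := CA t S; rewrite big_option /A Si eqxx koszul_diffE.
congr (J _); rewrite addr0 mulrCA; congr (_ + _).
by rewrite -sumrN; apply: eq_bigr => S' _; rewrite mulNr opprK.
Qed.

(** A surjection [H^i(R/J) -> H^i(R/I)] is preserved by base change along [phi],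
    and the base change factors through [H^i(R/L)]. *)
Lemma local_cohomology_phi_surj J I L i (JI : J `<=` I)
    (LI : L `<=` ideal_map phi I) : ideal_map phi J `<=` L ->
  (forall h, exists h', local_cohomology_map x (quotient_proj JI) i h' = h) ->
  forall h, exists h', local_cohomology_map x (quotient_proj LI) i h' = h.
Proof.
move=> JL surj h.
have [k [l [C [s [hC Ch]]]]] := represents_phi_generate h.
have /choice[h' h'E] : forall t, exists h', represents (k * q) (phi \o C t)
    (local_cohomology_map x (quotient_proj LI) i h').
  move=> t; have [ht Ct] := represents_exists (hC t).
  have [h1 h1E] := surj ht.
  have [n [u [hu uh1]]] := represents_surj h1 0; rewrite add0n in hu uh1.
  have huL : koszul_cocycle x L i (n * q) (phi \o u).
    by move=> T Ti; apply: JL; exact: koszul_cocycle_phi hu T Ti.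
  have [h2 uh2] := represents_exists huL; exists h2.
  have [G CG] := represents_exists (koszul_cocycle_phi (hC t)).
  have uht := represents_map JI uh1; rewrite h1E in uht.
  by rewrite -(represents_phi_inj Ct uht CG (represents_map LI uh2)).
exists (\sum_t s t *: h' t); rewrite linear_sum.
under eq_bigr do rewrite linearZ.
exact: represents_inj (represents_sum _ s h'E) Ch.
Qed.

End FrobeniusKoszul.

Section Length.
Context (K : realType) (R : comPzRingType) (V : lmodType R).

Section MultipleSubmodule.
Context (L : ideal R) (v : V).

Definition multiple_set : set V := [set w | exists2 a, L a & w = a *: v].

Lemma multiple_set0 : multiple_set 0.
Proof. by exists 0; [exact: ideal0|rewrite scale0r]. Qed.

Lemma multiple_setP a u w : multiple_set u -> multiple_set w -> multiple_set (a *: u + w).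
Proof.
move=> [b Lb ->] [c Lc ->]; exists (a * b + c); last by rewrite scalerDl scalerA.
by apply: idealD => //; exact: idealMl.
Qed.

Definition multiple_submodule : submodule V := Submodule multiple_set0 multiple_setP.

End MultipleSubmodule.

Lemma module_length_ge (v : V) (J : ideal R) n :
  annihilator v `<=` J -> ideal_chain J n -> ((n%:R)%:E <= module_length K V)%E.
Proof.
move=> annJ [L [JL chL]]; apply: ereal_sup_ubound; exists n => //.
exists (fun j => multiple_submodule (L j) v) => j jn; have [sub nsub] := chL j jn.
split=> [_ [a La ->]|sub']; first by exists a => //; exact: sub.
apply: nsub => a La.
have [|b Lb abE] := sub' (a *: v); first by exists a.
rewrite -[a](subrK b); apply: idealD => //; apply: JL; apply: annJ.
by rewrite /= /annihilator_set/= scalerBl abE subrr.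
Qed.

End Length.

(** * Lengths of local cohomology of powers *)

Section RegularFrobenius.
Context (R : comNzRingType) (m : ideal R) (p d : nat).
Hypotheses (hR : regular_local_ring m d) (hp : p \in [pchar R]).

Lemma generates_exists n (a : 'cV[R]_n) : exists I, generates a I.
Proof.
pose S0 : set R := [set u | exists b : 'rV_n, u = (b *m a) 0 0].
have S00 : S0 0 by exists 0; rewrite mul0mx mxE.
have S0P (c : R) (v w : R^o) : S0 v -> S0 w -> S0 (c *: v + w).
  by move=> [b ->] [b' ->]; exists (c *: b + b'); rewrite mulmxDl -scalemxAl !mxE.
by exists (Submodule (M := R^o) S00 S0P).
Qed.

(** Kunz: the Frobenius of a regular local ring is flat. Since the powers of a
    regular system of parameters form a regular sequence, the length of
    [R/m^[q]] is at least [q^d]. *)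
Lemma regular_frobenius e :
  (forall n (a : 'cV[R]_n), syzygy_flat (frobenius_power e hp) a) /\
  ideal_chain (ideal_map (frobenius_power e hp) m) ((p ^ e) ^ d).
Proof.
have p_gt0 : (0 < p ^ e)%N by rewrite expn_gt0 (prime_gt0 (pcharf_prime hp)).
have [hN hm _ _] := hR.
have [s [sd sm reg]] := regular_local_seq hR.
have regX := regular_seqX (p ^ e)%N reg.
have [n [a [am aphim flat]]] := syzygy_flat_regular_seq (phi := frobenius_power e hp) regX.
rewrite sm in am; split=> [k b|].
  have [I bI] := generates_exists b.
  apply: (syzygy_flat_ideal hN hm _ am flat bI) => c mc.
  exact: idealX.
have nm1 : ~ adjoins (zero_ideal R) s 1 by rewrite sm; case: hm => -[].
have := regular_seq_chain (p ^ e)%N reg nm1; rewrite sd.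
apply: ideal_chain_sub => c /(generates_map (frobenius_power e hp) am) [b ->].
exact: generates_mul aphim.
Qed.

End RegularFrobenius.

Section IdealPowers.
Context (R : comPzRingType).
Implicit Types I J : ideal R.

Lemma ideal_powM I k l a b :
  ideal_pow I k a -> ideal_pow I l b -> ideal_pow I (k + l) (a * b).
Proof.
move=> + Ib; elim: k a => [|k IHk] a; first by move=> _; exact: idealMl.
apply: (generated_min (N := colon (ideal_pow I (k.+1 + l)) b)) => _ [c [e [Ic Ie ->]]].
change (ideal_pow I (k + l).+1 (c * e * b)); rewrite -mulrA.
by apply: generated_sub; exists c, (e * b); split=> //; exact: IHk.
Qed.

Lemma ideal_pow1 I a : I a -> ideal_pow I 1 a.
Proof.
move=> Ia; apply: generated_sub; exists a, 1; split=> //; last by rewrite mulr1.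
exact: generated_sub.
Qed.

Lemma ideal_powX I k a n : ideal_pow I k a -> ideal_pow I (k * n) (a ^+ n).
Proof.
move=> Ia; elim: n => [|n IHn]; first by rewrite muln0; exact: generated_sub.
by rewrite mulnS exprS; exact: ideal_powM.
Qed.

Lemma ideal_pow_le I k l : (k <= l)%N -> ideal_pow I l `<=` ideal_pow I k.
Proof.
move=> /subnK <-; elim: (l - k)%N => // n IHn a Ia; apply: IHn.
apply: (generated_min (N := ideal_pow I (n + k))) Ia => _ [c [e [_ Ie ->]]].
exact: idealMl.
Qed.

Lemma ideal_pow_sub I n : (0 < n)%N -> ideal_pow I n `<=` I.
Proof.
case: n => // n _; apply: generated_min => _ [c [e [Ic _ ->]]]; exact: idealMr.
Qed.

(** A product of [n] elements of [J + (g)] with [a + b <= n + 1] has [a] factors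
    in [J] or [b] factors [g]. *)
Lemma ideal_pow_adjoin J g n a b : (a + b <= n.+1)%N ->
  ideal_pow (adjoin J g) n `<=` adjoin (ideal_pow J a) (g ^+ b).
Proof.
elim: n a b => [|n IHn] a b abn.
  case: a abn => [|a] abn u _; first by apply: adjoin_sub; exact: generated_sub.
  have -> : b = 0%N by lia.
  by apply: (ideal_eq1 (I := adjoin _ _)); exact: adjoin_mem.
case: a abn => [|a] abn; first by move=> u _; apply: adjoin_sub; exact: generated_sub.
case: b abn => [|b] abn; first move=> u _.
  by apply: (ideal_eq1 (I := adjoin _ _)); exact: adjoin_mem.
apply: (generated_min (N := adjoin (ideal_pow J a.+1) (g ^+ b.+1))) => _ [_ [w [[j Jj [r ->]] Iw ->]]].
rewrite mulrDl; apply: (idealD (I := adjoin (ideal_pow J a.+1) (g ^+ b.+1))).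
  have [|v Jv [c ->]] := IHn a b.+1 _ w Iw; first by lia.
  exists (j * v); first by apply: generated_sub; exists j, v.
  by exists (j * c); rewrite mulrDr mulrA.
have [|v Jv [c ->]] := IHn a.+1 b _ w Iw; first by lia.
exists (r * g * v); first exact: idealMl.
by exists (r * c); rewrite exprS; ring.
Qed.

Lemma ideal_pow_zero n : (0 < n)%N -> ideal_pow (zero_ideal R) n `<=` zero_ideal R.
Proof. exact: ideal_pow_sub. Qed.

Section Power.
Context (phi : {rmorphism R -> R}) (q : nat).
Hypothesis phiE : forall a, phi a = a ^+ q.

Lemma ideal_map_sub I J : I `<=` J -> ideal_map phi I `<=` ideal_map phi J.
Proof.
move=> IJ; apply: (generated_min (N := ideal_map phi J)) => _ [a Ia <-]; apply: ideal_map_mem; exact: IJ.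
Qed.

Lemma ideal_map_pow I k n : (n <= k * q)%N -> ideal_map phi (ideal_pow I k) `<=` ideal_pow I n.
Proof.
move=> nkq; apply: (generated_min (N := ideal_pow I n)) => _ [a Ia <-]; rewrite phiE.
by apply: (ideal_pow_le nkq); exact: ideal_powX.
Qed.

Lemma ideal_pow_map s n : (size s * q < n)%N ->
  ideal_pow (adjoins (zero_ideal R) s) n `<=` ideal_map phi (adjoins (zero_ideal R) s).
Proof.
elim: s n => [|y s IHs] n sn.
  apply: (subset_trans (ideal_pow_zero _)); first by lia.
  by move=> _ ->; exact: (ideal0 (ideal_map phi (zero_ideal R))).
have -> : adjoins (zero_ideal R) (y :: s) = adjoin (adjoins (zero_ideal R) s) y.
  exact: adjoins_adjoin.
rewrite /= mulSn in sn.
apply: (subset_trans (ideal_pow_adjoin (a := (n - q)%N) (b := q) _)); first by lia.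
apply: adjoin_min; last by rewrite -phiE; apply: ideal_map_mem; exact: adjoin_mem.
apply: (subset_trans (IHs _ _)); first by lia.
by apply: ideal_map_sub; exact: adjoin_sub.
Qed.

End Power.

Lemma finitely_generated_adjoins I : finitely_generated I ->
  exists s, I = adjoins (zero_ideal R) s.
Proof.
move=> [s sE]; exists s; apply: ideal_ext.
  by rewrite sE; apply: generated_min => a; exact: adjoins_mem.
apply: adjoins_min => [_ ->|y ys]; first exact: ideal0.
rewrite -[I y]/((I : set R) y) sE; exact: generated_sub.
Qed.

End IdealPowers.

Lemma limn_einf_ge (K : realType) (u : nat -> \bar K) (c : \bar K) (n0 : nat) :
  (forall n, (n0 <= n)%N -> (c <= u n)%E) -> (c <= limn_einf u)%E.
Proof.
move=> cu; rewrite limn_einf_lim; apply: lime_ge; first exact: is_cvg_einfs.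
exists n0 => // n /= n0n; apply: le_ereal_inf_tmp => _ [k /= nk <-].
by apply: cu; exact: leq_trans nk.
Qed.

Section LengthOfPowers.
Context (K : realType) (R : comNzRingType) (m : ideal R) (p d : nat).
Hypotheses (hR : regular_local_ring m d) (hp : p \in [pchar R]).
Context (r : nat) (x : 'I_r -> R) (I : ideal R) (s : seq R).
Hypotheses (IE : I = adjoins (zero_ideal R) s) (full : F_full x I).
Context (i : nat) (h : local_cohomology x (quotient_module I) i) (h0 : h <> 0).

Let p_gt1 : (1 < p)%N. Proof. by apply: prime_gt1; exact: pcharf_prime hp. Qed.

(** With [mu] exceeding the number of generators of [I], one has
    [(I^(mu p))^[q] <= I^n <= I^[q]] whenever [mu q <= n <= mu p q]. The map
    [H^i(R/I^(mu p)) -> H^i(R/I)] is onto because [R/I] is F-full, so its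
    Frobenius twist is onto and factors through [H^i(R/I^n)]; hence a class with
    annihilator in [m^[q]] lifts to [H^i(R/I^n)]. *)
Lemma module_length_power_ge n e : let mu := (size s).+1 in
  (mu * p ^ e <= n)%N -> (n <= mu * p * p ^ e)%N ->
  (((p ^ e) ^ d)%:R%:E <=
   module_length K (local_cohomology x (quotient_module (ideal_pow I n)) i))%E.
Proof.
move=> mu mun nmu; have [hN hm _ _] := hR.
have q_gt0 : (0 < p ^ e)%N by rewrite expn_gt0 (ltnW p_gt1).
have [flat chain] := regular_frobenius hR hp e.
pose phi : {rmorphism R -> R} := frobenius_power e hp.
have phiE a : phi a = a ^+ (p ^ e) by [].
have [k [u [hu uh]]] := represents_surj h 0; rewrite add0n in hu uh.
have [H uH] := represents_exists (koszul_cocycle_phi phiE hu).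
have mup : (0 < mu * p)%N by rewrite muln_gt0/= ltnW.
have JI : ideal_pow I (mu * p) `<=` I := ideal_pow_sub mup.
have LI : ideal_pow I n `<=` ideal_map phi I.
  rewrite IE; apply: (ideal_pow_map phiE).
  by apply: leq_trans mun; rewrite ltn_mul2r q_gt0 /=.
have JL : ideal_map phi (ideal_pow I (mu * p)) `<=` ideal_pow I n.
  exact: ideal_map_pow.
have rad : I `<=` radical (ideal_pow I (mu * p)).
  move=> a Ia; exists (mu * p)%N.
  by have := ideal_powX (mu * p) (ideal_pow1 Ia); rewrite mul1n.
have [h' h'E] := local_cohomology_phi_surj q_gt0 phiE hN flat LI JL
  (@full i _ JI rad) H.
apply: (@module_length_ge K R _ h' _ _ _ chain) => a ah'.
apply: (ideal_map_sub (I := annihilator h)).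
  by apply: local_proper => //; rewrite /= /annihilator_set/= scale1r.
apply: (represents_phi_annihilator q_gt0 phiE hN flat uh uH).
by rewrite -h'E -linearZ/= [a *: h']ah' raddf0.
Qed.

Lemma liminf_length_gt0 :
  (0 < limn_einf (fun n : nat =>
     module_length K (local_cohomology x (quotient_module (ideal_pow I n)) i)
     * ((n%:R ^+ d)^-1)%:E))%E.
Proof.
pose mu := (size s).+1; pose c : K := (((mu * p)%:R) ^+ d)^-1.
have mup : (0 < (mu * p)%:R :> K) by rewrite ltr0n muln_gt0/= ltnW.
apply: (@lt_le_trans _ _ c%:E); first by rewrite lte_fin invr_gt0 exprn_gt0.
apply: (limn_einf_ge (n0 := mu)) => n mun.
have n_gt0 : (0 < n)%N by apply: leq_trans mun.
have nmu_gt0 : (0 < n %/ mu)%N by rewrite divn_gt0.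
have /andP[] := trunc_log_bounds p_gt1 nmu_gt0; set e := trunc_log _ _ => le_e lt_e.
have mule : (mu * p ^ e <= n)%N by rewrite mulnC -leq_divRL.
have nle : (n <= mu * p * p ^ e)%N.
  by rewrite -mulnA -expnS mulnC ltnW// -ltn_divLR.
apply: (@le_trans _ _ (((p ^ e) ^ d)%:R%:E * ((n%:R ^+ d)^-1)%:E)%E); last first.
  apply: lee_wpmul2r; last exact: module_length_power_ge.
  by rewrite lee_fin invr_ge0 exprn_ge0.
rewrite -EFinM lee_fin /c natrX -!exprVn -exprMn lerXn2r// ?nnegrE ?invr_ge0//.
by rewrite ler_pdivlMr ?ltr0n// mulrC ler_pdivrMr// -natrM ler_nat mulnC.
Qed.

End LengthOfPowers.

(** * F-purity as solvability of linear systems *)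

Section TensorZero.
Context (S : comPzRingType) (f : S -> S) (f0 : f 0 = 0) (M : lmodType S).
Implicit Types (s a : S) (u : M).

Lemma tensor_eq_0r s : tensor_eq f [:: (s, 0 : M)] [::].
Proof.
rewrite -(scaler0 M (0 : S)); apply: tensor_trans (tensor_0l f 0).
by apply: tensor_trans (tensor_sym (tensor_balanced _ _ _ _)) _; rewrite f0 mulr0; exact: tensor_refl.
Qed.

Lemma tensor_eq_sumr (T : Type) (r : seq T) s (u : T -> M) :
  tensor_eq f [:: (s, \sum_(t <- r) u t)] [seq (s, u t) | t <- r].
Proof.
elim: r => [|t r IHr] /=; first by rewrite big_nil; exact: tensor_eq_0r.
rewrite big_cons; apply: tensor_trans (tensor_Dr _ _ _ _) _.
by apply: (tensor_cat (v := [:: _]) (v' := [:: _])) => //; exact: tensor_refl.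
Qed.

Lemma tensor_eq_map (T : Type) (r : seq T) (u v : T -> S * M) :
  (forall t, tensor_eq f [:: u t] [:: v t]) ->
  tensor_eq f [seq u t | t <- r] [seq v t | t <- r].
Proof.
move=> uv; elim: r => [|t r IHr] /=; first exact: tensor_refl.
exact: (tensor_cat (v := [:: _]) (v' := [:: _])).
Qed.

Lemma tensor_eq_map_cat (T : Type) (r : seq T) (u v w : T -> S * M) :
  (forall t, tensor_eq f [:: u t] [:: v t; w t]) ->
  tensor_eq f [seq u t | t <- r] ([seq v t | t <- r] ++ [seq w t | t <- r]).
Proof.
move=> uvw; elim: r => [|t r IHr] /=; first exact: tensor_refl.
apply: (tensor_trans (tensor_cat (v := [:: _]) (uvw t) IHr)) => /=.
apply: (tensor_cat (v := [:: _]) (v' := [:: _])); first exact: tensor_refl.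
rewrite -cat1s -[w t :: map w r]cat1s !catA.
by apply: tensor_cat; [exact: tensor_comm|exact: tensor_refl].
Qed.

Lemma tensor_eq_map0 (T : Type) (r : seq T) (u : T -> S * M) :
  (forall t, tensor_eq f [:: u t] [::]) -> tensor_eq f [seq u t | t <- r] [::].
Proof.
move=> u0; elim: r => [|t r IHr] /=; first exact: tensor_refl.
exact: (tensor_cat (v := [:: _]) (v' := [::])).
Qed.

Lemma tensor_eq_eval v w : tensor_eq (M := M) idfun v w ->
  \sum_(z <- v) z.1 *: z.2 = \sum_(z <- w) z.1 *: z.2.
Proof.
elim=> {v w}.
- by [].
- by move=> v w _ ->.
- by move=> v w y _ -> _ ->.
- by move=> v v' w w' _ vE _ wE; rewrite !big_cat/= vE wE.
- by move=> v w; rewrite !big_cat/= addrC.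
- by move=> u; rewrite big_seq1 big_nil scale0r.
- by move=> s t u; rewrite !big_cons big_nil /= scalerDl !addr0.
- by move=> s u v; rewrite !big_cons big_nil /= scalerDr !addr0.
- by move=> s a u; rewrite !big_seq1 /= scalerA.
Qed.

End TensorZero.

Section Purity.
Context (S : comPzRingType) (p : nat) (p_gt0 : (0 < p)%N) (pure : F_pure S p).
Context (X Y : finType) (A : X -> Y -> S).

Let cols : set {ffun Y -> S^o} := [set g | exists u : X -> S,
  g = [ffun y => \sum_x u x * A x y]].

Let cols0 : cols 0.
Proof.
by exists (fun=> 0); apply/ffunP => y; rewrite !ffunE big1// => x _; rewrite mul0r.
Qed.

Let colsP a g h : cols g -> cols h -> cols (a *: g + h).
Proof.
move=> [u ->] [v ->]; exists (fun x => a * u x + v x); apply/ffunP => y.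
rewrite !ffunE /GRing.scale/= mulr_sumr -big_split/=; apply: eq_bigr => x _.
by rewrite mulrDl mulrA.
Qed.

(** Purity of the Frobenius applied to the cokernel [M] of [A]: a solution of
    the system with coefficients raised to the power [p] says that the class of
    [b] in [M] is killed by the Frobenius tensored with [M]. *)
Lemma F_pure_linear_system (b : Y -> S) (v : X -> S) :
  (forall y, b y ^+ p = \sum_x v x * A x y ^+ p) ->
  exists u : X -> S, forall y, b y = \sum_x u x * A x y.
Proof.
move=> bv; pose f (a : S) := a ^+ p.
have f0 : f 0 = 0 by rewrite /f expr0n; case: p p_gt0.
pose N : submodule {ffun Y -> S^o} := Submodule cols0 colsP.
pose cls g : quotient_module N := quotient_class N g.
pose e y : {ffun Y -> S^o} := [ffun y' => (y' == y)%:R].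
have eE (c : Y -> S) : [ffun y => c y] = \sum_y c y *: e y :> {ffun Y -> S^o}.
  apply/ffunP => y; rewrite !ffunE sum_ffunE (bigD1 y)//= big1 => [|y' y'y].
    by rewrite !ffunE eqxx addr0 /GRing.scale/= mulr1.
  by rewrite !ffunE eq_sym (negbTE y'y) /GRing.scale/= mulr0.
have clsE (c : Y -> S) : cls [ffun y => c y] = \sum_y c y *: cls (e y).
  by rewrite eE /cls raddf_sum; apply: eq_bigr => y _; rewrite /= linearZ.
have tens0 (xs : seq X) :
    tensor_eq f [seq (\sum_(x <- xs) v x * f (A x y), cls (e y)) | y <- enum Y] [::].
  elim: xs => [|x xs IHxs].
    by apply: tensor_eq_map0 => y; rewrite big_nil; exact: tensor_0l.
  apply: (tensor_trans (w := [seq (v x * f (A x y), cls (e y)) | y <- enum Y] ++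
      [seq (\sum_(x <- xs) v x * f (A x y), cls (e y)) | y <- enum Y])).
    by apply: tensor_eq_map_cat => y; rewrite big_cons; exact: tensor_Dl.
  apply: (tensor_cat (v' := [::]) (w' := [::])) => //.
  apply: (tensor_trans (w := [seq (v x, A x y *: cls (e y)) | y <- enum Y])).
    by apply: tensor_eq_map => y; exact: tensor_balanced.
  apply: (tensor_trans (tensor_sym (tensor_eq_sumr f0 _ _ _))).
  rewrite big_enum -clsE /cls.
  have -> : quotient_class N [ffun y => A x y] = 0.
    apply/quotient_class_eq0; exists (fun x' => (x' == x)%:R); apply/ffunP => y.
    rewrite !ffunE (bigD1 x)//= eqxx mul1r big1 ?addr0// => x' /negbTE ->.
    by rewrite mul0r.
  exact: tensor_eq_0r.
have bten : tensor_eq f (frobenius_tensor p [:: (1, cls [ffun y => b y])])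
    (frobenius_tensor p [::]).
  rewrite /= expr1n; apply: tensor_trans (tens0 (enum X)).
  rewrite clsE -big_enum; apply: (tensor_trans (tensor_eq_sumr f0 _ _ _)).
  apply: tensor_eq_map => y; rewrite big_enum -bv.
  apply: (tensor_trans (tensor_sym (tensor_balanced _ _ _ _))).
  by rewrite mul1r; exact: tensor_refl.
have := tensor_eq_eval (pure bten); rewrite big_seq1 big_nil scale1r.
move=> /quotient_class_eq0[u /ffunP uE]; exists u => y.
by have := uE y; rewrite !ffunE.
Qed.

End Purity.

Section PurityModulo.
Context (R : comPzRingType) (I : ideal R) (p : nat) (p_gt0 : (0 < p)%N).
Hypothesis pure : F_pure (quotient_ring I) p.

Let cls (a : R) : quotient_ring I := quotient_class I a.

Lemma quotient_ringM a b : cls a * cls b = cls (a * b).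
Proof.
apply/quotient_classE.
set a' : R := repr _; set b' : R := repr _.
have -> : a' * b' - a * b = b' * (a' - a) + a * (b' - b) by ring.
by apply: idealD; apply: idealMl; exact: quotient_repr.
Qed.

Lemma quotient_ringX a n : cls a ^+ n = cls (a ^+ n).
Proof. by elim: n => // n IHn; rewrite !exprS IHn quotient_ringM. Qed.

Lemma quotient_ring_sum (T : finType) (F : T -> R) :
  \sum_t cls (F t) = cls (\sum_t F t).
Proof. by rewrite /cls raddf_sum. Qed.

Lemma quotient_ring_eq a b : cls a = cls b <-> I (a - b).
Proof. exact: quotient_classE. Qed.

(** The exponent is lowered from [p^(e+1)] to [p^e] by purity of one Frobenius. *)
Lemma F_pure_linear_system_mod (X Y : finType) (A : X -> Y -> R) e (b : Y -> R) (v : X -> R) :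
  (forall y, I (b y ^+ (p ^ e) - \sum_x v x * A x y ^+ (p ^ e))) ->
  exists u : X -> R, forall y, I (b y - \sum_x u x * A x y).
Proof.
elim: e A b v => [|e IHe] A b v bv.
  by exists v => y; have := bv y; rewrite expr1; under eq_bigr do rewrite expr1.
have [|u uE] := F_pure_linear_system p_gt0 pure
    (A := fun x y => cls (A x y ^+ (p ^ e))) (b := fun y => cls (b y ^+ (p ^ e)))
    (v := fun x => cls (v x)).
  move=> y; under eq_bigr do rewrite quotient_ringX quotient_ringM -exprM -expnSr.
  rewrite quotient_ringX quotient_ring_sum -exprM -expnSr.
  by apply/quotient_ring_eq; exact: bv.
apply: (IHe A b (fun x => repr (u x))) => y.
apply/quotient_ring_eq; rewrite uE -quotient_ring_sum; apply: eq_bigr => x _.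
by rewrite -quotient_ringM; congr (_ * _); rewrite /cls /quotient_class reprK.
Qed.

End PurityModulo.

(** * Local cohomology modules are artinian *)

Section Artinian.
Context (R : comPzRingType).

Definition dcc_in (V : lmodType R) (B : set V) : Prop :=
  forall N : nat -> submodule V, (forall n, N n `<=` B) ->
  (forall n, N n.+1 `<=` N n) ->
  exists n0, forall n, (n0 <= n)%N -> N n0 `<=` N n.

Definition artinian (V : lmodType R) : Prop := dcc_in (V := V) setT.

Lemma descending_le (V : lmodType R) (N : nat -> set V) :
  (forall n, N n.+1 `<=` N n) -> forall n k, (n <= k)%N -> N k `<=` N n.
Proof.
move=> Ndec n k /subnK <-; elim: (k - n)%N => // l IHl.
by apply: subset_trans IHl; rewrite addSn; exact: Ndec.
Qed.

(** [G] is a single-valued linear relation from [U] onto [B]: like a quotient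
    map, it transports the descending chain condition. *)
Lemma dcc_in_relation (U V : lmodType R) (B : set V) (G : U -> V -> Prop) :
  artinian U -> G 0 0 ->
  (forall a u v u' v', G u v -> G u' v' -> G (a *: u + u') (a *: v + v')) ->
  (forall v, G 0 v -> v = 0) -> (forall v, B v -> exists u, G u v) -> dcc_in B.
Proof.
move=> artU G0 GP Ginj Bsurj N NB Ndec.
pose P n : set U := [set u | exists2 v, N n v & G u v].
have P0 n : P n 0 by exists 0 => //; exact: submodule0.
have PP n a u w : P n u -> P n w -> P n (a *: u + w).
  move=> [v Nv Guv] [v' Nv' Gwv']; exists (a *: v + v'); last exact: GP.
  exact: submoduleP.
have [|n|n0 n0P] := artU (fun n => Submodule (P0 n) (@PP n)) _ _; first by [].
  by move=> u [v Nv Guv]; exists v => //; exact: Ndec.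
exists n0 => n n0n v Nv; have [u Guv] := Bsurj v (NB _ _ Nv).
have [|v' Nv' Guv'] := n0P n n0n u; first by exists v.
have -> : v = v'; last by [].
apply/eqP; rewrite -subr_eq0; apply/eqP; apply: Ginj.
by have := GP (-1) _ _ _ _ Guv' Guv; rewrite !scaleN1r addNr addrC.
Qed.

Lemma artinian_exact (A B C : lmodType R) (f : {linear A -> B}) (g : {linear B -> C}) :
  (forall b, g b = 0 -> exists a, f a = b) -> artinian A -> artinian C -> artinian B.
Proof.
move=> exact_fg artA artC N _ Ndec.
pose P n : set A := [set a | N n (f a)].
have P0 n : P n 0 by rewrite /P/= raddf0; exact: submodule0.
have PP n (a : R) u w : P n u -> P n w -> P n (a *: u + w).
  by rewrite /P/= linearP; exact: submoduleP.
have [|n|n1 n1P] := artA (fun n => Submodule (P0 n) (@PP n)) _ _; first by [].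
  by move=> a; exact: Ndec.
pose Q n : set C := [set c | exists2 b, N n b & c = g b].
have Q0 n : Q n 0 by exists 0; [exact: submodule0|rewrite raddf0].
have QP n (a : R) u w : Q n u -> Q n w -> Q n (a *: u + w).
  move=> [b Nb ->] [b' Nb' ->]; exists (a *: b + b'); last by rewrite linearP.
  exact: submoduleP.
have [|n|n2 n2P] := artC (fun n => Submodule (Q0 n) (@QP n)) _ _; first by [].
  by move=> _ [b Nb ->]; exists b => //; exact: Ndec.
pose n0 := (n1 + n2)%N; have Nle := descending_le (N := fun n => N n) Ndec.
exists n0 => n n0n b Nb.
have [|b' Nb' gb] := n2P n (leq_trans (leq_addl _ _) n0n) (g b).
  by exists b => //; apply: Nle Nb; exact: leq_addl.
have [|a aE] := exact_fg (b - b'); first by rewrite raddfB /= gb subrr.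
rewrite -(subrK b' b); apply: submoduleD => //; rewrite -aE.
apply: (n1P n (leq_trans (leq_addr _ _) n0n)); rewrite /= /P/= aE.
apply: submoduleB; first by apply: Nle Nb; exact: leq_addr.
by apply: Nle Nb'; apply: leq_trans n0n; exact: leq_addr.
Qed.

(** The submodules [z^k (N_n :&: (0 : z^(k+1)))] of [(0 : z)] decrease in both
    [n] and [k], so they are stationary in [n] uniformly in [k]; then [N_n] is
    stationary on each [(0 : z^k)] by induction on [k]. *)
Lemma artinian_torsion (V : lmodType R) (z : R) :
  (forall v : V, exists k, z ^+ k *: v = 0) ->
  dcc_in (V := V) [set v | z *: v = 0] -> artinian V.
Proof.
move=> tors dccz N _ Ndec.
have Nle := descending_le (N := fun n => N n) Ndec.
pose W n k : set V := [set v | exists w, [/\ N n w, z ^+ k.+1 *: w = 0 & v = z ^+ k *: w]].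
have W0 n k : W n k 0 by exists 0; split; rewrite ?scaler0//; exact: submodule0.
have WP n k (a : R) u v : W n k u -> W n k v -> W n k (a *: u + v).
  move=> [w [Nw zw ->]] [w' [Nw' zw' ->]]; exists (a *: w + w'); split.
  - exact: submoduleP.
  - by rewrite scalerDr scalerA mulrC -scalerA zw scaler0 zw' addr0.
  - by rewrite scalerDr !scalerA mulrC.
pose WS n k : submodule V := Submodule (W0 n k) (@WP n k).
have Wz n k : WS n k `<=` [set v | z *: v = 0].
  by move=> _ [w [_ zw ->]]; rewrite /= scalerA -exprS.
have Wn n n' k : (n <= n')%N -> W n' k `<=` W n k.
  by move=> nn' _ [w [Nw zw ->]]; exists w; split=> //; exact: Nle Nw.
have WkS n k : W n k.+1 `<=` W n k.
  move=> _ [w [Nw zw ->]]; exists (z *: w); split; rewrite ?scalerA -?exprSr//.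
  exact: submoduleZ.
have Wk n := descending_le (WkS n).
have [||n0 n0P] := dccz (fun n => WS n n).
- by move=> n; exact: Wz.
- by move=> n; apply: subset_trans (WkS _ _); exact: Wn.
have /choice[nk nkP] : forall k, exists n1, forall n, (n1 <= n)%N -> WS n1 k `<=` WS n k.
  move=> k; apply: (dccz (fun n => WS n k)) => n; first exact: Wz.
  exact: Wn.
pose n1 := (n0 + \max_(k < n0) nk k)%N.
have stab n k : (n1 <= n)%N -> W n1 k `<=` W n k.
  move=> n1n; have [kn0|n0k] := ltnP k n0.
    have nkn1 : (nk k <= n1)%N.
      apply: leq_trans (leq_addl n0 _).
      exact: (leq_bigmax (F := fun k : 'I_n0 => nk k) (Ordinal kn0)).
    apply: (subset_trans (Wn _ _ k nkn1)); apply: nkP; exact: leq_trans n1n.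
  have n0n1 : (n0 <= n1)%N := leq_addr _ _.
  apply: (subset_trans (Wn _ _ k n0n1)); apply: (subset_trans (Wk n0 _ _ n0k)).
  apply: (subset_trans (n0P (maxn n k) _)); first by rewrite leq_max n0k orbT.
  apply: (subset_trans (Wn n _ _ (leq_maxl n k))).
  by apply: Wk; exact: leq_maxr.
exists n1 => n n1n v Nv; have [k kE] := tors v.
elim: k v Nv kE => [|k IHk] v Nv kE.
  by rewrite expr0 scale1r in kE; rewrite kE; exact: submodule0.
have [|w [Nw zw vw]] := stab n k n1n (z ^+ k *: v); first by exists v.
rewrite -(subrK w v); apply: submoduleD => //; apply: IHk.
  by apply: submoduleB => //; exact: Nle Nw.
by rewrite scalerBr vw subrr.
Qed.

Lemma artinian_cyclic (m : ideal R) (V : lmodType R) (h0 : V) :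
  noetherian R -> local_ring m ->
  (forall h : V, exists a, h = a *: h0) -> (forall a : R, m a -> a *: h0 = 0) -> artinian V.
Proof.
move=> hN hm cyc mh0 N _ Ndec.
have [Nh0|/existsNP[n1 nNh0]] := pselect (forall n, N n h0).
  by exists 0%N => n _ h _; have [a ->] := cyc h; exact: submoduleZ.
exists n1 => n _ h; have [a ->] := cyc h => Nah0.
have [ma|nma] := pselect (m a); first by rewrite mh0//; exact: submodule0.
by case: nNh0; apply: (local_saturated hN hm nma).
Qed.

End Artinian.

Section CechComplex.
Context (R : comPzRingType) (r : nat) (x : 'I_r -> R).
Implicit Types (J : ideal R) (S T : {set 'I_r}).

Lemma koszul_sign_swap (j l : 'I_r) T : j \in T -> l \in T -> j != l ->
  koszul_sign R j T * koszul_sign R l (T :\ j) =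
  - (koszul_sign R l T * koszul_sign R j (T :\ l)).
Proof.
move=> jT lT jl.
have -> : koszul_sign R j T = (-1) ^+ (l < j)%N * koszul_sign R j (T :\ l).
  by rewrite -{1}(finset.setD1K lT) koszul_sign_setU1 ?finset.setD11.
have -> : koszul_sign R l T = (-1) ^+ (j < l)%N * koszul_sign R l (T :\ j).
  by rewrite -{1}(finset.setD1K jT) koszul_sign_setU1 ?finset.setD11.
have -> : (-1) ^+ (l < j)%N = - (-1) ^+ (j < l)%N :> R.
  case: (ltngtP j l) => [||/val_inj jlE]; rewrite ?expr1 ?expr0 ?opprK//.
  by rewrite jlE eqxx in jl.
ring.
Qed.

(** The terms indexed by [(j, l)] and [(l, j)] cancel. *)
Lemma koszul_diff_diff k (u : {set 'I_r} -> R) T :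
  koszul_diff x k (koszul_diff x k u) T = 0.
Proof.
pose F (j l : 'I_r) := koszul_sign R j T * koszul_sign R l (T :\ j) *
  (x j ^+ k * x l ^+ k * u (T :\ j :\ l)).
have FN j l : j \in T -> l \in T -> j != l -> F j l = - F l j.
  move=> jT lT jl; rewrite /F koszul_sign_swap// mulNr; congr (- (_ * _)).
  by rewrite (mulrC (x j ^+ k)); congr (_ * u _); apply/setP => h; rewrite !inE andbCA.
transitivity (\sum_(j in T) \sum_(l in T | l != j) F j l).
  apply: eq_bigr => j jT; rewrite !mulr_sumr; apply: eq_big => [l|l _].
    by rewrite in_setD1 andbC.
  by rewrite /F; ring.
pose Z := \sum_(j in T) \sum_(l in T | (j < l)%N) F j l.
transitivity (Z - Z); last exact: subrr.
rewrite (eq_bigr (fun j : 'I_r => \sum_(l in T | (j < l)%N) F j l +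
   \sum_(l in T | (l < j)%N) F j l)); last first.
  move=> j jT; rewrite (bigID (fun l : 'I_r => (j < l)%N))/=.
  congr (_ + _); apply: eq_bigl => l; rewrite -andbA; congr (_ && _).
    by case: eqP => [->|//]; rewrite ltnn.
  by rewrite -val_eqE/=; case: (ltngtP l j).
rewrite big_split/=; congr (_ + _).
rewrite /Z -sumrN.
under [RHS]eq_bigr do rewrite -sumrN.
rewrite [RHS](exchange_big_dep (mem T))/=; last by move=> j l _ /andP[].
apply: eq_bigr => j jT; apply: eq_big => [l|l /andP[lT lj]]; first by rewrite jT.
by apply: FN => //; rewrite -val_eqE/= gtn_eqF.
Qed.

Lemma cech_diff_diff J (c : cech_module x (quotient_module J)) :
  cech_diff (cech_diff c) = 0.
Proof.
have [n [u uE]] := koszul_frac_surj c 0.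
apply: functional_extensionality_dep => T.
rewrite (cech_diff_frac (k := (0 + n)%N) (u := koszul_diff x (0 + n) u)).
  by rewrite koszul_diff_diff koszul_frac0.
by move=> j _; rewrite (cech_diff_frac (k := (0 + n)%N) (u := u)).
Qed.

Lemma cech_diff_supported (M : lmodType R) (i : nat) (c : cech_module x M) :
  cech_supported (fun k => k.+1 == i) c -> cech_supported (fun k => k == i) (cech_diff c).
Proof.
move=> ci S Si; rewrite /cech_diff big1// => j jS; rewrite ci.
  have -> : (0 : localization M (cech_elt x (S :\ j))) = fraction _ 0 0 by [].
  by rewrite (localization_extE (cech_eltD1 x jS)) scaler0 fraction0 scaler0.
by rewrite -card_setD1S.
Qed.

End CechComplex.

(** ** The long exact sequence *)

Section LocalizationExact.
Context (R : comPzRingType) (M' M M'' : lmodType R) (w : R).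
Context (f : {linear M' -> M}) (g : {linear M -> M''}).

Lemma localization_map_inj : (forall u, f u = 0 -> u = 0) ->
  forall z, localization_map f (z : localization M' w) = 0 -> z = 0.
Proof.
move=> f_inj z; have [u [k ->]] := fraction_surj z.
rewrite localization_mapE => /fraction_eq0[n nE]; apply/fraction_eq0; exists n.
by apply: f_inj; rewrite linearZ.
Qed.

Lemma localization_map_surj : (forall v, exists u, g u = v) ->
  forall z : localization M'' w, exists y, localization_map g y = z.
Proof.
move=> g_surj z; have [v [k ->]] := fraction_surj z.
have [u <-] := g_surj v; exists (fraction w u k); exact: localization_mapE.
Qed.

Lemma localization_map_exact : (forall u, g u = 0 -> exists v, f v = u) ->
  forall z : localization M w, localization_map g z = 0 ->
  exists y, localization_map f y = z.
Proof.
move=> gf_exact z; have [u [k ->]] := fraction_surj z.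
rewrite localization_mapE => /fraction_eq0[n]; rewrite -linearZ => /gf_exact[v vE].
exists (fraction w v (k + n)); rewrite localization_mapE vE.
by rewrite -fraction_rescale.
Qed.

End LocalizationExact.

Section LongExactSequence.
Context (R : comPzRingType) (r : nat) (x : 'I_r -> R) (I' I I'' : ideal R).
Context (f : {linear quotient_module I' -> quotient_module I})
        (g : {linear quotient_module I -> quotient_module I''}).
Hypotheses (f_inj : forall u, f u = 0 -> u = 0) (g_surj : forall v, exists u, g u = v).
Hypotheses (gf0 : forall u, g (f u) = 0) (gf_exact : forall u, g u = 0 -> exists v, f v = u).

Local Notation F := (@cech_map R r x _ _ f).
Local Notation G := (@cech_map R r x _ _ g).

Let F_inj c : F c = 0 -> c = 0.
Proof.
move=> Fc; apply: functional_extensionality_dep => S; apply: (localization_map_inj f_inj).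
by rewrite -[LHS]/(F c S) Fc.
Qed.

Let GF0 c : G (F c) = 0.
Proof.
apply: functional_extensionality_dep => S; rewrite /cech_map.
have [u [k ->]] := fraction_surj (c S); rewrite !localization_mapE gf0.
exact: fraction0.
Qed.

Let G_surj D c : cech_supported D c -> exists2 b, cech_supported D b & G b = c.
Proof.
move=> cD.
have lift S : {b : localization (quotient_module I) (cech_elt x S) |
    (~~ D #|S| -> b = 0) /\ localization_map g b = c S}.
  apply: cid; have [DS|DS] := boolP (D #|S|).
    by have [b bE] := localization_map_surj g_surj (c S); exists b.
  by exists 0; rewrite cD// raddf0.
exists (fun S => sval (lift S)) => [S DS|].
  by have [+ _] := svalP (lift S); exact.
apply: functional_extensionality_dep => S.
by have [_ bE] := svalP (lift S).
Qed.

Let GF_exact D c : cech_supported D c -> G c = 0 -> exists2 b, cech_supported D b & F b = c.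
Proof.
move=> cD Gc.
have lift S : {b : localization (quotient_module I') (cech_elt x S) |
    localization_map f b = c S}.
  apply: cid; apply: (localization_map_exact gf_exact).
  by rewrite -[LHS]/(G c S) Gc.
exists (fun S => sval (lift S)) => [S DS|].
  by apply: (localization_map_inj f_inj); rewrite (svalP (lift S)) cD.
apply: functional_extensionality_dep => S; exact: svalP (lift S).
Qed.

Lemma local_cohomology_exact i h : local_cohomology_map x g i h = 0 ->
  exists h', local_cohomology_map x f i h' = h.
Proof.
have [z ->] := quotient_class_surj h.
rewrite local_cohomology_mapE => /quotient_class_eq0[c'' c''i /= zc''].
have [c ci Gc] := G_surj c''i; have [zi dz] := submodule_valP z.
have ei : cech_supported (fun k => k == i) (submodule_val z - cech_diff c).
  move=> S Si; rewrite -[LHS]/(submodule_val z S - cech_diff c S).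
  by rewrite zi// (cech_diff_supported ci)// subrr.
have [|b bi Fb] := GF_exact ei.
  by rewrite raddfB/= -cech_map_diff Gc zc'' subrr.
have db : cech_diff b = 0.
  by apply: F_inj; rewrite -cech_map_diff Fb raddfB/= dz cech_diff_diff subrr.
have bz : cech_cocycles x (quotient_module I') i b by [].
exists (quotient_class _ (submodule_of bz)); rewrite local_cohomology_mapE.
apply/quotient_classE; exists (- c).
  by move=> S Si; rewrite -[LHS]/(- c S) ci// oppr0.
by rewrite /= Fb raddfN /= addrC addKr.
Qed.

(** The graph of the connecting map [H^i(R/I'') -> H^(i+1)(R/I')]: as a relation
    it avoids choosing the lift [c] of [w]. *)
Let connecting i (a : local_cohomology x (quotient_module I'') i)
    (b : local_cohomology x (quotient_module I') i.+1) : Prop :=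
  exists c w e, [/\ cech_supported (fun k => k == i) c,
    a = quotient_class _ w, b = quotient_class _ e,
    submodule_val w = G c & F (submodule_val e) = cech_diff c].

Lemma dcc_kernel i : artinian (local_cohomology x (quotient_module I'') i) ->
  dcc_in [set b | local_cohomology_map x f i.+1 b = 0].
Proof.
move=> art; apply: (dcc_in_relation (G := connecting (i := i)) art).
- exists 0, 0, 0; split; rewrite ?raddf0//; exact: cech_supported0.
- move=> a u v u' v' [c [w [e [ci -> -> wE eE]]]] [c' [w' [e' [c'i -> -> w'E e'E]]]].
  exists (a *: c + c'), (a *: w + w'), (a *: e + e'); split; rewrite ?linearP//=.
  + exact: cech_supportedP.
  + by rewrite wE w'E.
  + by rewrite eE e'E.
- move=> _ [c [w [e [ci w0 -> wE eE]]]].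
  have /quotient_class_eq0[c'' c''i wc''] := esym w0.
  have [b bi Gb] := G_surj c''i.
  have [||a ai Fa] := GF_exact (D := fun k => k == i) (c := c - cech_diff b).
  + move=> S Si; rewrite -[LHS]/(c S - cech_diff b S).
    by rewrite ci// (cech_diff_supported bi)// subrr.
  + by rewrite raddfB/= -cech_map_diff Gb -wc'' wE subrr.
  apply/quotient_class_eq0; exists a; first exact: ai.
  apply/eqP; rewrite -subr_eq0; apply/eqP; apply: F_inj.
  by rewrite raddfB/= eE -cech_map_diff Fa raddfB/= cech_diff_diff subr0 subrr.
- move=> v /=; have [e ->] := quotient_class_surj v.
  rewrite local_cohomology_mapE => /quotient_class_eq0[c ci /= Fe].
  have Gcz : cech_cocycles x (quotient_module I'') i (G c).
    by split; [exact: cech_map_supported|rewrite cech_map_diff -Fe GF0].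
  by exists (quotient_class _ (submodule_of Gcz)), c, (submodule_of Gcz), e.
Qed.

Lemma dcc_kernel0 : dcc_in [set b | local_cohomology_map x f 0 b = 0].
Proof.
move=> N NB _; exists 0%N => n _ v /NB /=.
have [e ->] := quotient_class_surj v.
rewrite local_cohomology_mapE => /quotient_class_eq0[c ci /= Fe].
have c0 : c = 0 by apply: functional_extensionality_dep => S; exact: ci.
have e0 : submodule_val e = 0 by apply: F_inj; rewrite Fe c0 raddf0.
have -> : e = 0 by exact: val_inj.
by rewrite raddf0; exact: submodule0.
Qed.

End LongExactSequence.

Section LocalCohomologyArtinian.
Context (R : comPzRingType) (m : ideal R) (hN : noetherian R) (hm : local_ring m).
Context (r : nat) (x : 'I_r -> R) (hx : (m : set R) = generated_ideal (range x)).

Let xm j : m (x j).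
Proof. by rewrite -[m _]/((m : set R) _) hx; apply: generated_sub; exists j. Qed.

Section Multiplication.
Context (z : R).

Definition multiplication (a : R^o) : R^o := a * z.

Lemma multiplication_is_linear : linear multiplication.
Proof. by move=> a u v; rewrite /multiplication mulrDl /GRing.scale/= mulrA. Qed.

HB.instance Definition _ := GRing.isLinear.Build R R^o R^o _ multiplication
  multiplication_is_linear.

Context (L I : ideal R) (LI : forall a, L a -> I (a * z)).

Definition multiplication_map of (forall a, L a -> I (a * z)) :=
  @quotient_map R R^o R^o L I multiplication.

Lemma multiplication_mapE a :
  multiplication_map LI (quotient_class L a) = quotient_class I (a * z).
Proof. exact: (@quotient_mapE R R^o R^o L I multiplication LI). Qed.

Lemma multiplication_map_is_linear : linear (multiplication_map LI).
Proof. exact: (@quotient_map_linear R R^o R^o L I multiplication LI). Qed.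

HB.instance Definition _ := GRing.isLinear.Build R (quotient_module L)
  (quotient_module I) _ (multiplication_map LI) multiplication_map_is_linear.

End Multiplication.

Let residue_field i : artinian (local_cohomology x (quotient_module m) i).
Proof.
case: i => [|i]; last first.
  apply: (artinian_cyclic (h0 := 0) hN hm) => [h|a _]; last exact: scaler0.
  exists 0; rewrite scaler0; have [k [u [_ uh]]] := represents_surj h 0.
  apply/(represents_eq0 uh); exists 1%N, (fun=> 0) => S Si.
  rewrite [koszul_diff _ _ _ _]big1 => [|j _]; last by rewrite !mulr0.
  have /card_gt0P[j jS] : (0 < #|S|)%N by rewrite Si.
  by rewrite subr0 expr1 (cech_eltD1 x jS) -mulrA; apply: idealMl; exact: idealMr.
have hu : koszul_cocycle x m 0 1 (fun=> 1).
  by move=> T _; apply: ideal_sum => j _; apply: idealMl; apply: idealMr; rewrite expr1.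
have [h0 uh0] := represents_exists hu.
apply: (artinian_cyclic (h0 := h0) hN hm) => [h|a ma]; last first.
  have := representsP a uh0 (represents0 x m 0 1); rewrite !addr0 => auh.
  apply/(represents_eq0 auh); exists 0%N, (fun=> 0) => S _.
  rewrite [koszul_diff _ _ _ _]big1 => [|j _]; last by rewrite !mulr0.
  by rewrite subr0 mul1r mulr1.
have [k [u [_ uh]]] := represents_surj h 1.
exists (u finset.set0).
have := representsP (u finset.set0) (represents_rescale k uh0) (represents0 x m 0 (1 + k)).
rewrite addr0 => uh0'; apply: (represents_inj uh); apply: (represents_mod uh0') => S.
move=> /eqP; rewrite cards_eq0 => /eqP ->.
rewrite /koszul_rescale /cech_elt big_set0 expr1n !mulr1 addr0 subrr.
exact: ideal0.
Qed.

(** Noetherian induction on [I], as for flatness: along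
    [0 -> R/(I : z) -> R/I -> R/(I + (z)) -> 0] the artinian property passes to
    the middle term; if [z] is regular on [R/I] the kernel of [z] on
    [H^i(R/I)] is a quotient of [H^(i-1)(R/(I + (z)))], and [H^i(R/I)] is
    [z]-torsion. *)
Lemma local_cohomology_artinian (I : ideal R) i :
  artinian (local_cohomology x (quotient_module I) i).
Proof.
elim/(noetherian_ind hN) : I i => I IH i.
have [I1|nI1] := pselect (I 1).
  apply: (artinian_cyclic (h0 := 0) hN hm) => [h|a _]; last exact: scaler0.
  exists 0; rewrite scaler0; have [k [u [_ uh]]] := represents_surj h 0.
  by apply/(represents_eq0 uh); exists 0%N, (fun=> 0) => S _; exact: ideal_eq1.
have Im := local_proper hN hm nI1.
have [xI|/existsNP[j nIx]] := pselect (forall j, I (x j)).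
  have -> : I = m.
    apply: ideal_ext => //; rewrite hx; apply: (generated_min (N := I)).
    by move=> _ [j _ <-]; exact: xI.
  exact: residue_field.
pose z := x j; pose g := quotient_proj (adjoin_sub (J := I) z).
have g_surj v : exists u, g u = v.
  have [a ->] := quotient_class_surj v.
  by exists (quotient_class I a); exact: quotient_projE.
have Iz_art i' : artinian (local_cohomology x (quotient_module (adjoin I z)) i').
  apply: IH; first exact: adjoin_sub.
  by move=> sub; apply: nIx; apply: sub; exact: adjoin_mem.
have seq_exact (L : ideal R) (LI : forall a, L a -> I (a * z)) :
    (forall a, I (a * z) -> L a) ->
    [/\ forall u, multiplication_map LI u = 0 -> u = 0,
        forall u, g (multiplication_map LI u) = 0 &
        forall u, g u = 0 -> exists v, multiplication_map LI v = u].
  move=> IL; split=> u; have [a ->] := quotient_class_surj u.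
  - rewrite multiplication_mapE => /quotient_class_eq0 Iaz.
    by apply/quotient_class_eq0; exact: IL.
  - rewrite multiplication_mapE /g quotient_projE; apply/quotient_class_eq0.
    by apply: idealMl; exact: adjoin_mem.
  - rewrite /g quotient_projE => /quotient_class_eq0[b Ib [c aE]].
    exists (quotient_class L c); rewrite multiplication_mapE; apply/quotient_classE.
    have -> : c * z - a = - b by rewrite aE; ring.
    exact: submoduleN.
have [colI|ncolI] := pselect (forall a, I (a * z) -> I a).
  have LI a : I a -> I (a * z) by exact: idealMr.
  have [f_inj gf0 gf_exact] := seq_exact I LI colI.
  pose f : {linear quotient_module I -> quotient_module I} := multiplication_map LI.
  have fE h : local_cohomology_map x f i h = z *: h.
    have [k [u [_ uh]]] := represents_surj h 0.
    have [w ->] := quotient_class_surj h; rewrite local_cohomology_mapE -linearZ.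
    congr quotient_class; apply: val_inj => /=.
    apply: functional_extensionality_dep => S.
    rewrite /cech_map -[RHS]/(z *: submodule_val w S).
    have [v [l ->]] := fraction_surj (submodule_val w S).
    rewrite localization_mapE fractionZ; congr fraction.
    have [a ->] := quotient_class_surj v.
    by rewrite /f [LHS]multiplication_mapE quotient_classZ mulrC.
  apply: (artinian_torsion (z := z)).
    move=> h; have [k [u [hu uh]]] := represents_surj h 0.
    by exists (0 + k)%N; exact: represents_torsion hu uh.
  have -> : [set v : local_cohomology x (quotient_module I) i | z *: v = 0] =
      [set v | local_cohomology_map x f i v = 0].
    by apply/seteqP; split=> v /=; rewrite fE.
  case: {fE} i => [|i]; first exact: dcc_kernel0.
  exact: (dcc_kernel f_inj g_surj gf0 gf_exact).
have LI a : colon I z a -> I (a * z) by [].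
have [f_inj gf0 gf_exact] := seq_exact (colon I z) LI (fun=> id).
pose f : {linear quotient_module (colon I z) -> quotient_module I} := multiplication_map LI.
apply: (artinian_exact (f := local_cohomology_map x f i) (g := local_cohomology_map x g i)).
- exact: (local_cohomology_exact f_inj g_surj gf_exact).
- by apply: IH; [exact: colon_sub|].
- exact: Iz_art.
Qed.

End LocalCohomologyArtinian.

(** * F-pure rings are F-full *)

Section FrobeniusSpan.
Context (R : comNzRingType) (p : nat) (hp : p \in [pchar R]).
Context (r : nat) (x : 'I_r -> R) (I : ideal R) (i : nat).
Implicit Types (e k : nat) (u : {set 'I_r} -> R).

Let phi e : {rmorphism R -> R} := frobenius_power e hp.

Let phiE e a : phi e a = a ^+ (p ^ e). Proof. by []. Qed.

Let p_gt0 : (0 < p)%N. Proof. exact: prime_gt0 (pcharf_prime hp). Qed.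

Let q_gt0 e : (0 < p ^ e)%N. Proof. by rewrite expn_gt0 p_gt0. Qed.

Lemma ideal_map_frobenius_sub e (J : ideal R) : ideal_map (phi e) J `<=` J.
Proof.
by apply: (generated_min (N := J)) => _ [a Ja <-]; rewrite phiE; exact: idealX.
Qed.

Lemma koszul_cocycle_frobenius e (J : ideal R) k u : ideal_map (phi e) I `<=` J ->
  koszul_cocycle x I i k u -> koszul_cocycle x J i (k * p ^ e) (fun S => u S ^+ (p ^ e)).
Proof.
by move=> IJ hu T Ti; apply: IJ; exact: (koszul_cocycle_phi (phiE e) hu Ti).
Qed.

Lemma koszul_cocycle_sum (J : ideal R) k n (s : 'I_n -> R) (C : 'I_n -> {set 'I_r} -> R) :
  (forall t, koszul_cocycle x J i k (C t)) ->
  koszul_cocycle x J i k (fun S => \sum_t s t * C t S).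
Proof.
move=> hC T Ti; rewrite koszul_diff_sum; apply: ideal_sum => t _.
by apply: idealMl; exact: hC.
Qed.

(** The submodule generated by the image of the [e]-th Frobenius of [H^i(R/I)]. *)
Definition frobenius_span_set e : set (local_cohomology x (quotient_module I) i) :=
  [set h | exists k n (s : 'I_n -> R) (C : 'I_n -> {set 'I_r} -> R),
    (forall t, koszul_cocycle x I i k (C t)) /\
    represents (k * p ^ e) (fun S => \sum_t s t * C t S ^+ (p ^ e)) h].

Lemma frobenius_span_set0 e : frobenius_span_set e 0.
Proof.
exists 0%N, 0%N, (fun=> 0), (fun _ _ => 0); split=> [[]//|].
by under eq_fun do rewrite big_ord0; exact: represents0.
Qed.

Let span_rescale e k n (s : 'I_n -> R) (C : 'I_n -> {set 'I_r} -> R) l h :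
  represents (x := x) (J := I) (i := i) (k * p ^ e)
    (fun S => \sum_t s t * C t S ^+ (p ^ e)) h ->
  represents ((k + l) * p ^ e)
    (fun S => \sum_t s t * koszul_rescale x l (C t) S ^+ (p ^ e)) h.
Proof.
move=> /(represents_rescale (l * p ^ e)); rewrite -mulnDl; congr represents.
apply: funext => S; rewrite /koszul_rescale mulr_sumr; apply: eq_bigr => t _.
by rewrite exprMn exprM; ring.
Qed.

Lemma frobenius_span_setP e a h h' :
  frobenius_span_set e h -> frobenius_span_set e h' -> frobenius_span_set e (a *: h + h').
Proof.
move=> [k [n [s [C [hC Ch]]]]] [k' [n' [s' [C' [hC' Ch']]]]].
exists (k + k')%N, (n + n')%N,
  (fun t => match fintype.split t with inl t1 => a * s t1 | inr t2 => s' t2 end),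
  (fun t => match fintype.split t with
    | inl t1 => koszul_rescale x k' (C t1)
    | inr t2 => koszul_rescale x k (C' t2) end); split.
  move=> t; case: (fintype.split t) => t1; first exact: koszul_cocycle_rescale.
  by rewrite addnC; exact: koszul_cocycle_rescale.
have Ch'k := span_rescale k Ch'; rewrite addnC in Ch'k.
have := representsP a (span_rescale k' Ch) Ch'k; congr represents.
apply: funext => S; rewrite big_split_ord mulr_sumr/=; congr (_ + _).
  apply: eq_bigr => t _; rewrite (unsplitK (inl t) : fintype.split (lshift n' t) = _).
  by rewrite mulrA.
by apply: eq_bigr => t _; rewrite (unsplitK (inr t) : fintype.split (rshift n t) = _).
Qed.

Definition frobenius_span e : submodule (local_cohomology x (quotient_module I) i) :=
  Submodule (frobenius_span_set0 e) (@frobenius_span_setP e).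

Lemma frobenius_spanS e : frobenius_span e.+1 `<=` frobenius_span e.
Proof.
move=> h [k [n [s [C [hC Ch]]]]]; exists (k * p ^ 1)%N, n, s, (fun t S => C t S ^+ (p ^ 1)).
split=> [t|].
  by apply: koszul_cocycle_frobenius (hC t); exact: ideal_map_frobenius_sub.
move: Ch; rewrite -mulnA -expnD add1n; congr represents; apply: funext => S.
by apply: eq_bigr => t _; rewrite -exprM -expnD add1n.
Qed.

Hypotheses (art : artinian (local_cohomology x (quotient_module I) i)).
Hypothesis pure : F_pure (quotient_ring I) p.

(** The spans of the iterated Frobenius images are stationary from some [e0]
    on, so that [F^e0 h] is a combination of elements [F^(e0+e) h'] modulo
    coboundaries. Purity of [F^e0] removes the exponent [p^e0] from this linear
    system and leaves [h] as a combination of elements [F^e h']. *)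
Lemma frobenius_span_full e h : frobenius_span e h.
Proof.
have [e0 e0P] := art (fun n => @subsetT _ (frobenius_span n)) frobenius_spanS.
have [k [u [hu uh]]] := represents_surj h 0; rewrite add0n in hu uh.
set q0 := (p ^ e0)%N; set q := (p ^ e)%N.
have q0_gt0 : (0 < q0)%N by exact: q_gt0.
have [H uH] : exists H : local_cohomology x (quotient_module I) i,
    represents (k * q0) (fun S => u S ^+ q0) H.
  apply: represents_exists.
  by apply: koszul_cocycle_frobenius hu; exact: ideal_map_frobenius_sub.
have [K [n [s [C [hC CH]]]]] : frobenius_span (e0 + e) H.
  apply: (e0P (e0 + e)%N (leq_addr _ _)).
  exists k, 1%N, (fun=> 1), (fun=> u); split=> //.
  by under eq_fun do rewrite big_ord1 mul1r.
have {}CH : represents (K * q * q0) (fun S => \sum_t s t * (C t S ^+ q) ^+ q0) H.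
  move: CH; rewrite addnC expnD mulnA; congr represents; apply: funext => S.
  by apply: eq_bigr => t _; rewrite -exprM.
pose uK := koszul_rescale x (K * q) u.
pose Ck t := koszul_rescale x k (fun S => C t S ^+ q).
have uKH : represents ((k + K * q) * q0) (fun S => uK S ^+ q0) H.
  have := represents_rescale (K * q * q0) uH; rewrite -mulnDl; congr represents.
  by apply: funext => S; rewrite /koszul_rescale /uK /koszul_rescale exprMn exprM.
have CkH : represents ((k + K * q) * q0) (fun S => \sum_t s t * Ck t S ^+ q0) H.
  have := represents_rescale (k * q0) CH; rewrite -mulnDl addnC; congr represents.
  apply: funext => S; rewrite /koszul_rescale mulr_sumr; apply: eq_bigr => t _.
  by rewrite /Ck /koszul_rescale exprMn exprM; ring.
have := representsP (-1) CkH uKH; rewrite scaleN1r addNr => d0.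
have [N [v NvE]] := (represents_eq0 d0).1 erefl.
pose N' := (N * q0 - N)%N.
have NN' : (N + N' = N * q0)%N by rewrite subnKC// leq_pmulr.
pose v' := koszul_rescale x N' v; pose k' := (k + K * q + N)%N.
(* [X = inl t] stands for the class of [C t]^q, [X = inr S'] for the boundary of S'. *)
pose A (X : 'I_n + {set 'I_r}) (S : {set 'I_r}) := if #|S| == i then
  (match X with inl t => cech_elt x S ^+ N * Ck t S | inr S' => koszul_mx x k' S' S end)
  else 0.
pose b (S : {set 'I_r}) := if #|S| == i then cech_elt x S ^+ N * uK S else 0.
pose c (X : 'I_n + {set 'I_r}) := match X with inl t => s t | inr S' => v' S' end.
have [S|w wE] := F_pure_linear_system_mod p_gt0 pure (A := A) (e := e0) (b := b) (v := c).
  rewrite /A /b; case: eqP => [Si|_]; last first.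
    rewrite big1 => [|X _]; last by rewrite expr0n expn_eq0 -leqn0 leqNgt p_gt0/= mulr0.
    by rewrite expr0n expn_eq0 -leqn0 leqNgt p_gt0/= subr0; exact: ideal0.
  rewrite big_sumType/=.
  have -> : \sum_S' v' S' * koszul_mx x k' S' S ^+ (p ^ e0) = koszul_diff x (k' * q0) v' S.
    by rewrite koszul_diffE; apply: eq_bigr => S' _; rewrite (koszul_mx_phi x (phiE e0)).
  rewrite /k' mulnDl -NN' addnA koszul_diff_rescale.
  have := NvE S Si => /(idealMl (cech_elt x S ^+ N')).
  have NqE : cech_elt x S ^+ N' * cech_elt x S ^+ N = (cech_elt x S ^+ N) ^+ q0.
    by rewrite -exprD addnC NN' exprM.
  have -> : \sum_t s t * (cech_elt x S ^+ N * Ck t S) ^+ (p ^ e0) =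
      (cech_elt x S ^+ N) ^+ q0 * \sum_t s t * Ck t S ^+ q0.
    by rewrite mulr_sumr; apply: eq_bigr => t _; rewrite exprMn; ring.
  by congr (I _); rewrite [(_ * uK S) ^+ _]exprMn -/q0 -NqE /koszul_rescale; ring.
pose g S := \sum_t w (inl t) * C t S ^+ q.
have [h1 gh1] : exists h1, represents (x := x) (J := I) (i := i) (K * q) g h1.
  apply: represents_exists; apply: koszul_cocycle_sum => t.
  by apply: koszul_cocycle_frobenius (hC t); exact: ideal_map_frobenius_sub.
suff <- : h1 = h by exists K, n, (fun t => w (inl t)), C.
have uhK := represents_rescale (K * q) uh.
have gh1k := represents_rescale k gh1; rewrite addnC in gh1k.
have dh := representsP (-1) gh1k uhK.
suff : -1 *: h1 + h = 0.
  by rewrite scaleN1r addrC => /eqP; rewrite subr_eq0 => /eqP.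
apply/(represents_eq0 dh); exists N, (fun S' => w (inr S')) => S Si.
have := wE S; rewrite /A /b Si eqxx big_sumType/= koszul_diffE.
have -> : \sum_t w (inl t) * (cech_elt x S ^+ N * Ck t S) =
    cech_elt x S ^+ N * koszul_rescale x k g S.
  rewrite /koszul_rescale /g !mulr_sumr; apply: eq_bigr => t _.
  by rewrite /Ck /koszul_rescale; ring.
by congr (I _); rewrite /uK; ring.
Qed.

End FrobeniusSpan.

(** If [I] is contained in the radical of [J] then [I^[q] <= J] for a power [q]
    of [p], and Frobenius images of classes of [R/I] lift to [R/J]. *)
Lemma F_pure_F_full (R : comNzRingType) (m : ideal R) (p d : nat)
    (hR : regular_local_ring m d) (hp : p \in [pchar R])
    (r : nat) (x : 'I_r -> R) (hx : (m : set R) = generated_ideal (range x))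
    (I : ideal R) : F_pure (quotient_ring I) p -> F_full x I.
Proof.
move=> pure i J JI IJ h; have [hN hm _ _] := hR.
have p_gt1 : (1 < p)%N := prime_gt1 (pcharf_prime hp).
have [s sE] := finitely_generated_adjoins (hN I).
have [e eP] : exists e, forall y, y \in s -> J (y ^+ (p ^ e)).
  have : forall y, y \in s -> exists n, J (y ^+ n).
    by move=> y ys; apply: IJ; rewrite sE; exact: adjoins_mem.
  elim: {sE} s => [|y s IHs] sJ; first by exists 0%N.
  have [z zs|e eP] := IHs; first by apply: sJ; rewrite inE zs orbT.
  have [n Jn] := sJ y (mem_head _ _).
  have powJ a k l : (k <= l)%N -> J (a ^+ k) -> J (a ^+ l).
    by move=> /subnK <- Ja; rewrite exprD; exact: idealMl.
  exists (e + n)%N => z; rewrite inE => /predU1P[->|/eP].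
    apply: powJ Jn; apply: (leq_trans (leq_addl e n)).
    by apply: ltnW; exact: ltn_expl.
  by apply: powJ; rewrite leq_exp2l// leq_addr.
have IeJ : ideal_map (frobenius_power e hp) I `<=` J.
  have [n [a aI]] := noetherian_generates I hN.
  apply: (generated_min (N := J)) => _ [b Ib <-].
  rewrite sE in Ib; elim: s eP b Ib {sE aI} => [|y s IHs] eP b.
    by move=> ->; rewrite rmorph0; exact: ideal0.
  rewrite /= adjoins_adjoin => -[b' b's [c ->]]; rewrite rmorphD rmorphM.
  apply: idealD; last by apply: idealMl; apply: eP; exact: mem_head.
  by apply: IHs b's => z zs; apply: eP; rewrite inE zs orbT.
have art := @local_cohomology_artinian _ _ hN hm _ _ hx I i.
have [k [n [c [C [hC Ch]]]]] := frobenius_span_full hp art pure e h.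
have [h' Ch'] : exists h', represents (x := x) (J := J) (i := i) (k * p ^ e)
    (fun S => \sum_t c t * C t S ^+ (p ^ e)) h'.
  apply: represents_exists; apply: koszul_cocycle_sum => t.
  exact: koszul_cocycle_frobenius IeJ (hC t).
by exists h'; exact: represents_inj (represents_map JI Ch') Ch.
Qed.

(** * Growth of the lengths *)

Theorem theorem6p1 (K : realType) (R : comNzRingType) (m : ideal R) (p d : nat)
    (hR : regular_local_ring m d) (hp : p \in [pchar R])
    (r : nat) (x : 'I_r -> R) (hx : (m : set R) = generated_ideal (range x))
    (I : ideal R) :
  (F_pure (quotient_ring I) p -> F_full x I) /\
  (F_full x I -> forall i : nat,
     (exists h : local_cohomology x (quotient_module I) i, h <> 0) ->
     (0 < limn_einf (fun n : nat =>
        module_length K (local_cohomology x (quotient_module (ideal_pow I n)) i)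
        * ((n%:R ^+ d)^-1)%:E))%E).
Proof.
have [hN _ _ _] := hR.
split=> [pure|full i [h h0]]; first exact: (F_pure_F_full hR hp hx pure).
have [s sE] := finitely_generated_adjoins (hN I).
exact: (liminf_length_gt0 K hR hp sE full h0).
Qed.
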